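(* Let $(H,R)$ be a semisimple quasi-triangular Hopf algebra over a field $k$ of characteristic zero, let $A$ be a nonzero strongly separable quantum commutative left $H$-module algebra, and let $(B,R_B)$, $B=A\otimes H\otimes A^*\cong\operatorname{End}A^*\otimes H$, be the quasi-triangular weak Hopf algebra defined in the context. Then, as braided tensor categories, ${}_B\mathcal M$ is equivalent to ${}_H\mathcal M$.
   Context: All algebras and coalgebras are over $k$; Sweedler notation is used and $S$ is the antipode of $H$. A quasi-triangular Hopf algebra is a pair $(H,R)$, $R=R^1\otimes R^2\in H\otimes H$ invertible, with $R^1h_{(1)}\otimes R^2h_{(2)}=h_{(2)}R^1\otimes h_{(1)}R^2$ for all $h\in H$, $(\Delta\otimes id)(R)=R_1^1\otimes R_2^1\otimes R_1^2R_2^2$, $(id\otimes\Delta)(R)=R_1^1R_2^1\otimes R_2^2\otimes R_1^2$. Here $R_i=R_i^1\otimes R_i^2$ are copies of $R$ and $x_i=x_i^1\otimes x_i^2$ copies of $x$ (lower index: copy; upper index: tensor leg). A left $H$-module algebra $A$ is quantum commutative if $ab=(R^2\cdot b)(R^1\cdot a)$ for all $a,b\in A$. $A$ is strongly separable if it has a symmetric separability idempotent $x=x^1\otimes x^2\in A\otimes A$, i.e. $ax^1\otimes x^2=x^1\otimes x^2a$, $x^1x^2=1_A$, $x^1\otimes x^2=x^2\otimes x^1$. $\alpha_A\in A^*$ is determined by $\langle\alpha_A,x^1\rangle x^2=1_A$. For $a,b\in A$, $a^*\in A^*$, $h\in H$: $\langle a\rightharpoonup a^*,b\rangle=\langle a^*,ba\rangle$,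 $\langle a^*\leftharpoonup a,b\rangle=\langle a^*,ab\rangle$, $\langle a^*\vartriangleleft h,b\rangle=\langle a^*,h\cdot b\rangle$, and $\langle a^*_{(1)},a\rangle\langle a^*_{(2)},b\rangle=\langle a^*,ab\rangle$. $B=A\otimes H\otimes A^*$ has product $(a\otimes h\otimes a^* )(b\otimes g\otimes b^* )=\langle b^*,a\rangle b\otimes hg\otimes a^*$, unit $x^1\otimes1_H\otimes(x^2\rightharpoonup\alpha_A)$, and $\Delta_B(a\otimes h\otimes a^* )=((R_1^2\cdot x^1)a\otimes R_2^1h_{(1)}R_1^1\otimes a^*_{(2)})\otimes(x^2\otimes h_{(2)}\otimes a^*_{(1)}\vartriangleleft R_2^2)$, $\varepsilon_B(a\otimes h\otimes a^* )=\langle\alpha_A,a\rangle\varepsilon(h)\langle a^*,1_A\rangle$, $S_B(a\otimes h\otimes a^* )=\langle a^*\vartriangleleft R_2^2,x^1\rangle x^2\otimes R_1^1S(R_2^1h)\otimes\alpha_A\leftharpoonup(R_1^2\cdot a)$, $R_B=((R_3^2\cdot x_2^1)x_1^1\otimes R_2^1R_3^1\otimes\alpha_{A(1)}\vartriangleleft R_1^2)\otimes(x_2^2\otimes R_1^1R_2^2\otimes(x_1^2\rightharpoonup\alpha_{A(2)}))$. With these, $(B,R_B)$ is a quasi-triangular weak Hopf algebra. For a (weak) Hopf algebra $L$ with R-matrix $R$, ${}_L\mathcal M$ is the category of finite dimensional left $L$-modules with the usual tensor product induced by the coproduct ($V\otimes W=\Delta(1)(V\otimes_kW)$ in the weak case)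 and braiding $v\otimes w\mapsto R^2w\otimes R^1v$. *)

(* Defs.v *)
From HB Require Import structures.
From mathcomp Require Import all_boot all_algebra all_field.

Set Implicit Arguments.
Unset Strict Implicit.
Unset Printing Implicit Defensive.

Import GRing.Theory VectorInternalTheory.
Local Open Scope ring_scope.

(* The tensor product over k of finite dimensional spaces: the entry (i, j) of
   an element is its coordinate on [bvec i ⊗ bvec j], where [bvec] is the basis
   given by [r2v]; see [sw_tens] for the universal property. *)
Definition tensor (k : fieldType) (V W : vectType k) : Type :=
  'M[k]_(dim V, dim W).
HB.instance Definition _ (k : fieldType) (V W : vectType k) :=
  Vector.copy (tensor V W) 'M[k]_(dim V, dim W).

Definition bvec (k : fieldType) (V : vectType k) (i : 'I_(dim V)) : V :=
  r2v (delta_mx 0 i).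

Definition tens (k : fieldType) (V W : vectType k) (v : V) (w : W) : tensor V W :=
  (v2r v)^T *m v2r w.

(* Sweedler notation: [\sw_(a, b <- t) F a b] is the image of [t] under the
   linear map which sends [bvec i ⊗ bvec j] to [F (bvec i) (bvec j)]. For
   bilinear [F] this is the usual meaning of the sum of the [F t^1 t^2], cf.
   [sw_tens] and [tens_sw]. *)
Definition sweedler (k : fieldType) (V W : vectType k) (X : lmodType k)
    (t : tensor V W) (f : V -> W -> X) : X :=
  \sum_i \sum_j (t : 'M_(_, _)) i j *: f (bvec i) (bvec j).

Notation "v ⊗ w" := (tens v w) (at level 40, left associativity) : ring_scope.
Notation "'\sw_' ( a , b <- t ) F" := (sweedler t (fun a b => F))
  (at level 41, F at level 41, a name, b name, t at level 50,
   format "'[' \sw_ ( a ,  b  <-  t ) '/  '  F ']'") : ring_scope.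

Definition sweedler3 (k : fieldType) (U V W : vectType k) (X : lmodType k)
    (t : tensor U (tensor V W)) (f : U -> V -> W -> X) : X :=
  \sw_(a, u <- t) \sw_(b, c <- u) f a b c.
Notation "'\sw_' ( a , b , c <- t ) F" := (sweedler3 t (fun a b c => F))
  (at level 41, F at level 41, a name, b name, c name, t at level 50,
   format "'[' \sw_ ( a ,  b ,  c  <-  t ) '/  '  F ']'") : ring_scope.

Definition lin (k : fieldType) (V X : lmodType k) (f : V -> X) : Prop := linear f.
Definition bil (k : fieldType) (V W X : lmodType k) (f : V -> W -> X) : Prop :=
  (forall w, lin (fun v => f v w)) /\ (forall v, lin (f v)).

Section TensorTheory.
Variable k : fieldType.
Implicit Types (Z : lmodType k) (V W X Y U : vectType k).

Lemma linfun_lin V W (f : V -> W) : lin f -> linfun f =1 f.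
Proof.
move=> hf v.
pose m := GRing.isSemilinear.Build k V W _ f (GRing.semilinear_linear hf).
pose F : {linear V -> W} := HB.pack f m.
exact: (lfunE F).
Qed.

Lemma tensPl V W c (u v : V) (w : W) : (c *: u + v) ⊗ w = c *: (u ⊗ w) + v ⊗ w.
Proof. by rewrite /tens linearP linearP /= mulmxDl scalemxAl. Qed.
Lemma tensPr V W c (u v : W) (w : V) : w ⊗ (c *: u + v) = c *: (w ⊗ u) + w ⊗ v.
Proof. by rewrite /tens linearP /= mulmxDr scalemxAr. Qed.

Lemma eq_sw V W Z (t : tensor V W) (f g : V -> W -> Z) :
  (forall a b, f a b = g a b) -> sweedler t f = sweedler t g.
Proof. by move=> e; do 2!apply: eq_bigr => ? _; rewrite e. Qed.

Lemma swPl V W Z c (s t : tensor V W) (f : V -> W -> Z) :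
  sweedler (c *: s + t) f = c *: sweedler s f + sweedler t f.
Proof.
rewrite /sweedler scaler_sumr -big_split; apply: eq_bigr => i _.
rewrite scaler_sumr -big_split; apply: eq_bigr => j _ /=.
by rewrite !mxE scalerDl scalerA.
Qed.
Lemma swPr V W Z c (t : tensor V W) (f g : V -> W -> Z) :
  sweedler t (fun a b => c *: f a b + g a b) = c *: sweedler t f + sweedler t g.
Proof.
rewrite /sweedler scaler_sumr -big_split; apply: eq_bigr => i _.
rewrite scaler_sumr -big_split; apply: eq_bigr => j _ /=.
by rewrite scalerDr !scalerA mulrC.
Qed.

Lemma lin_comp Z Z1 Z2 (F : Z1 -> Z2) (g : Z -> Z1) :
  lin F -> lin g -> lin (fun v => F (g v)).
Proof. by move=> hF hg c u v; rewrite hg hF. Qed.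
Lemma lin_id Z : lin (fun v : Z => v). Proof. by []. Qed.
Lemma lin_lf (Z : lmodType k) X Y (F : 'Hom(X, Y)) (g : Z -> X) :
  lin g -> lin (fun v => F (g v)).
Proof. by move=> hg c u v; rewrite hg linearP. Qed.
Lemma lin_lapp Z X Y (F : Z -> 'Hom(X, Y)) (x : X) :
  lin F -> lin (fun v => F v x).
Proof. by move=> hF c u v; rewrite hF add_lfunE scale_lfunE. Qed.
Lemma lin_tensl Z V W (g : Z -> V) (w : W) : lin g -> lin (fun z => g z ⊗ w).
Proof. by move=> hg c u v; rewrite hg tensPl. Qed.
Lemma lin_tensr Z V W (g : Z -> W) (w : V) : lin g -> lin (fun z => w ⊗ g z).
Proof. by move=> hg c u v; rewrite hg tensPr. Qed.
Lemma lin_swl Z V W (Z' : lmodType k) (g : Z -> tensor V W) (f : V -> W -> Z') :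
  lin g -> lin (fun z => sweedler (g z) f).
Proof. by move=> hg c u v; rewrite hg swPl. Qed.
Lemma lin_swr Z V W (Z' : lmodType k) (t : tensor V W) (f : Z -> V -> W -> Z') :
  (forall a b, lin (fun z => f z a b)) -> lin (fun z => \sw_(a, b <- t) f z a b).
Proof. by move=> hg c u v; rewrite -swPr; apply: eq_sw => a b; rewrite hg. Qed.
Lemma lin_mull Z (A : falgType k) (g : Z -> A) b : lin g -> lin (fun z => g z * b).
Proof. by move=> hg c u v; rewrite hg mulrDl scalerAl. Qed.
Lemma lin_mulr Z (A : falgType k) (g : Z -> A) b : lin g -> lin (fun z => b * g z).
Proof. by move=> hg c u v; rewrite hg mulrDr scalerAr. Qed.
Lemma lin_scalel Z Z' (g : Z -> k^o) (b : Z') : lin g -> lin (fun z => (g z : k) *: b).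
Proof. by move=> hg c u v; rewrite hg scalerDl scalerA. Qed.
Lemma lin_scaler Z Z' (g : Z -> Z') (b : k) : lin g -> lin (fun z => b *: g z).
Proof. by move=> hg c u v; rewrite hg scalerDr !scalerA mulrC. Qed.
Lemma lin_add Z Z' (g h : Z -> Z') : lin g -> lin h -> lin (fun z => g z + h z).
Proof. by move=> hg hh c u v; rewrite hg hh scalerDr addrACA. Qed.
Lemma lin_opp Z Z' (g : Z -> Z') : lin g -> lin (fun z => - g z).
Proof. by move=> hg c u v; rewrite hg opprD scalerN. Qed.
Lemma lin_vsval Z V (U : {vspace V}) (g : Z -> subvs_of U) :
  lin g -> lin (fun z => vsval (g z)).
Proof. by move=> hg c u v; rewrite hg linearP. Qed.
Lemma lin_vsproj Z V (U : {vspace V}) (g : Z -> V) :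
  lin g -> lin (fun z => vsproj U (g z)).
Proof. by move=> hg c u v; rewrite hg linearP. Qed.
Lemma lin_compl Z X Y V (F : Z -> 'Hom(X, Y)) (G : 'Hom(V, X)) :
  lin F -> lin (fun z => (F z \o G)%VF).
Proof. by move=> hF c u v; rewrite hF comp_lfunDl comp_lfunZl. Qed.
Lemma lin_compr Z X Y V (F : Z -> 'Hom(V, X)) (G : 'Hom(X, Y)) :
  lin F -> lin (fun z => (G \o F z)%VF).
Proof. by move=> hF c u v; rewrite hF comp_lfunDr comp_lfunZr. Qed.
Lemma lin_linfun Z X Y (F : Z -> X -> Y) :
  (forall z, lin (F z)) -> (forall x, lin (fun z => F z x)) ->
  lin (fun z => linfun (F z)).
Proof.
move=> h1 h2 c u v; apply/lfunP => x.
by rewrite add_lfunE scale_lfunE !linfun_lin //; apply: h2.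
Qed.
Lemma lin_bill Z Z1 Z2 Z3 (f : Z1 -> Z2 -> Z3) (g : Z -> Z1) b :
  bil f -> lin g -> lin (fun z => f (g z) b).
Proof. case=> h _ hg; exact: (lin_comp (h b) hg). Qed.
Lemma lin_bilr Z Z1 Z2 Z3 (f : Z1 -> Z2 -> Z3) (g : Z -> Z2) a :
  bil f -> lin g -> lin (fun z => f a (g z)).
Proof. case=> _ h hg; exact: (lin_comp (h a) hg). Qed.
End TensorTheory.

Ltac linslow := first
 [ eassumption
 | match goal with H : bil _ |- _ => first [refine (lin_bill _ H _) | refine (lin_bilr _ H _)] end
 | apply: lin_id | apply: lin_lf | apply: lin_vsval | apply: lin_vsproj
 | apply: lin_swr | apply: lin_swl | apply: lin_linfun | apply: lin_lapp ].
Ltac lineta := lazymatch goal with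
 | |- lin (fun _ => _) => idtac
 | |- @lin ?k ?V ?X ?f => change (@lin k V X (fun v => f v))
 | |- _ => idtac end.
Ltac linstep := lineta; lazymatch goal with
 | |- lin (fun v => v) => exact: lin_id
 | |- lin (fun v => tens (@?a v) (@?b v)) => first [apply: lin_tensl | apply: lin_tensr]
 | |- lin (fun v => sweedler (@?t v) (@?f v)) => first [apply: lin_swr | apply: lin_swl]
 | |- lin (fun v => GRing.mul (@?a v) (@?b v)) => first [apply: lin_mull | apply: lin_mulr]
 | |- lin (fun v => GRing.scale (@?a v) (@?b v)) => first [apply: lin_scalel | apply: lin_scaler]
 | |- lin (fun v => fun_of_lfun (@?a v) (@?b v)) => first [apply: lin_lf | apply: lin_lapp]
 | |- lin (fun v => vsval (@?a v)) => apply: lin_vsval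
 | |- lin (fun v => vsproj _ (@?a v)) => apply: lin_vsproj
 | |- lin (fun v => linfun (@?a v)) => apply: lin_linfun
 | |- lin (fun v => comp_lfun (@?a v) (@?b v)) => first [apply: lin_compl | apply: lin_compr]
 | |- lin (fun v => GRing.add (@?a v) (@?b v)) => apply: lin_add
 | |- lin (fun v => GRing.opp (@?a v)) => apply: lin_opp
 | |- _ => linslow
 end.
Ltac lin := intros; repeat (linstep; intros).
Ltac bil := split=> *; lin.

Section TensorTheory2.
Variable k : fieldType.
Implicit Types (Z : lmodType k) (V W X Y U : vectType k).

Lemma lin_sum Z Z' (F : Z -> Z') : lin F ->
  forall I (r : seq I) (P : pred I) G, F (\sum_(i <- r | P i) G i) = \sum_(i <- r | P i) F (G i).
Proof.
move=> hF; pose m := GRing.isSemilinear.Build k Z Z' _ F (GRing.semilinear_linear hF).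
pose F' : {linear Z -> Z'} := HB.pack F m.
exact: (linear_sum F').
Qed.
Lemma linZ Z Z' (F : Z -> Z') : lin F -> forall c u, F (c *: u) = c *: F u.
Proof.
move=> hF c u; pose m := GRing.isSemilinear.Build k Z Z' _ F (GRing.semilinear_linear hF).
pose F' : {linear Z -> Z'} := HB.pack F m.
exact: (linearZ_LR F').
Qed.

Lemma sw_lin Z Z' V W (F : Z -> Z') (t : tensor V W) f : lin F ->
  F (sweedler t f) = \sw_(a, b <- t) F (f a b).
Proof.
move=> hF; rewrite /sweedler (lin_sum hF); apply: eq_bigr => i _.
by rewrite (lin_sum hF); apply: eq_bigr => j _; rewrite (linZ hF).
Qed.

Lemma bvecE V (v : V) : v = \sum_i v2r v 0 i *: bvec i.
Proof.
rewrite -[LHS]v2rK [v2r v in LHS]row_sum_delta linear_sum /=.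
by apply: eq_bigr => i _; rewrite linearZ.
Qed.

Lemma sw_tens V W Z (v : V) (w : W) (f : V -> W -> Z) : bil f ->
  sweedler (v ⊗ w) f = f v w.
Proof.
case=> h1 h2; rewrite [v in RHS]bvecE (lin_sum (h1 w)); apply: eq_bigr => i _.
rewrite (linZ (h1 w)) [w in RHS]bvecE (lin_sum (h2 _)) scaler_sumr.
apply: eq_bigr => j _; rewrite (linZ (h2 _)) scalerA; congr (_ *: _).
by rewrite /tens mxE big_ord1 mxE.
Qed.

Lemma tens_sw V W (t : tensor V W) : \sw_(a, b <- t) (a ⊗ b) = t.
Proof.
rewrite /sweedler [RHS]matrix_sum_delta; do 2!apply: eq_bigr => ? _.
by congr (_ *: _); rewrite /tens /bvec !r2vK trmx_delta mul_delta_mx.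
Qed.

Lemma eq_tens_lin V W Z (F G : tensor V W -> Z) : lin F -> lin G ->
  (forall v w, F (v ⊗ w) = G (v ⊗ w)) -> forall t, F t = G t.
Proof.
move=> hF hG e t; rewrite -(tens_sw t) (sw_lin _ _ hF) (sw_lin _ _ hG).
exact: eq_sw.
Qed.

Lemma sw_sw V W X Y Z (t : tensor V W) (F : V -> W -> tensor X Y) (f : X -> Y -> Z) :
  \sw_(c, d <- \sw_(a, b <- t) F a b) f c d
   = \sw_(a, b <- t) \sw_(c, d <- F a b) f c d.
Proof. by apply: (sw_lin (F := fun u => sweedler u f)); lin. Qed.

Lemma sw_exch V W X Y Z (s : tensor V W) (t : tensor X Y) (f : V -> W -> X -> Y -> Z) :
  \sw_(a, b <- s) \sw_(c, d <- t) f a b c d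
   = \sw_(c, d <- t) \sw_(a, b <- s) f a b c d.
Proof.
have swE V1 W1 (u : tensor V1 W1) (g : V1 -> W1 -> Z) :
  sweedler u g = \sum_p (u : 'M_(_, _)) p.1 p.2 *: g (bvec p.1) (bvec p.2).
  by rewrite /sweedler pair_bigA.
rewrite !swE; under eq_bigr do rewrite swE scaler_sumr.
under [RHS]eq_bigr do rewrite swE scaler_sumr.
rewrite exchange_big; do 2!apply: eq_bigr => ? _.
by rewrite !scalerA mulrC.
Qed.
End TensorTheory2.

Definition tmul (k : fieldType) (L M : falgType k) (s t : tensor L M) : tensor L M :=
  \sw_(a, b <- s) \sw_(c, d <- t) ((a * c) ⊗ (b * d)).

Definition flip (k : fieldType) (V W : vectType k) (t : tensor V W) : tensor W V :=
  \sw_(a, b <- t) (b ⊗ a).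

Record hopfData (k : fieldType) (L : falgType k) := HopfData {
  comul : 'Hom(L, tensor L L);
  counit : 'Hom(L, k^o);
  antipode : 'End(L) }.

Section HopfStructures.
Variables (k : fieldType) (L : falgType k) (D : hopfData L).
Local Notation Δ := (comul D).
Local Notation ε := (counit D).
Local Notation S := (antipode D).

Record coalgebra_axioms : Prop := {
  comulA : forall h,
    \sw_(h1, h2 <- Δ h) \sw_(h11, h12 <- Δ h1) (h11 ⊗ (h12 ⊗ h2)) =
    \sw_(h1, h2 <- Δ h) \sw_(h21, h22 <- Δ h2) (h1 ⊗ (h21 ⊗ h22));
  counitl : forall h, \sw_(h1, h2 <- Δ h) ((ε h1 : k) *: h2) = h;
  counitr : forall h, \sw_(h1, h2 <- Δ h) ((ε h2 : k) *: h1) = h }.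

Record hopf_axioms : Prop := {
  hopf_coalg : coalgebra_axioms;
  hopf_comulM : forall g h, Δ (g * h) = tmul (Δ g) (Δ h);
  hopf_comul1 : Δ 1 = 1 ⊗ 1;
  hopf_counitM : forall g h, ε (g * h) = ε g * ε h;
  hopf_counit1 : ε 1 = 1;
  hopf_antipodel : forall h, \sw_(h1, h2 <- Δ h) (S h1 * h2) = (ε h : k) *: 1;
  hopf_antipoder : forall h, \sw_(h1, h2 <- Δ h) (h1 * S h2) = (ε h : k) *: 1 }.

(* These [linfun]s are applied to linear functions, hence they do agree with
   their argument ([linfun_lin]); the same holds throughout this file. *)
Definition target_counital : 'End(L) :=
  linfun (fun h => \sw_(e1, e2 <- Δ 1) ((ε (e1 * h) : k) *: e2)).
Definition source_counital : 'End(L) :=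
  linfun (fun h => \sw_(e1, e2 <- Δ 1) ((ε (h * e2) : k) *: e1)).

(* Weak Hopf algebras in the sense of Böhm, Nill and Szlachányi. *)
Record weak_hopf_axioms : Prop := {
  wha_coalg : coalgebra_axioms;
  comulM : forall g h, Δ (g * h) = tmul (Δ g) (Δ h);
  counitMl : forall f g h,
    ε (f * g * h) = \sw_(g1, g2 <- Δ g) (ε (f * g1) * ε (g2 * h));
  counitMr : forall f g h,
    ε (f * g * h) = \sw_(g1, g2 <- Δ g) (ε (f * g2) * ε (g1 * h));
  comul1l : \sw_(e1, e2 <- Δ 1) \sw_(e21, e22 <- Δ e2) (e1 ⊗ (e21 ⊗ e22)) =
    \sw_(e1, e2 <- Δ 1) \sw_(f1, f2 <- Δ 1) (e1 ⊗ ((e2 * f1) ⊗ f2));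
  comul1r : \sw_(e1, e2 <- Δ 1) \sw_(e21, e22 <- Δ e2) (e1 ⊗ (e21 ⊗ e22)) =
    \sw_(e1, e2 <- Δ 1) \sw_(f1, f2 <- Δ 1) (e1 ⊗ ((f1 * e2) ⊗ f2));
  antipodel : forall h, \sw_(h1, h2 <- Δ h) (S h1 * h2) = source_counital h;
  antipoder : forall h, \sw_(h1, h2 <- Δ h) (h1 * S h2) = target_counital h;
  antipodeS : forall h,
    \sw_(h1, h2 <- Δ h) \sw_(h21, h22 <- Δ h2) (S h1 * h21 * S h22) = S h }.

Variable R : tensor L L.

(* (Δ ⊗ id) R = R_13 R_23 and (id ⊗ Δ) R = R_13 R_12 *)
Definition hexagon_axiom_l : Prop :=
  \sw_(r1, r2 <- R) \sw_(a, b <- Δ r1) (a ⊗ (b ⊗ r2)) =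
  \sw_(r1, r2 <- R) \sw_(s1, s2 <- R) (r1 ⊗ (s1 ⊗ (r2 * s2))).
Definition hexagon_axiom_r : Prop :=
  \sw_(r1, r2 <- R) \sw_(a, b <- Δ r2) (r1 ⊗ (a ⊗ b)) =
  \sw_(r1, r2 <- R) \sw_(s1, s2 <- R) ((r1 * s1) ⊗ (s2 ⊗ r2)).

Record qt_hopf : Prop := {
  qth_hopf : hopf_axioms;
  qth_inv : exists Q, tmul R Q = 1 ⊗ 1 /\ tmul Q R = 1 ⊗ 1;
  qth_comul : forall h, tmul R (Δ h) = tmul (flip (Δ h)) R;
  qth_hexl : hexagon_axiom_l;
  qth_hexr : hexagon_axiom_r }.

(* [qtw_corner]: R lies in Δ^op(1) (L ⊗ L) Δ(1); [Q] is the quasi-inverse of R,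
   in Δ(1) (L ⊗ L) Δ^op(1) (Nikshych, Turaev and Vainerman). *)
Record qt_weak_hopf : Prop := {
  qtw_weak : weak_hopf_axioms;
  qtw_corner : tmul (tmul (flip (Δ 1)) R) (Δ 1) = R;
  qtw_inv : exists2 Q, tmul (tmul (Δ 1) Q) (flip (Δ 1)) = Q &
    tmul R Q = flip (Δ 1) /\ tmul Q R = Δ 1;
  qtw_comul : forall h, tmul R (Δ h) = tmul (flip (Δ h)) R;
  qtw_hexl : hexagon_axiom_l;
  qtw_hexr : hexagon_axiom_r }.

End HopfStructures.

Section Cat.
Variable k : fieldType.

(* k-linear braided monoidal categories, in the notation of which
   [ccomp f g] is f after g. *)
Record braidedCategory := BraidedCategory {
  ob : Type;
  mor : ob -> ob -> lmodType k;
  cid : forall X, mor X X;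
  ccomp : forall X Y Z, mor Y Z -> mor X Y -> mor X Z;
  ccompA : forall W X Y Z (f : mor Y Z) (g : mor X Y) (h : mor W X),
    ccomp f (ccomp g h) = ccomp (ccomp f g) h;
  ccomp1m : forall X Y (f : mor X Y), ccomp (cid Y) f = f;
  ccompm1 : forall X Y (f : mor X Y), ccomp f (cid X) = f;
  ccomp_bil : forall X Y Z, bil (@ccomp X Y Z);
  cat_iso := fun X Y (f : mor X Y) =>
    exists2 g : mor Y X, ccomp g f = cid X & ccomp f g = cid Y;

  tob : ob -> ob -> ob;
  tmor : forall X X' Y Y', mor X X' -> mor Y Y' -> mor (tob X Y) (tob X' Y');
  tmor1 : forall X Y, tmor (cid X) (cid Y) = cid (tob X Y);
  tmorM : forall X X' X'' Y Y' Y'' (f' : mor X' X'') (f : mor X X')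
    (g' : mor Y' Y'') (g : mor Y Y'),
    tmor (ccomp f' f) (ccomp g' g) = ccomp (tmor f' g') (tmor f g);
  tmor_bil : forall X X' Y Y', bil (@tmor X X' Y Y');

  tunit : ob;
  assoc : forall X Y Z, mor (tob (tob X Y) Z) (tob X (tob Y Z));
  associ : forall X Y Z, mor (tob X (tob Y Z)) (tob (tob X Y) Z);
  lunit : forall X, mor (tob tunit X) X;
  runit : forall X, mor (tob X tunit) X;
  braid : forall X Y, mor (tob X Y) (tob Y X);
  assocK : forall X Y Z, ccomp (associ X Y Z) (assoc X Y Z) = cid _;
  associK : forall X Y Z, ccomp (assoc X Y Z) (associ X Y Z) = cid _;
  lunit_iso : forall X, cat_iso (lunit X);
  runit_iso : forall X, cat_iso (runit X);
  braid_iso : forall X Y, cat_iso (braid X Y);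
  assoc_nat : forall X X' Y Y' Z Z' (f : mor X X') (g : mor Y Y') (h : mor Z Z'),
    ccomp (assoc X' Y' Z') (tmor (tmor f g) h) = ccomp (tmor f (tmor g h)) (assoc X Y Z);
  lunit_nat : forall X X' (f : mor X X'),
    ccomp (lunit X') (tmor (cid tunit) f) = ccomp f (lunit X);
  runit_nat : forall X X' (f : mor X X'),
    ccomp (runit X') (tmor f (cid tunit)) = ccomp f (runit X);
  braid_nat : forall X X' Y Y' (f : mor X X') (g : mor Y Y'),
    ccomp (braid X' Y') (tmor f g) = ccomp (tmor g f) (braid X Y);
  pentagon : forall W X Y Z,
    ccomp (assoc W X (tob Y Z)) (assoc (tob W X) Y Z) =
    ccomp (tmor (cid W) (assoc X Y Z))
      (ccomp (assoc W (tob X Y) Z) (tmor (assoc W X Y) (cid Z)));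
  triangle : forall X Y,
    ccomp (tmor (cid X) (lunit Y)) (assoc X tunit Y) = tmor (runit X) (cid Y);
  hexagonl : forall X Y Z,
    ccomp (assoc Y Z X) (ccomp (braid X (tob Y Z)) (assoc X Y Z)) =
    ccomp (tmor (cid Y) (braid X Z))
      (ccomp (assoc Y X Z) (tmor (braid X Y) (cid Z)));
  hexagonr : forall X Y Z,
    ccomp (associ Z X Y) (ccomp (braid (tob X Y) Z) (associ X Y Z)) =
    ccomp (tmor (braid X Z) (cid Y))
      (ccomp (associ X Z Y) (tmor (cid X) (braid Y Z)))
}.
Arguments cid {_} X.

Record functor (C D : braidedCategory) := Functor {
  fob :> ob C -> ob D;
  fmor : forall X Y, mor X Y -> mor (fob X) (fob Y);
  fmor_lin : forall X Y, lin (@fmor X Y);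
  fmor1 : forall X, fmor (cid X) = cid (fob X);
  fmorM : forall X Y Z (f : mor Y Z) (g : mor X Y),
    fmor (ccomp f g) = ccomp (fmor f) (fmor g) }.

Definition id_functor C := @Functor C C id (fun _ _ => id)
  (fun _ _ => @lin_id k _) (fun _ => erefl) (fun _ _ _ _ _ => erefl).

Definition comp_functor C D E (F : functor D E) (G : functor C D) : functor C E.
Proof.
apply: (@Functor C E (F \o G) (fun _ _ f => fmor F (fmor G f))).
- by move=> X Y c u v; rewrite !fmor_lin.
- by move=> X; rewrite !fmor1.
- by move=> X Y Z f g; rewrite !fmorM.
Defined.

Definition nat_iso C D (F G : functor C D) : Prop :=
  exists2 η : forall X, mor (F X) (G X), forall X, cat_iso (η X) &
  forall X Y (f : mor X Y), ccomp (η Y) (fmor F f) = ccomp (fmor G f) (η X).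

Definition is_equivalence C D (F : functor C D) : Prop :=
  exists G : functor D C,
    nat_iso (comp_functor G F) (id_functor C) /\
    nat_iso (comp_functor F G) (id_functor D).

Record braidedFunctor (C D : braidedCategory) := {
  bfun :> functor C D;
  bten : forall X Y, mor (tob (bfun X) (bfun Y)) (bfun (tob X Y));
  bunit : mor (tunit D) (bfun (tunit C));
  bten_iso : forall X Y, cat_iso (bten X Y);
  bunit_iso : cat_iso bunit;
  bten_nat : forall X X' Y Y' (f : mor X X') (g : mor Y Y'),
    ccomp (bten X' Y') (tmor (fmor bfun f) (fmor bfun g)) =
    ccomp (fmor bfun (tmor f g)) (bten X Y);
  bten_assoc : forall X Y Z,
    ccomp (fmor bfun (assoc X Y Z))
      (ccomp (bten (tob X Y) Z) (tmor (bten X Y) (cid (bfun Z)))) =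
    ccomp (bten X (tob Y Z))
      (ccomp (tmor (cid (bfun X)) (bten Y Z)) (assoc (bfun X) (bfun Y) (bfun Z)));
  bten_lunit : forall X,
    ccomp (fmor bfun (lunit X))
      (ccomp (bten (tunit C) X) (tmor bunit (cid (bfun X)))) = lunit (bfun X);
  bten_runit : forall X,
    ccomp (fmor bfun (runit X))
      (ccomp (bten X (tunit C)) (tmor (cid (bfun X)) bunit)) = runit (bfun X);
  bten_braid : forall X Y,
    ccomp (fmor bfun (braid X Y)) (bten X Y) =
    ccomp (bten Y X) (braid (bfun X) (bfun Y)) }.

Definition braided_equivalent (C D : braidedCategory) : Prop :=
  exists F : braidedFunctor C D, is_equivalence F.
End Cat.

Record fdmod (k : fieldType) (L : falgType k) := Fdmod {
  carrier :> vectType k;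
  modact : 'Hom(L, 'End(carrier));
  modact1 : modact 1 = \1%VF;
  modactM : forall g h, modact (g * h) = (modact g \o modact h)%VF }.

Section Tmul.
Variables (k : fieldType) (L M : falgType k).
Implicit Types s t u : tensor L M.
Lemma sw_tmul (Z : lmodType k) s t (f : L -> M -> Z) : bil f ->
  sweedler (tmul s t) f = \sw_(a, b <- s) \sw_(c, d <- t) f (a * c) (b * d).
Proof.
case=> h1 h2; rewrite /tmul sw_sw; apply: eq_sw => a b; rewrite sw_sw.
by apply: eq_sw => c d; rewrite sw_tens.
Qed.
Lemma tmulA s t u : tmul s (tmul t u) = tmul (tmul s t) u.
Proof.
rewrite [RHS]/tmul sw_tmul; last by bil.
rewrite {1}/tmul; apply: eq_sw => a b; rewrite sw_tmul; last by bil.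
by apply: eq_sw => c d; apply: eq_sw => e f; rewrite !mulrA.
Qed.
End Tmul.

Definition tril (k : fieldType) (V W X Z : lmodType k) (f : V -> W -> X -> Z) :=
  [/\ forall b c, lin (fun a => f a b c), forall a c, lin (fun b => f a b c) &
      forall a b, lin (f a b)].
Ltac tril := split; lin.

Section Sweedler3.
Variables (k : fieldType) (V W X : vectType k) (Z : lmodType k).
Implicit Type f : V -> W -> X -> Z.
Lemma lin_sw3l (Z' : lmodType k) (g : Z' -> tensor V (tensor W X)) f :
  lin g -> lin (fun z => sweedler3 (g z) f).
Proof. by rewrite /sweedler3; lin. Qed.
Lemma lin_sw3r (Z' : lmodType k) t (f : Z' -> V -> W -> X -> Z) :
  (forall a b c, lin (fun z => f z a b c)) -> lin (fun z => \sw_(a, b, c <- t) f z a b c).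
Proof. by move=> h; rewrite /sweedler3; lin. Qed.
Lemma sw3_tens f a b c : tril f -> sweedler3 (a ⊗ (b ⊗ c)) f = f a b c.
Proof.
by case=> h1 h2 h3; rewrite /sweedler3 sw_tens ?sw_tens //; split=> *; lin; apply: h1.
Qed.
Lemma sw3_sw (V1 W1 V2 W2 : vectType k) (s : tensor V1 W1) (t : V1 -> W1 -> tensor V2 W2)
    f g1 g2 g3 : tril f ->
  sweedler3 (\sw_(a, b <- s) \sw_(c, d <- t a b) (g1 a b c d ⊗ (g2 a b c d ⊗ g3 a b c d))) f =
   \sw_(a, b <- s) \sw_(c, d <- t a b) f (g1 a b c d) (g2 a b c d) (g3 a b c d).
Proof.
have lf : lin (fun t => sweedler3 t f) by apply: lin_sw3l; lin.
move=> hf; rewrite (sw_lin _ _ lf); apply: eq_sw => a b.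
by rewrite (sw_lin _ _ lf); apply: eq_sw => c d; exact: sw3_tens.
Qed.
Lemma sw3_lin (Z' : lmodType k) (F : Z -> Z') t f : lin F ->
  F (sweedler3 t f) = \sw_(a, b, c <- t) F (f a b c).
Proof.
by move=> hF; rewrite /sweedler3 sw_lin //; apply: eq_sw => a u; rewrite sw_lin.
Qed.
Lemma eq_sw3 t f g : (forall a b c, f a b c = g a b c) -> sweedler3 t f = sweedler3 t g.
Proof. by move=> e; do 2!apply: eq_sw => ? ?; apply: e. Qed.
Lemma tens3_ext (F G : tensor V (tensor W X) -> Z) : lin F -> lin G ->
  (forall a b c, F (a ⊗ (b ⊗ c)) = G (a ⊗ (b ⊗ c))) -> F =1 G.
Proof.
move=> hF hG e; apply: eq_tens_lin => // a u; move: u; apply: eq_tens_lin => [||b c].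
- by apply: (lin_comp hF); lin.
- by apply: (lin_comp hG); lin.
exact: e.
Qed.
End Sweedler3.

Section Rep.
Variables (k : fieldType) (L : falgType k).
Implicit Types U V W X Y : fdmod L.

Lemma modact1E V v : modact V 1 v = v. Proof. by rewrite modact1 id_lfunE. Qed.
Lemma modactME V g h v : modact V (g * h) v = modact V g (modact V h v).
Proof. by rewrite modactM comp_lfunE. Qed.

(* Morphisms of modules form a subspace of ['Hom(V, W)], see [intertwP]. *)
Definition intertw V W : {vspace 'Hom(V, W)} :=
  lker (linfun (fun f : 'Hom(V, W) =>
    linfun (fun h : L => ((f \o modact V h) - (modact W h \o f))%VF))).

Lemma intertwP V W (f : 'Hom(V, W)) :
  reflect (forall h v, f (modact V h v) = modact W h (f v)) (f \in intertw V W).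
Proof.
rewrite memv_ker linfun_lin; last by lin.
apply: (iffP eqP) => [e h v | e].
  have := congr1 (fun F : 'Hom(L, 'Hom(V, W)) => F h v) e.
  rewrite linfun_lin; last by lin.
  rewrite add_lfunE opp_lfunE !comp_lfunE !zero_lfunE => /eqP.
  by rewrite subr_eq0 => /eqP.
apply/lfunP => h; rewrite linfun_lin; last by lin.
by apply/lfunP => v; rewrite add_lfunE opp_lfunE !comp_lfunE !zero_lfunE e subrr.
Qed.

Definition rhom V W : vectType k := subvs_of (intertw V W).
Definition mkhom V W (f : 'Hom(V, W))
  (hf : forall h v, f (modact V h v) = modact W h (f v)) : rhom V W :=
  Subvs (introT (intertwP f) hf).
Lemma rhomP V W (f : rhom V W) h v : vsval f (modact V h v) = modact W h (vsval f v).
Proof. by have /intertwP := subvsP f. Qed.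
Lemma rhom_ext V W (f g : rhom V W) : vsval f =1 vsval g -> f = g.
Proof. by move=> e; apply: subvs_inj; apply/lfunP. Qed.

Definition rid V : rhom V V.
Proof. by apply: (@mkhom V V \1%VF) => h v; rewrite !id_lfunE. Defined.
Definition rcomp U V W (f : rhom V W) (g : rhom U V) : rhom U W.
Proof.
by apply: (@mkhom U W (vsval f \o vsval g)%VF) => h v; rewrite !comp_lfunE !rhomP.
Defined.

Variable D : hopfData L.
Hypothesis hD : weak_hopf_axioms D.
Local Notation Δ := (comul D).
Local Notation ε := (counit D).

Definition tact V W (t : tensor L L) : 'End(tensor V W) :=
  linfun (fun m => \sw_(a, b <- t) \sw_(v, w <- m) (modact V a v ⊗ modact W b w)).
Lemma tact_tens V W t (v : V) (w : W) :
  tact V W t (v ⊗ w) = \sw_(a, b <- t) (modact V a v ⊗ modact W b w).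
Proof.
rewrite /tact linfun_lin; last by lin.
by apply: eq_sw => a b; rewrite sw_tens //; bil.
Qed.
Lemma tact_lin V W : lin (tact V W).
Proof. by apply: lin_linfun; lin. Qed.
Lemma lin_tact (Z : lmodType k) V W (t : Z -> tensor L L) m : lin t -> lin (fun z => tact V W (t z) m).
Proof. by move=> h c u v; rewrite h tact_lin add_lfunE scale_lfunE. Qed.
Lemma tactM V W s t : tact V W (tmul s t) = (tact V W s \o tact V W t)%VF.
Proof.
apply/lfunP; apply: eq_tens_lin => [||v w]; try by lin.
rewrite comp_lfunE !tact_tens sw_tmul; last by bil.
rewrite (sw_lin _ _ (F := tact V W s)); last by lin.
rewrite sw_exch; apply: eq_sw => a b; rewrite tact_tens; apply: eq_sw => c d.
by rewrite !modactME.
Qed.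
Definition trunc V W : {vspace tensor V W} := limg (tact V W (Δ 1)).

Lemma tmul1l g : tmul (Δ 1) (Δ g) = Δ g.
Proof. by rewrite -comulM // mul1r. Qed.
Lemma tmul1r g : tmul (Δ g) (Δ 1) = Δ g.
Proof. by rewrite -comulM // mulr1. Qed.
(* The tensor product of V and W in the category of modules is the subspace
   Δ(1) (V ⊗ W); [v ⊠ w] below denotes Δ(1) (v ⊗ w). *)
Definition tcar V W : vectType k := subvs_of (trunc V W).
Definition pt V W (v : V) (w : W) : tcar V W := vsproj (trunc V W) (tact V W (Δ 1) (v ⊗ w)).

Lemma comulA3 (Z : lmodType k) h (f : L -> L -> L -> Z) : tril f ->
  \sw_(a, b <- Δ h) \sw_(c, d <- Δ a) f c d b =
  \sw_(a, b <- Δ h) \sw_(c, d <- Δ b) f a c d.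
Proof.
move=> hf; have /= := congr1 (fun t => sweedler3 t f) (comulA (wha_coalg hD) h).
by rewrite !sw3_sw.
Qed.
Lemma comul1l3 (Z : lmodType k) (f : L -> L -> L -> Z) : tril f ->
  \sw_(a, b <- Δ 1) \sw_(c, d <- Δ b) f a c d =
  \sw_(a, b <- Δ 1) \sw_(c, d <- Δ 1) f a (b * c) d.
Proof. by move=> hf; have /= := congr1 (fun t => sweedler3 t f) (comul1l hD); rewrite !sw3_sw. Qed.
Lemma comul1r3 (Z : lmodType k) (f : L -> L -> L -> Z) : tril f ->
  \sw_(a, b <- Δ 1) \sw_(c, d <- Δ b) f a c d =
  \sw_(a, b <- Δ 1) \sw_(c, d <- Δ 1) f a (c * b) d.
Proof. by move=> hf; have /= := congr1 (fun t => sweedler3 t f) (comul1r hD); rewrite !sw3_sw. Qed.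
Lemma comulM2 (Z : lmodType k) g h (f : L -> L -> Z) : bil f ->
  \sw_(a, b <- Δ (g * h)) f a b = \sw_(a, b <- Δ g) \sw_(c, d <- Δ h) f (a * c) (b * d).
Proof. by move=> hf; rewrite comulM // sw_tmul. Qed.
Lemma comulM1l (Z : lmodType k) h (f : L -> L -> Z) : bil f ->
  \sw_(a, b <- Δ 1) \sw_(c, d <- Δ h) f (a * c) (b * d) = \sw_(a, b <- Δ h) f a b.
Proof. by move=> hf; rewrite -comulM2 // mul1r. Qed.
Lemma comulM1r (Z : lmodType k) h (f : L -> L -> Z) : bil f ->
  \sw_(a, b <- Δ h) \sw_(c, d <- Δ 1) f (a * c) (b * d) = \sw_(a, b <- Δ h) f a b.
Proof. by move=> hf; rewrite -comulM2 // mulr1. Qed.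
Lemma counitl1 h : \sw_(a, b <- Δ h) ((ε a : k) *: b) = h.
Proof. exact: counitl (wha_coalg hD) h. Qed.
Lemma counitr1 h : \sw_(a, b <- Δ h) ((ε b : k) *: a) = h.
Proof. exact: counitr (wha_coalg hD) h. Qed.

Definition tpr V W : 'Hom(tensor V W, tcar V W) :=
  linfun (fun m => vsproj (trunc V W) (tact V W (Δ 1) m)).
Lemma tprE V W m : tpr V W m = vsproj (trunc V W) (tact V W (Δ 1) m).
Proof. by rewrite linfun_lin //; lin. Qed.
Lemma vsval_tpr V W m : vsval (tpr V W m) = tact V W (Δ 1) m.
Proof. by rewrite tprE vsprojK // memv_img ?memvf. Qed.
Lemma tact1_tact V W h m : tact V W (Δ 1) (tact V W (Δ h) m) = tact V W (Δ h) m.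
Proof. by rewrite -comp_lfunE -tactM tmul1l. Qed.
Lemma tact_tact1 V W h m : tact V W (Δ h) (tact V W (Δ 1) m) = tact V W (Δ h) m.
Proof. by rewrite -comp_lfunE -tactM tmul1r. Qed.
Lemma tprK V W (u : tcar V W) : tpr V W (vsval u) = u.
Proof.
have /memv_imgP[m _ e] := subvsP u; apply: subvs_inj.
by rewrite vsval_tpr e tact1_tact.
Qed.
Lemma ptE V W (v : V) (w : W) : pt v w = tpr V W (v ⊗ w).
Proof. by rewrite tprE. Qed.
Lemma lin_ptl (Z : lmodType k) V W (g : Z -> V) (w : W) : lin g -> lin (fun z => pt (g z) w).
Proof. by rewrite /pt; lin. Qed.
Lemma lin_ptr (Z : lmodType k) V W (g : Z -> W) (w : V) : lin g -> lin (fun z => pt w (g z)).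
Proof. by rewrite /pt; lin. Qed.
Lemma tcar_ext V W (Z : lmodType k) (F G : tcar V W -> Z) : lin F -> lin G ->
  (forall v w, F (pt v w) = G (pt v w)) -> F =1 G.
Proof.
move=> hF hG e u; rewrite -(tprK u).
apply: (@eq_tens_lin _ _ _ _ (fun m => F (tpr V W m)) (fun m => G (tpr V W m))).
- by move=> c x y; rewrite linearP hF.
- by move=> c x y; rewrite linearP hG.
by move=> v w; rewrite -ptE.
Qed.
Lemma pt_bal V W (v : V) (w : W) : pt v w = \sw_(a, b <- Δ 1) pt (modact V a v) (modact W b w).
Proof.
rewrite [LHS]ptE -[LHS]tprK vsval_tpr tact_tens sw_lin; last by lin.
by apply: eq_sw => a b; rewrite ptE.
Qed.


Definition clift V W (Z : vectType k) (f : V -> W -> Z) : 'Hom(tcar V W, Z) :=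
  linfun (fun u => sweedler (vsval u) f).
Lemma lin_clift (Z' : lmodType k) V W (Z : vectType k) (f : Z' -> V -> W -> Z) u :
  (forall a b, lin (fun z => f z a b)) -> lin (fun z => clift (f z) u).
Proof.
move=> h c x y; rewrite /clift !linfun_lin; try by lin.
Qed.
Lemma clift_pt V W (Z : vectType k) (f : V -> W -> Z) v w : bil f ->
  (forall v w, \sw_(a, b <- Δ 1) f (modact V a v) (modact W b w) = f v w) ->
  clift f (pt v w) = f v w.
Proof.
move=> hf hb; rewrite /clift linfun_lin; last by lin.
rewrite ptE vsval_tpr tact_tens sw_sw -[RHS]hb.
by apply: eq_sw => a b; rewrite sw_tens.
Qed.

Definition tact_sub V W : 'Hom(L, 'End(tcar V W)) :=
  linfun (fun h => linfun (fun u => vsproj (trunc V W) (tact V W (Δ h) (vsval u)))).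
Lemma tact_subE V W h u :
  tact_sub V W h u = vsproj (trunc V W) (tact V W (Δ h) (vsval u)).
Proof.
rewrite /tact_sub linfun_lin; last by lin; apply: lin_tact; lin.
by rewrite linfun_lin //; lin.
Qed.
Lemma tact_sub_val V W h u : vsval (tact_sub V W h u) = tact V W (Δ h) (vsval u).
Proof. by rewrite tact_subE vsprojK // -tact1_tact memv_img ?memvf. Qed.
Definition tobj V W : fdmod L.
Proof.
apply: (@Fdmod k L (tcar V W) (tact_sub V W)).
  apply/lfunP => u; apply: subvs_inj; rewrite tact_sub_val id_lfunE.
  by rewrite -vsval_tpr tprK.
move=> g h; apply/lfunP => u; apply: subvs_inj.
by rewrite comp_lfunE !tact_sub_val comulM // tactM comp_lfunE.
Defined.
Lemma tobj_pt V W h (v : V) (w : W) :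
  modact (tobj V W) h (pt v w) = \sw_(a, b <- Δ h) pt (modact V a v) (modact W b w).
Proof.
transitivity (tpr V W (tact V W (Δ h) (v ⊗ w))).
  by apply: subvs_inj; rewrite /= tact_sub_val ptE !vsval_tpr tact_tact1 tact1_tact.
rewrite tact_tens sw_lin; last by lin.
by apply: eq_sw => a b; rewrite ptE.
Qed.

Definition ptm V W (v : V) (w : W) : tobj V W := pt v w.
Local Notation "v ⊠ w" := (ptm v w) (at level 40, left associativity).
Lemma lin_ptml (Z : lmodType k) V W (g : Z -> V) (w : W) : lin g -> lin (fun z => g z ⊠ w).
Proof. exact: lin_ptl. Qed.
Lemma lin_ptmr (Z : lmodType k) V W (g : Z -> W) (w : V) : lin g -> lin (fun z => w ⊠ g z).
Proof. exact: lin_ptr. Qed.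
Lemma ptm_bal V W (v : V) (w : W) : v ⊠ w = \sw_(a, b <- Δ 1) (modact V a v ⊠ modact W b w).
Proof. exact: pt_bal. Qed.
Lemma ptm_act V W h (v : V) (w : W) :
  modact (tobj V W) h (v ⊠ w) = \sw_(a, b <- Δ h) (modact V a v ⊠ modact W b w).
Proof. exact: tobj_pt. Qed.
Lemma ptm_ext V W (Z : lmodType k) (F G : tobj V W -> Z) : lin F -> lin G ->
  (forall v w, F (v ⊠ w) = G (v ⊠ w)) -> F =1 G.
Proof. exact: tcar_ext. Qed.
Definition mlift V W (Z : vectType k) (f : V -> W -> Z) : 'Hom(tobj V W, Z) := clift f.
Lemma lin_mlift (Z' : lmodType k) V W (Z : vectType k) (f : Z' -> V -> W -> Z) u :
  (forall a b, lin (fun z => f z a b)) -> lin (fun z => mlift (f z) u).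
Proof. exact: lin_clift. Qed.
Lemma mlift_ptm V W (Z : vectType k) (f : V -> W -> Z) v w : bil f ->
  (forall v w, \sw_(a, b <- Δ 1) f (modact V a v) (modact W b w) = f v w) ->
  mlift f (v ⊠ w) = f v w.
Proof. exact: clift_pt. Qed.

Ltac pstep := lineta; lazymatch goal with
 | |- lin (fun v => ptm (@?a v) (@?b v)) => first [apply: lin_ptml | apply: lin_ptmr]
 | |- lin (fun v => fun_of_lfun (mlift (@?a v)) (@?b v)) => first [apply: lin_lf | apply: lin_mlift]
 | |- _ => linstep end.
Ltac lin ::= intros; repeat (pstep; intros).

Section Mkhom.
Variables (U V W : fdmod L) (f : U -> V -> W) (hf : bil f)
  (hb : forall v w, \sw_(a, b <- Δ 1) f (modact U a v) (modact V b w) = f v w)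
  (hh : forall h v w, \sw_(a, b <- Δ h) f (modact U a v) (modact V b w) = modact W h (f v w)).
Lemma mkhom2_subproof h u : mlift f (modact (tobj U V) h u) = modact W h (mlift f u).
Proof.
move: u; apply: ptm_ext => [||v w]; try by lin.
rewrite ptm_act sw_lin; last by lin.
rewrite mlift_ptm // -hh; apply: eq_sw => a b; exact: mlift_ptm.
Qed.
Definition mkhom2 : rhom (tobj U V) W := mkhom mkhom2_subproof.
Lemma mkhom2_pt v w : vsval mkhom2 (v ⊠ w) = f v w.
Proof. exact: mlift_ptm. Qed.
End Mkhom.
Lemma rhom2_ext U V W (f g : rhom (tobj U V) W) :
  (forall v w, vsval f (v ⊠ w) = vsval g (v ⊠ w)) -> f = g.
Proof. by move=> e; apply: rhom_ext; apply: ptm_ext => //; lin. Qed.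

Definition rten U U' V V' (f : rhom U U') (g : rhom V V') : rhom (tobj U V) (tobj U' V').
Proof.
apply: (@mkhom2 U V (tobj U' V') (fun v w => vsval f v ⊠ vsval g w)).
- by bil.
- move=> v w; rewrite [RHS]ptm_bal; apply: eq_sw => a b; by rewrite !rhomP.
- move=> h v w; rewrite ptm_act; apply: eq_sw => a b; by rewrite !rhomP.
Defined.
Lemma rten_pt U U' V V' (f : rhom U U') (g : rhom V V') v w :
  vsval (rten f g) (v ⊠ w) = vsval f v ⊠ vsval g w.
Proof. exact: mkhom2_pt. Qed.

Lemma ptm3_act U V W h (x : U) (y : V) (w : W) : 
  modact (tobj (tobj U V) W) h (x ⊠ y ⊠ w) =
  \sw_(a, b <- Δ h) \sw_(c, d <- Δ b) (modact U a x ⊠ modact V c y ⊠ modact W d w).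
Proof.
rewrite ptm_act -(@comulA3 _ _ (fun a b c => modact U a x ⊠ modact V b y ⊠ modact W c w)); last by tril.
apply: eq_sw => a b; rewrite ptm_act.
by rewrite (sw_lin _ _ (F := fun u => u ⊠ modact W b w)) //; lin.
Qed.
Lemma ptm3_act' U V W h (x : U) (y : V) (w : W) : 
  modact (tobj U (tobj V W)) h (x ⊠ (y ⊠ w)) =
  \sw_(a, b <- Δ h) \sw_(c, d <- Δ b) (modact U a x ⊠ (modact V c y ⊠ modact W d w)).
Proof.
rewrite ptm_act; apply: eq_sw => a b; rewrite ptm_act.
by rewrite (sw_lin _ _ (F := fun u => modact U a x ⊠ u)) //; lin.
Qed.
Lemma ptm3_bal U V W (x : U) (y : V) (w : W) :
  \sw_(a, b <- Δ 1) (modact U a x ⊠ (modact V b y ⊠ w)) = x ⊠ (y ⊠ w).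
Proof.
rewrite -[RHS]modact1E ptm3_act' (@comul1r3 _ (fun a b c => modact U a x ⊠ (modact V b y ⊠ modact W c w))); last by tril.
apply: eq_sw => a b; rewrite [modact V b y ⊠ w]ptm_bal.
rewrite (sw_lin _ _ (F := fun u => modact U a x ⊠ u)); last by lin.
by apply: eq_sw => c d; rewrite modactME.
Qed.
Lemma ptm3_bal' U V W (x : U) (y : V) (w : W) :
  \sw_(a, b <- Δ 1) (x ⊠ modact V a y ⊠ modact W b w) = x ⊠ y ⊠ w.
Proof.
rewrite -[RHS]modact1E ptm3_act (@comul1l3 _ (fun a b c => modact U a x ⊠ modact V b y ⊠ modact W c w)); last by tril.
rewrite sw_exch; apply: eq_sw => a b; rewrite [x ⊠ _]ptm_bal.
rewrite (sw_lin _ _ (F := fun u => u ⊠ _)); last by lin.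
by apply: eq_sw => c d; rewrite modactME.
Qed.

Definition assoc_fun U V W (u : tobj U V) (w : W) : tobj U (tobj V W) :=
  mlift (fun x y => x ⊠ (y ⊠ w)) u.
Lemma assoc_fun_pt U V W x y w : @assoc_fun U V W (x ⊠ y) w = x ⊠ (y ⊠ w).
Proof. by rewrite /assoc_fun mlift_ptm //; [bil | move=> *; exact: ptm3_bal]. Qed.
Definition rassoc U V W : rhom (tobj (tobj U V) W) (tobj U (tobj V W)).
Proof.
apply: (@mkhom2 _ _ _ (@assoc_fun U V W)).
- by rewrite /assoc_fun; bil.
- move=> u w; move: u; apply: ptm_ext => [||x y]; try by rewrite /assoc_fun; lin.
  rewrite assoc_fun_pt -[RHS]modact1E ptm3_act'.
  rewrite -(@comulA3 _ _ (fun a b c => modact U a x ⊠ (modact V b y ⊠ modact W c w))); last by tril.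
  apply: eq_sw => a b; rewrite ptm_act.
  rewrite (sw_lin _ _ (F := fun u => assoc_fun u _)); last by rewrite /assoc_fun; lin.
  by apply: eq_sw => c d; rewrite assoc_fun_pt.
- move=> h u w; move: u; apply: ptm_ext => [||x y]; try by rewrite /assoc_fun; lin.
  rewrite assoc_fun_pt ptm3_act'.
  rewrite -(@comulA3 _ _ (fun a b c => modact U a x ⊠ (modact V b y ⊠ modact W c w))); last by tril.
  apply: eq_sw => a b; rewrite ptm_act.
  rewrite (sw_lin _ _ (F := fun u => assoc_fun u _)); last by rewrite /assoc_fun; lin.
  by apply: eq_sw => c d; rewrite assoc_fun_pt.
Defined.
Lemma rassoc_pt U V W x y w : vsval (rassoc U V W) (x ⊠ y ⊠ w) = x ⊠ (y ⊠ w).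
Proof. by rewrite mkhom2_pt assoc_fun_pt. Qed.

Definition associ_fun U V W (x : U) (u : tobj V W) : tobj (tobj U V) W :=
  mlift (fun y w => x ⊠ y ⊠ w) u.
Lemma associ_fun_pt U V W x y w : @associ_fun U V W x (y ⊠ w) = x ⊠ y ⊠ w.
Proof. by rewrite /associ_fun mlift_ptm //; [bil | move=> *; exact: ptm3_bal']. Qed.
Definition rassoci U V W : rhom (tobj U (tobj V W)) (tobj (tobj U V) W).
Proof.
apply: (@mkhom2 _ _ _ (@associ_fun U V W)).
- by rewrite /associ_fun; bil.
- move=> x u; move: u; apply: ptm_ext => [||y w]; try by rewrite /associ_fun; lin.
  rewrite associ_fun_pt -[RHS]modact1E ptm3_act.
  apply: eq_sw => a b; rewrite ptm_act.
  rewrite (sw_lin _ _ (F := fun u => associ_fun _ u)); last by rewrite /associ_fun; lin.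
  by apply: eq_sw => c d; rewrite associ_fun_pt.
- move=> h x u; move: u; apply: ptm_ext => [||y w]; try by rewrite /associ_fun; lin.
  rewrite associ_fun_pt ptm3_act.
  apply: eq_sw => a b; rewrite ptm_act.
  rewrite (sw_lin _ _ (F := fun u => associ_fun _ u)); last by rewrite /associ_fun; lin.
  by apply: eq_sw => c d; rewrite associ_fun_pt.
Defined.
Lemma rassoci_pt U V W x y w : vsval (rassoci U V W) (x ⊠ (y ⊠ w)) = x ⊠ y ⊠ w.
Proof. by rewrite mkhom2_pt associ_fun_pt. Qed.

Lemma riso U V (f : rhom U V) (g : V -> U) : lin g ->
  (forall v, vsval f (g v) = v) -> (forall u, g (vsval f u) = u) ->
  exists2 h : rhom V U, rcomp h f = rid U & rcomp f h = rid V.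
Proof.
move=> hg fg gf.
have hh h v : linfun g (modact V h v) = modact U h (linfun g v).
  by rewrite !linfun_lin // -{1}(fg v) -rhomP gf.
by exists (mkhom hh); apply: rhom_ext => x; rewrite /= comp_lfunE id_lfunE /= linfun_lin.
Qed.

Local Notation tgt := (target_counital D).
(* The right unit constraint is v ⊠ z |-> ε(1_(2) z) 1_(1) v. It is not given by
   [source_counital]: on L_t the map [osource] is the inverse of the antipode. *)
Definition osource (z : L) : L := \sw_(a, b <- Δ 1) ((ε (b * z) : k) *: a).
Lemma osource_lin : lin osource. Proof. by rewrite /osource; lin. Qed.
Lemma tgtE h : tgt h = \sw_(a, b <- Δ 1) ((ε (a * h) : k) *: b).
Proof. by rewrite /target_counital linfun_lin //; lin. Qed.
Lemma counitM1 f h : ε (f * h) = \sw_(a, b <- Δ 1) ((ε (a * h) : k) *: ε (f * b)).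
Proof.
have := counitMr hD f 1 h; rewrite mulr1 => ->.
by apply: eq_sw => a b; rewrite mulrC.
Qed.
Lemma tgtM g h : tgt (g * tgt h) = tgt (g * h).
Proof.
rewrite tgtE [RHS]tgtE; apply: eq_sw => a b; congr (_ *: _).
rewrite mulrA mulrA (counitM1 (a * g) h) tgtE.
rewrite (sw_lin _ _ (F := fun u => ε (a * g * u))); last by lin.
by apply: (@eq_sw _ _ _ k^o) => c d; rewrite -scalerAr linearZ.
Qed.
Lemma tgtK h : tgt (tgt h) = tgt h.
Proof. by rewrite -{1}[tgt h]mul1r tgtM mul1r. Qed.
Lemma tgt_fix (z : subvs_of (limg tgt)) : tgt (vsval z) = vsval z.
Proof. by have /memv_imgP[m _ ->] := subvsP z; rewrite tgtK. Qed.

(* The unit object is the target counital subalgebra L_t = ε_t(L), on which h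
   acts by z |-> ε_t(h z). *)
Definition uact : 'Hom(L, 'End(subvs_of (limg tgt))) :=
  linfun (fun h => linfun (fun z => vsproj (limg tgt) (tgt (h * vsval z)))).
Lemma uactE h z : vsval (uact h z) = tgt (h * vsval z).
Proof.
rewrite /uact linfun_lin; last by lin.
by rewrite linfun_lin ?vsprojK ?memv_img ?memvf //; lin.
Qed.
Definition uobj : fdmod L.
Proof.
apply: (@Fdmod k L (subvs_of (limg tgt)) uact).
  by apply/lfunP => z; apply: subvs_inj; rewrite uactE mul1r tgt_fix id_lfunE.
by move=> g h; apply/lfunP => z; apply: subvs_inj; rewrite comp_lfunE !uactE tgtM mulrA.
Defined.
Definition uval (z : uobj) : L := vsval (z : subvs_of (limg tgt)).
Definition uproj (h : L) : uobj := vsproj (limg tgt) (tgt h).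
Lemma lin_uval (Z : lmodType k) (g : Z -> uobj) : lin g -> lin (fun z => uval (g z)).
Proof. by rewrite /uval; lin. Qed.
Lemma lin_uproj (Z : lmodType k) (g : Z -> L) : lin g -> lin (fun z => uproj (g z)).
Proof. by rewrite /uproj; lin. Qed.
Lemma uproj_val (z : uobj) : uproj (uval z) = z.
Proof. by apply: subvs_inj; rewrite /uproj vsprojK ?memv_img ?memvf // tgt_fix. Qed.
Lemma uval_proj h : uval (uproj h) = tgt h.
Proof. by rewrite /uval /uproj vsprojK ?memv_img ?memvf. Qed.
Lemma uval_fix z : tgt (uval z) = uval z. Proof. exact: tgt_fix. Qed.
Lemma uval_act h z : uval (modact uobj h z) = tgt (h * uval z).
Proof. exact: uactE. Qed.
Lemma uact_proj h z : modact uobj h z = uproj (h * uval z).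
Proof. by apply: subvs_inj; have := uval_act h z; rewrite -uval_proj. Qed.

Lemma tgt_counit g : \sw_(a, b <- Δ g) (tgt a * b) = g.
Proof.
rewrite -[RHS]counitl1 -(@comulM1l _ _ (fun a b => (ε a : k) *: b)); last by bil.
rewrite sw_exch; apply: eq_sw => a b; rewrite tgtE.
rewrite (sw_lin _ _ (F := fun u => u * b)); last by lin.
by apply: eq_sw => c d; rewrite -scalerAl.
Qed.
Lemma tgt_split a c : tgt (a * c) = \sw_(p, q <- Δ a) ((ε (q * c) : k) *: tgt p).
Proof.
rewrite tgtE.
transitivity (\sw_(e1, e2 <- Δ 1) \sw_(p, q <- Δ a)
   ((ε (q * c) : k) *: ((ε (e1 * p) : k) *: e2))).
  apply: eq_sw => e1 e2; rewrite mulrA (counitMl hD).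
  rewrite (sw_lin _ _ (F := fun x : k^o => (x : k) *: e2)); last by lin.
  by apply: eq_sw => p q; rewrite scalerA mulrC.
rewrite sw_exch; apply: eq_sw => p q; rewrite tgtE.
by rewrite (sw_lin _ _ (F := fun u => _ *: u)) //; lin.
Qed.
Lemma tgt_comul (Z : lmodType k) h (f : L -> L -> Z) : bil f ->
  \sw_(a, b <- Δ h) f (tgt a) b = \sw_(a, b <- Δ 1) f (tgt a) (b * h).
Proof.
move=> hf; rewrite -(@comulM1l _ h (fun a b => f (tgt a) b)); last by bil.
transitivity (\sw_(a, b <- Δ 1) \sw_(p, q <- Δ a) \sw_(c, d <- Δ h)
    ((ε (q * c) : k) *: f (tgt p) (b * d))).
  apply: eq_sw => a b; rewrite sw_exch; apply: eq_sw => c d.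
  rewrite tgt_split (sw_lin _ _ (F := fun u => f u (b * d))); last by lin.
  by apply: eq_sw => p q; rewrite (linZ (F := fun u => f u (b * d))) //; lin.
rewrite (@comulA3 _ 1 (fun p q b => \sw_(c, d <- Δ h)
    ((ε (q * c) : k) *: f (tgt p) (b * d)))); last by tril.
apply: eq_sw => a b; rewrite -(@comulM2 _ b h (fun p q => (ε p : k) *: f (tgt a) q)); last by bil.
rewrite -[in RHS](counitl1 (b * h)) (sw_lin _ _ (F := fun u => f (tgt a) u)); last by lin.
by apply: eq_sw => p q; rewrite (linZ (F := fun u => f (tgt a) u)) //; lin.
Qed.
Lemma comul_tgt (Z : lmodType k) z (f : L -> L -> Z) : bil f -> tgt z = z ->
  \sw_(a, b <- Δ z) f a b = \sw_(a, b <- Δ 1) f (a * z) b.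
Proof.
move=> hf hz; rewrite -{1}hz tgtE.
rewrite (sw_lin _ _ (F := fun u => \sw_(a, b <- Δ u) f a b)); last by lin.
transitivity (\sw_(a, b <- Δ 1) \sw_(c, d <- Δ b) ((ε (a * z) : k) *: f c d)).
  apply: eq_sw => a b; rewrite (linZ (F := fun u => \sw_(a, b <- Δ u) f a b)); last by lin.
  by rewrite (sw_lin _ _ (F := fun u => _ *: u)) //; lin.
rewrite (@comul1r3 _ (fun a c d => (ε (a * z) : k) *: f c d)); last by tril.
rewrite sw_exch; apply: eq_sw => c d; rewrite -{2}hz tgtE.
rewrite (sw_lin _ _ (F := fun u => f (c * u) d)); last by lin.
by apply: eq_sw => a b; rewrite (linZ (F := fun u => f (c * u) d)) //; lin.
Qed.
Lemma comul_mul_tgt (Z : lmodType k) h z (f : L -> L -> Z) : bil f -> tgt z = z ->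
  \sw_(a, b <- Δ (h * z)) f a b = \sw_(a, b <- Δ h) f (a * z) b.
Proof.
move=> hf hz; rewrite comulM2 //.
rewrite -(@comulM1r _ h (fun a b => f (a * z) b)); last by bil.
apply: eq_sw => a b; rewrite (@comul_tgt _ z (fun c d => f (a * c) (b * d))) //; last by bil.
by apply: eq_sw => c d; rewrite mulrA.
Qed.
Lemma osource_tgt y : osource (tgt y) = osource y.
Proof.
rewrite /osource; apply: eq_sw => a b; congr (_ *: _).
rewrite (counitM1 b y) tgtE (sw_lin _ _ (F := fun u => ε (b * u))); last by lin.
by apply: (@eq_sw _ _ _ k^o) => c d; rewrite -scalerAr linearZ.
Qed.
Lemma osrc_counit h z : \sw_(a, b <- Δ h) ((ε (b * z) : k) *: a) = h * osource z.
Proof.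
rewrite -(@comulM1r _ h (fun a b => (ε (b * z) : k) *: a)); last by bil.
transitivity (\sw_(a, b <- Δ h) \sw_(c, d <- Δ 1) \sw_(p, q <- Δ d)
   ((ε (q * z) : k) *: ((ε (b * p) : k) *: (a * c)))).
  apply: eq_sw => a b; apply: eq_sw => c d; rewrite (counitMl hD).
  rewrite (sw_lin _ _ (F := fun x : k^o => (x : k) *: (a * c))); last by lin.
  by apply: eq_sw => p q; rewrite scalerA mulrC.
transitivity (\sw_(a, b <- Δ h) \sw_(c, d <- Δ 1) \sw_(p, q <- Δ c)
   ((ε (d * z) : k) *: ((ε (b * q) : k) *: (a * p)))).
  apply: eq_sw => a b.
  by rewrite -(@comulA3 _ 1 (fun c p q => ((ε (q * z) : k) *: ((ε (b * p) : k) *: (a * c))))) //; tril.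
rewrite sw_exch /osource (sw_lin _ _ (F := fun u => h * u)); last by lin.
apply: eq_sw => c d.
rewrite -scalerAr -[h * c in RHS]counitr1 comulM2; last by bil.
rewrite (sw_lin _ _ (F := fun u => _ *: u)); last by lin.
apply: eq_sw => a b.
by rewrite (sw_lin _ _ (F := fun u => _ *: u)) //; lin.
Qed.
Lemma comul1_osrc (Z : lmodType k) z (f : L -> L -> Z) : bil f -> tgt z = z ->
  \sw_(a, b <- Δ 1) f (a * osource z) b = \sw_(a, b <- Δ 1) f a (b * z).
Proof.
move=> hf hz.
transitivity (\sw_(a, b <- Δ 1) \sw_(c, d <- Δ a) ((ε (d * z) : k) *: f c b)).
  apply: eq_sw => a b; rewrite -osrc_counit (sw_lin _ _ (F := fun u => f u b)); last by lin.
  by apply: eq_sw => c d; rewrite (linZ (F := fun u => f u b)) //; lin.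
rewrite (@comulA3 _ 1 (fun c d b => (ε (d * z) : k) *: f c b)); last by tril.
apply: eq_sw => a b.
rewrite -[b * z]counitl1 comul_mul_tgt //; last by bil.
rewrite (sw_lin _ _ (F := fun u => f a u)); last by lin.
by apply: eq_sw => c d; rewrite (linZ (F := fun u => f a u)) //; lin.
Qed.
Lemma osource1 : osource 1 = 1.
Proof.
rewrite -[LHS]mul1r -osrc_counit -[RHS]counitr1.
by apply: eq_sw => a b; rewrite mulr1.
Qed.

Ltac pstep ::= lineta; lazymatch goal with
 | |- lin (fun v => ptm (@?a v) (@?b v)) => first [apply: lin_ptml | apply: lin_ptmr]
 | |- lin (fun v => fun_of_lfun (mlift (@?a v)) (@?b v)) => first [apply: lin_lf | apply: lin_mlift]
 | |- lin (fun v => uval (@?a v)) => apply: lin_uval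
 | |- lin (fun v => uproj (@?a v)) => apply: lin_uproj
 | |- _ => linstep end.

Section Unitors.
Variable V : fdmod L.

Definition rlunit_fun (z : uobj) (v : V) : V := modact V (uval z) v.
Lemma rlunit_bil : bil rlunit_fun. Proof. by rewrite /rlunit_fun; bil. Qed.
Lemma rlunit_act h z v :
  \sw_(a, b <- Δ h) rlunit_fun (modact uobj a z) (modact V b v) = modact V h (rlunit_fun z v).
Proof.
rewrite /rlunit_fun -modactME -[h * _]tgt_counit comul_mul_tgt ?uval_fix //; last by bil.
rewrite (sw_lin _ _ (F := fun u => modact V u v)); last by lin.
by apply: eq_sw => a b; rewrite uval_act modactME.
Qed.
Lemma rlunit_bal z v :
  \sw_(a, b <- Δ 1) rlunit_fun (modact uobj a z) (modact V b v) = rlunit_fun z v.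
Proof. by rewrite rlunit_act modact1E. Qed.
Definition rlunit : rhom (tobj uobj V) V := mkhom2 rlunit_bil rlunit_bal rlunit_act.
Lemma rlunit_pt z v : vsval rlunit (z ⊠ v) = modact V (uval z) v.
Proof. exact: mkhom2_pt. Qed.

Definition rlunit_inv (v : V) : tobj uobj V := \sw_(a, b <- Δ 1) (uproj a ⊠ modact V b v).
Lemma rlunit_invK v : vsval rlunit (rlunit_inv v) = v.
Proof.
rewrite /rlunit_inv sw_lin; last by lin.
rewrite -[RHS]modact1E -[1 in RHS]tgt_counit (sw_lin _ _ (F := fun u => modact V u v)); last by lin.
by apply: eq_sw => a b; rewrite rlunit_pt uval_proj modactME.
Qed.
Lemma rlunitK u : rlunit_inv (vsval rlunit u) = u.
Proof.
move: u; apply: ptm_ext => [||z v]; try by rewrite /rlunit_inv; lin.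
rewrite rlunit_pt /rlunit_inv [RHS]ptm_bal.
transitivity (\sw_(a, b <- Δ 1) (uproj (tgt a) ⊠ modact V (b * uval z) v)).
  by apply: eq_sw => a b; rewrite modactME /uproj tgtK.
rewrite -(@tgt_comul _ (uval z) (fun a b => uproj a ⊠ modact V b v)); last by bil.
rewrite comul_tgt ?uval_fix //; last by bil.
by apply: eq_sw => a b; rewrite uact_proj /uproj tgtK.
Qed.

Definition rrunit_fun (v : V) (z : uobj) : V := modact V (osource (uval z)) v.
Lemma rrunit_bil : bil rrunit_fun. Proof. by rewrite /rrunit_fun /osource; bil. Qed.
Lemma rrunit_act h v z :
  \sw_(a, b <- Δ h) rrunit_fun (modact V a v) (modact uobj b z) = modact V h (rrunit_fun v z).
Proof.
rewrite /rrunit_fun -modactME -osrc_counit -(@comulM1l _ h (fun a b => (ε (b * uval z) : k) *: a)); last by bil.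
rewrite sw_exch (sw_lin _ _ (F := fun u => modact V u v)); last by lin.
apply: eq_sw => a b; rewrite uval_act osource_tgt -modactME /osource; congr (modact V _ v).
rewrite (sw_lin _ _ (F := fun u => u * a)); last by lin.
by apply: eq_sw => c d; rewrite mulrA -scalerAl.
Qed.
Lemma rrunit_bal v z :
  \sw_(a, b <- Δ 1) rrunit_fun (modact V a v) (modact uobj b z) = rrunit_fun v z.
Proof. by rewrite rrunit_act modact1E. Qed.
Definition rrunit : rhom (tobj V uobj) V := mkhom2 rrunit_bil rrunit_bal rrunit_act.
Lemma rrunit_pt v z : vsval rrunit (v ⊠ z) = modact V (osource (uval z)) v.
Proof. exact: mkhom2_pt. Qed.

Definition rrunit_inv (v : V) : tobj V uobj := \sw_(a, b <- Δ 1) (modact V a v ⊠ uproj b).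
Lemma rrunit_invK v : vsval rrunit (rrunit_inv v) = v.
Proof.
rewrite /rrunit_inv sw_lin; last by lin.
transitivity (modact V (\sw_(a, b <- Δ 1) (osource b * a)) v).
  rewrite (sw_lin _ _ (F := fun u => modact V u v)); last by lin.
  by apply: eq_sw => a b; rewrite rrunit_pt uval_proj osource_tgt modactME.
rewrite -[RHS]modact1E; congr (modact V _ v).
rewrite -[RHS]counitr1 -(@comulM1l _ 1 (fun a b => (ε b : k) *: a)); last by bil.
rewrite [RHS]sw_exch; apply: eq_sw => a b; rewrite /osource.
rewrite (sw_lin _ _ (F := fun u => u * a)); last by lin.
by apply: eq_sw => c d; rewrite -scalerAl.
Qed.
Lemma rrunitK u : rrunit_inv (vsval rrunit u) = u.
Proof.
move: u; apply: ptm_ext => [||v z]; try by rewrite /rrunit_inv; lin.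
rewrite rrunit_pt /rrunit_inv [RHS]ptm_bal.
transitivity (\sw_(a, b <- Δ 1) (modact V (a * osource (uval z)) v ⊠ uproj b)).
  by apply: eq_sw => a b; rewrite modactME.
rewrite (@comul1_osrc _ _ (fun a b => modact V a v ⊠ uproj b)) ?uval_fix //; last by bil.
by apply: eq_sw => a b; rewrite uact_proj.
Qed.
End Unitors.

Lemma rtriangle V W (v : V) (z : uobj) (w : W) :
  modact V (osource (uval z)) v ⊠ w = v ⊠ modact W (uval z) w.
Proof.
rewrite ptm_bal [RHS]ptm_bal.
transitivity (\sw_(a, b <- Δ 1) (modact V (a * osource (uval z)) v ⊠ modact W b w)).
  by apply: eq_sw => a b; rewrite modactME.
rewrite (@comul1_osrc _ _ (fun a b => modact V a v ⊠ modact W b w)) ?uval_fix //; last by bil.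
by apply: eq_sw => a b; rewrite modactME.
Qed.

Lemma sw_flip (V W : vectType k) (Z : lmodType k) (t : tensor V W) (f : W -> V -> Z) : bil f ->
  \sw_(a, b <- flip t) f a b = \sw_(a, b <- t) f b a.
Proof. by move=> hf; rewrite /flip sw_sw; apply: eq_sw => a b; rewrite sw_tens. Qed.

Variable R : tensor L L.
Hypothesis hR : qt_weak_hopf D R.

Section Braid.
Variables V W : fdmod L.
Definition rbraid_fun (v : V) (w : W) : tobj W V := \sw_(r, s <- R) (modact W s w ⊠ modact V r v).
Lemma rbraid_bil : bil rbraid_fun. Proof. by rewrite /rbraid_fun; bil. Qed.
Lemma rbraid_mul (t : tensor L L) v w :
  \sw_(a, b <- t) rbraid_fun (modact V a v) (modact W b w) =
  \sw_(r, s <- tmul R t) (modact W s w ⊠ modact V r v).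
Proof.
rewrite sw_tmul; last by bil.
rewrite /rbraid_fun sw_exch; apply: eq_sw => a b; apply: eq_sw => r s.
by rewrite !modactME.
Qed.
Lemma RΔ1 : tmul R (Δ 1) = R.
Proof. by rewrite -{1}(qtw_corner hR) -tmulA tmul1l; exact: qtw_corner. Qed.
Lemma rbraid_bal v w :
  \sw_(a, b <- Δ 1) rbraid_fun (modact V a v) (modact W b w) = rbraid_fun v w.
Proof. by rewrite rbraid_mul RΔ1. Qed.
Lemma rbraid_act h v w :
  \sw_(a, b <- Δ h) rbraid_fun (modact V a v) (modact W b w) = modact (tobj W V) h (rbraid_fun v w).
Proof.
rewrite rbraid_mul (qtw_comul hR) sw_tmul; last by bil.
rewrite sw_flip; last by bil.
rewrite sw_exch sw_lin; last by lin.
apply: eq_sw => r s; rewrite ptm_act; apply: eq_sw => a b.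
by rewrite !modactME.
Qed.
Definition rbraid : rhom (tobj V W) (tobj W V) := mkhom2 rbraid_bil rbraid_bal rbraid_act.
Lemma rbraid_pt v w : vsval rbraid (v ⊠ w) = \sw_(r, s <- R) (modact W s w ⊠ modact V r v).
Proof. exact: mkhom2_pt. Qed.
End Braid.

Lemma rbraid_iso V W : exists2 h, rcomp h (rbraid V W) = rid _ & rcomp (rbraid V W) h = rid _.
Proof.
have [Q hQ [RQ QR]] := qtw_inv hR.
pose f (w : W) (v : V) : tobj V W := \sw_(r, s <- Q) (modact V r v ⊠ modact W s w).
have fbil : bil f by rewrite /f; bil.
have QΔ : tmul Q (flip (Δ 1)) = Q.
  suff FF : tmul (flip (Δ 1)) (flip (Δ 1)) = flip (Δ 1) by rewrite -{1}hQ -tmulA FF hQ.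
  by rewrite -RQ -tmulA [tmul Q (tmul R Q)]tmulA QR tmulA RΔ1.
have fQ (t : tensor L L) w v :
    \sw_(a, b <- t) f (modact W b w) (modact V a v) =
    \sw_(r, s <- tmul Q t) (modact V r v ⊠ modact W s w).
  rewrite sw_tmul; last by bil.
  rewrite /f sw_exch; apply: eq_sw => a b; apply: eq_sw => r s.
  by rewrite !modactME.
have fbal w v : \sw_(a, b <- Δ 1) f (modact W a w) (modact V b v) = f w v.
  transitivity (\sw_(b, a <- flip (Δ 1)) f (modact W a w) (modact V b v)).
    by symmetry; apply: (@sw_flip _ _ _ (Δ 1) (fun b a => f (modact W a w) (modact V b v))); clear fbil; rewrite /f; bil.
  by rewrite fQ QΔ.
have gpt w v : mlift f (w ⊠ v) = f w v by exact: mlift_ptm.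
apply: (@riso _ _ _ (mlift f)) => [|u|u]; first by lin.
  move: u; apply: ptm_ext => [||w v]; try by lin.
  rewrite gpt /f sw_lin; last by lin.
  transitivity (\sw_(b, a <- flip (Δ 1)) (modact W a w ⊠ modact V b v)); last first.
    by rewrite ptm_bal; apply: (@sw_flip _ _ _ (Δ 1) (fun b a => modact W a w ⊠ modact V b v)); bil.
  rewrite -RQ sw_tmul; last by bil.
  rewrite sw_exch; apply: eq_sw => a b; rewrite rbraid_pt; apply: eq_sw => r s.
  by rewrite !modactME.
move: u; apply: ptm_ext => [||v w]; try by lin.
rewrite rbraid_pt sw_lin; last by lin.
transitivity (\sw_(r, s <- R) f (modact W s w) (modact V r v)).
  by apply: eq_sw => r s; exact: gpt.
by rewrite fQ QR -ptm_bal.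
Qed.

Lemma hexl3 (Z : lmodType k) (f : L -> L -> L -> Z) : tril f ->
  \sw_(r1, r2 <- R) \sw_(a, b <- Δ r1) f a b r2 =
  \sw_(r1, r2 <- R) \sw_(s1, s2 <- R) f r1 s1 (r2 * s2).
Proof. by move=> hf; have /= := congr1 (fun t => sweedler3 t f) (qtw_hexl hR); rewrite !sw3_sw. Qed.
Lemma hexr3 (Z : lmodType k) (f : L -> L -> L -> Z) : tril f ->
  \sw_(r1, r2 <- R) \sw_(a, b <- Δ r2) f r1 a b =
  \sw_(r1, r2 <- R) \sw_(s1, s2 <- R) f (r1 * s1) s2 r2.
Proof. by move=> hf; have /= := congr1 (fun t => sweedler3 t f) (qtw_hexr hR); rewrite !sw3_sw. Qed.

Lemma rcompE U V W (f : rhom V W) (g : rhom U V) u : vsval (rcomp f g) u = vsval f (vsval g u).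
Proof. exact: comp_lfunE. Qed.
Lemma ridE V v : vsval (rid V) v = v. Proof. exact: id_lfunE. Qed.
Lemma rhom3_ext U V W X (f g : rhom (tobj (tobj U V) W) X) :
  (forall u v w, vsval f (u ⊠ v ⊠ w) = vsval g (u ⊠ v ⊠ w)) -> f = g.
Proof.
move=> e; apply: rhom2_ext => u w; move: u; apply: ptm_ext => [||u v]; by [lin | exact: e].
Qed.
Lemma rhom3_ext' U V W X (f g : rhom (tobj U (tobj V W)) X) :
  (forall u v w, vsval f (u ⊠ (v ⊠ w)) = vsval g (u ⊠ (v ⊠ w))) -> f = g.
Proof.
move=> e; apply: rhom2_ext => u w; move: w; apply: ptm_ext => [||v w]; by [lin | exact: e].
Qed.
Lemma rhom4_ext U V W X Y (f g : rhom (tobj (tobj (tobj U V) W) X) Y) :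
  (forall u v w x, vsval f (u ⊠ v ⊠ w ⊠ x) = vsval g (u ⊠ v ⊠ w ⊠ x)) -> f = g.
Proof.
move=> e; apply: rhom3_ext => u w x; move: u; apply: ptm_ext => [||u v]; by [lin | exact: e].
Qed.

Lemma rsw U V (X Y : vectType k) (f : rhom U V) (t : tensor X Y) (F : X -> Y -> U) :
  vsval f (sweedler t F) = \sw_(a, b <- t) vsval f (F a b).
Proof. by apply: (sw_lin _ _ (F := fun u => vsval f u)); lin. Qed.
Lemma rhexl U V W (x : U) (y : V) (z : W) :
  vsval (rassoc V W U) (vsval (rbraid U (tobj V W)) (x ⊠ (y ⊠ z))) =
  vsval (rten (rid V) (rbraid U W)) (vsval (rassoc V U W)
     (vsval (rten (rbraid U V) (rid W)) (x ⊠ y ⊠ z))).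
Proof.
rewrite rbraid_pt rten_pt rbraid_pt ridE.
rewrite (sw_lin _ _ (F := fun u => u ⊠ z)); last by lin.
rewrite !rsw.
transitivity (\sw_(r, s <- R) \sw_(a, b <- Δ s) (modact V a y ⊠ (modact W b z ⊠ modact U r x))).
  apply: eq_sw => r s; rewrite ptm_act.
  rewrite (sw_lin _ _ (F := fun u => u ⊠ _)); last by lin.
  rewrite rsw.
  by apply: eq_sw => a b; rewrite rassoc_pt.
rewrite (@hexr3 _ (fun r a b => modact V a y ⊠ (modact W b z ⊠ modact U r x))); last by tril.
rewrite sw_exch; apply: eq_sw => r s.
rewrite rassoc_pt rten_pt rbraid_pt ridE (sw_lin _ _ (F := fun u => _ ⊠ u)); last by lin.
by apply: eq_sw => a b; rewrite modactME.
Qed.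
Lemma rhexr U V W (x : U) (y : V) (z : W) :
  vsval (rassoci W U V) (vsval (rbraid (tobj U V) W) (x ⊠ y ⊠ z)) =
  vsval (rten (rbraid U W) (rid V)) (vsval (rassoci U W V)
     (vsval (rten (rid U) (rbraid V W)) (x ⊠ (y ⊠ z)))).
Proof.
rewrite rbraid_pt rten_pt rbraid_pt ridE.
rewrite (sw_lin _ _ (F := fun u => x ⊠ u)); last by lin.
rewrite !rsw.
transitivity (\sw_(r, s <- R) \sw_(a, b <- Δ r) (modact W s z ⊠ modact U a x ⊠ modact V b y)).
  apply: eq_sw => r s; rewrite ptm_act.
  rewrite (sw_lin _ _ (F := fun u => _ ⊠ u)); last by lin.
  rewrite rsw.
  by apply: eq_sw => a b; rewrite rassoci_pt.
rewrite (@hexl3 _ (fun a b s => modact W s z ⊠ modact U a x ⊠ modact V b y)); last by tril.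
rewrite sw_exch; apply: eq_sw => r s.
rewrite rassoci_pt rten_pt rbraid_pt ridE (sw_lin _ _ (F := fun u => u ⊠ _)); last by lin.
by apply: eq_sw => a b; rewrite modactME.
Qed.

Lemma rcompA U V W X (f : rhom W X) (g : rhom V W) (h : rhom U V) :
  rcomp f (rcomp g h) = rcomp (rcomp f g) h.
Proof. by apply: rhom_ext => u; rewrite !rcompE. Qed.
Lemma rcomp1m U V (f : rhom U V) : rcomp (rid V) f = f.
Proof. by apply: rhom_ext => u; rewrite rcompE ridE. Qed.
Lemma rcompm1 U V (f : rhom U V) : rcomp f (rid U) = f.
Proof. by apply: rhom_ext => u; rewrite rcompE ridE. Qed.
Lemma rhomPE U V c (f g : rhom U V) u :
  vsval (c *: f + g) u = c *: vsval f u + vsval g u.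
Proof. by rewrite linearP add_lfunE scale_lfunE. Qed.
Lemma rcomp_bil U V W : bil (@rcomp U V W).
Proof.
split=> f c g h; apply: rhom_ext => u; rewrite !(rcompE, rhomPE) //.
by rewrite linearP.
Qed.
Lemma rten1 U V : rten (rid U) (rid V) = rid (tobj U V).
Proof. by apply: rhom2_ext => u v; rewrite rten_pt !ridE. Qed.
Lemma rtenM U V W U' V' W' (f : rhom V W) (g : rhom U V) (f' : rhom V' W') (g' : rhom U' V') :
  rten (rcomp f g) (rcomp f' g') = rcomp (rten f f') (rten g g').
Proof. by apply: rhom2_ext => u v; rewrite !(rcompE, rten_pt). Qed.
Lemma rten_bil U U' V V' : bil (@rten U U' V V').
Proof.
split=> f c g h; apply: rhom2_ext => u v; rewrite !(rten_pt, rhomPE).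
  exact: (@lin_ptml _ _ _ id).
exact: (@lin_ptmr _ _ _ id).
Qed.
Lemma rassocK U V W : rcomp (rassoci U V W) (rassoc U V W) = rid _.
Proof. by apply: rhom3_ext => u v w; rewrite rcompE rassoc_pt rassoci_pt ridE. Qed.
Lemma rassociK U V W : rcomp (rassoc U V W) (rassoci U V W) = rid _.
Proof. by apply: rhom3_ext' => u v w; rewrite rcompE rassoci_pt rassoc_pt ridE. Qed.
Lemma rlunit_iso V : exists2 g, rcomp g (rlunit V) = rid _ & rcomp (rlunit V) g = rid _.
Proof.
apply: (riso (g := @rlunit_inv V)); last exact: rlunitK; last exact: rlunit_invK.
by rewrite /rlunit_inv; lin.
Qed.
Lemma rrunit_iso V : exists2 g, rcomp g (rrunit V) = rid _ & rcomp (rrunit V) g = rid _.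
Proof.
apply: (riso (g := @rrunit_inv V)); last exact: rrunitK; last exact: rrunit_invK.
by rewrite /rrunit_inv; lin.
Qed.
Lemma rassoc_nat U U' V V' W W' (f : rhom U U') (g : rhom V V') (h : rhom W W') :
  rcomp (rassoc U' V' W') (rten (rten f g) h) = rcomp (rten f (rten g h)) (rassoc U V W).
Proof. by apply: rhom3_ext => u v w; rewrite !rcompE !rten_pt !rassoc_pt !rten_pt. Qed.
Lemma rlunit_nat V V' (f : rhom V V') :
  rcomp (rlunit V') (rten (rid uobj) f) = rcomp f (rlunit V).
Proof. by apply: rhom2_ext => z v; rewrite !rcompE rten_pt !rlunit_pt ridE rhomP. Qed.
Lemma rrunit_nat V V' (f : rhom V V') :
  rcomp (rrunit V') (rten f (rid uobj)) = rcomp f (rrunit V).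
Proof. by apply: rhom2_ext => v z; rewrite !rcompE rten_pt !rrunit_pt ridE rhomP. Qed.
Lemma rbraid_nat U U' V V' (f : rhom U U') (g : rhom V V') :
  rcomp (rbraid U' V') (rten f g) = rcomp (rten g f) (rbraid U V).
Proof.
apply: rhom2_ext => u v; rewrite !rcompE rten_pt !rbraid_pt rsw.
by apply: eq_sw => r s; rewrite rten_pt !rhomP.
Qed.
Lemma rpentagon U V W X :
  rcomp (rassoc U V (tobj W X)) (rassoc (tobj U V) W X) =
  rcomp (rten (rid U) (rassoc V W X))
    (rcomp (rassoc U (tobj V W) X) (rten (rassoc U V W) (rid X))).
Proof.
by apply: rhom4_ext => u v w x; rewrite !(rcompE, rten_pt, rassoc_pt, ridE).
Qed.
Lemma rtri V W :
  rcomp (rten (rid V) (rlunit W)) (rassoc V uobj W) = rten (rrunit V) (rid W).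
Proof.
apply: rhom3_ext => v z w; rewrite rcompE rassoc_pt !rten_pt !ridE.
by rewrite rlunit_pt rrunit_pt rtriangle.
Qed.
Lemma rhexagonl U V W :
  rcomp (rassoc V W U) (rcomp (rbraid U (tobj V W)) (rassoc U V W)) =
  rcomp (rten (rid V) (rbraid U W)) (rcomp (rassoc V U W) (rten (rbraid U V) (rid W))).
Proof. by apply: rhom3_ext => u v w; rewrite !rcompE rassoc_pt rhexl. Qed.
Lemma rhexagonr U V W :
  rcomp (rassoci W U V) (rcomp (rbraid (tobj U V) W) (rassoci U V W)) =
  rcomp (rten (rbraid U W) (rid V)) (rcomp (rassoci U W V) (rten (rid U) (rbraid V W))).
Proof. by apply: rhom3_ext' => u v w; rewrite !rcompE rassoci_pt rhexr. Qed.

Definition braided_Rep : braidedCategory k :=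
  @BraidedCategory k (fdmod L) rhom rid rcomp rcompA rcomp1m rcompm1 rcomp_bil
    tobj rten rten1 rtenM rten_bil
    uobj rassoc rassoci rlunit rrunit rbraid
    rassocK rassociK rlunit_iso rrunit_iso rbraid_iso
    rassoc_nat rlunit_nat rrunit_nat rbraid_nat
    rpentagon rtri rhexagonl rhexagonr.
End Rep.

Definition Rep (k : fieldType) (L : falgType k) (D : hopfData L) (R : tensor L L)
  (hR : qt_weak_hopf D R) : braidedCategory k := braided_Rep (qtw_weak hR) hR.


Section HopfWeak.
Variables (k : fieldType) (L : falgType k) (D : hopfData L).
Hypothesis hD : hopf_axioms D.
Local Notation Δ := (comul D).
Local Notation ε := (counit D).
Local Notation S := (antipode D).

Lemma hopf_sw1 (Z : lmodType k) (f : L -> L -> Z) : bil f -> \sw_(a, b <- Δ 1) f a b = f 1 1.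
Proof. by move=> hf; rewrite (hopf_comul1 hD) sw_tens. Qed.
Lemma hopf_target h : target_counital D h = (ε h : k) *: 1.
Proof.
rewrite /target_counital linfun_lin; last by lin.
by rewrite hopf_sw1 ?mul1r //; bil.
Qed.
Lemma hopf_source h : source_counital D h = (ε h : k) *: 1.
Proof.
rewrite /source_counital linfun_lin; last by lin.
by rewrite hopf_sw1 ?mulr1 //; bil.
Qed.

Lemma hopf_weak : weak_hopf_axioms D.
Proof.
have M := hopf_counitM hD.
have C := hopf_coalg hD.
split; first exact: C.
- exact: hopf_comulM.
- move=> f g h; rewrite !M.
  rewrite -{1}(counitl C g).
  rewrite (sw_lin _ _ (F := fun u => ε f * ε u * ε h)); last first.
    by move=> c u v; rewrite linearP /= mulrDr mulrDl -scalerAr -scalerAl.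
  apply: (@eq_sw _ _ _ k^o) => a b.
  by rewrite !M linearZ /= -!mulrA; congr (_ * _); rewrite -mulrA.
- move=> f g h; rewrite !M.
  rewrite -{1}(counitl C g).
  rewrite (sw_lin _ _ (F := fun u => ε f * ε u * ε h)); last first.
    by move=> c u v; rewrite linearP /= mulrDr mulrDl -scalerAr -scalerAl.
  apply: (@eq_sw _ _ _ k^o) => a b.
  by rewrite !M linearZ /= -!mulrA; congr (_ * _); rewrite mulrCA.
- rewrite hopf_sw1; last by bil.
  rewrite hopf_sw1; last by bil.
  rewrite hopf_sw1; last by bil.
  by rewrite hopf_sw1 ?mulr1 //; bil.
- rewrite hopf_sw1; last by bil.
  rewrite hopf_sw1; last by bil.
  rewrite hopf_sw1; last by bil.
  by rewrite hopf_sw1 ?mulr1 //; bil.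
- by move=> h; rewrite hopf_source hopf_antipodel.
- by move=> h; rewrite hopf_target hopf_antipoder.
move=> h.
have e : \sw_(a, b <- Δ h) \sw_(c, d <- Δ a) (S c * d * S b) =
   \sw_(a, b <- Δ h) \sw_(c, d <- Δ b) (S a * c * S d).
  have /= := congr1 (fun t => \sw_(a, b, c <- t) (S a * b * S c)) (comulA C h).
  by rewrite !sw3_sw //; tril.
rewrite -e -[in RHS](counitl C h) (sw_lin _ _ (F := fun u => S u)); last by lin.
apply: eq_sw => a b; rewrite -(sw_lin _ _ (F := fun u => u * S b)); last by lin.
by rewrite hopf_antipodel // -scalerAl mul1r linearZ.
Qed.

Variable R : tensor L L.
Lemma tmul1t (t : tensor L L) : tmul (1 ⊗ 1) t = t.
Proof.
rewrite /tmul sw_tens; last by bil.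
by under eq_sw do rewrite !mul1r; rewrite tens_sw.
Qed.
Lemma tmult1 (t : tensor L L) : tmul t (1 ⊗ 1) = t.
Proof.
rewrite /tmul -[RHS]tens_sw; apply: eq_sw => a b; rewrite sw_tens; last by bil.
by rewrite !mulr1.
Qed.
Lemma flip11 : flip (1 ⊗ 1 : tensor L L) = 1 ⊗ 1.
Proof. by rewrite /flip sw_tens //; bil. Qed.
End HopfWeak.

Lemma qt_hopf_weak (k : fieldType) (L : falgType k) (D : hopfData L) (R : tensor L L) :
  qt_hopf D R -> qt_weak_hopf D R.
Proof.
case=> hD [Q [RQ QR]] hc hl hr; split=> //.
- exact: hopf_weak.
- by rewrite (hopf_comul1 hD) flip11 tmul1t tmult1.
- exists Q; rewrite (hopf_comul1 hD) flip11 ?tmul1t ?tmult1 //.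
Qed.

Section Dual.
Variables (k : fieldType) (A : falgType k).
Local Notation dual := 'Hom(A, k^o).
Implicit Types (f : dual) (a b : A).
(* [rharp a f] is a ⇀ f and [lharp f a] is f ↼ a. *)
Definition rharp a f : dual := linfun (fun b => f (b * a)).
Definition lharp f a : dual := linfun (fun b => f (a * b)).
Definition dbas (i : 'I_(dim A)) : dual := linfun (fun a : A => (v2r a 0 i : k^o)).
(* The comultiplication of the dual of A, see [dcomulP]. *)
Definition dcomul f : tensor dual dual :=
  \sum_i \sum_j (f (bvec i * bvec j) : k) *: (dbas i ⊗ dbas j).
Lemma dbas_lin i : lin (fun a : A => (v2r a 0 i : k^o)).
Proof. by move=> c u v; rewrite linearP /= !mxE. Qed.
Lemma dcomul_lin : lin dcomul.
Proof.
move=> c u v; rewrite /dcomul scaler_sumr -big_split; apply: eq_bigr => i _.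
rewrite scaler_sumr -big_split; apply: eq_bigr => j _ /=.
by rewrite add_lfunE scale_lfunE scalerDl scalerA.
Qed.
Lemma dcomulP f a b : \sw_(f1, f2 <- dcomul f) (f1 a * f2 b) = f (a * b).
Proof.
rewrite /dcomul (lin_sum (F := fun t : tensor dual dual => \sw_(f1, f2 <- t) (f1 a * f2 b : k^o))); last by lin.
rewrite [a in RHS](bvecE a) mulr_suml linear_sum; apply: eq_bigr => i _.
rewrite (lin_sum (F := fun t : tensor dual dual => \sw_(f1, f2 <- t) (f1 a * f2 b : k^o))); last by lin.
rewrite [b in RHS](bvecE b) mulr_sumr linear_sum; apply: eq_bigr => j _.
rewrite (linZ (F := fun t : tensor dual dual => \sw_(f1, f2 <- t) (f1 a * f2 b : k^o))); last by lin.
rewrite -scalerAl -scalerAr scalerA linearZ /=.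
rewrite (@sw_tens _ _ _ _ _ _ (fun f1 f2 : dual => (f1 a * f2 b : k^o))); last first.
  by split=> u c v w; rewrite add_lfunE scale_lfunE (mulrDr, mulrDl) -(scalerAr, scalerAl).
rewrite !linfun_lin; try exact: dbas_lin.
by rewrite /GRing.scale /= mulrC.
Qed.
End Dual.

Notation dual A := 'Hom(A, _^o).

Section StronglySeparable.
Variables (k : fieldType) (A : falgType k).

Record symmetric_separability_idempotent (x : tensor A A) : Prop := {
  sep_central : forall a : A,
    \sw_(x1, x2 <- x) ((a * x1) ⊗ x2) = \sw_(x1, x2 <- x) (x1 ⊗ (x2 * a));
  sep_mul : \sw_(x1, x2 <- x) (x1 * x2) = 1;
  sep_sym : flip x = x }.

Variables (x : tensor A A) (α : dual A).
(* The condition which determines α_A *)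
Definition sep_counit := \sw_(x1, x2 <- x) ((α x1 : k) *: x2) = 1.
Hypothesis hx : symmetric_separability_idempotent x.
Hypothesis hα : sep_counit.

Lemma sep_sw (Z : lmodType k) a (f : A -> A -> Z) : bil f ->
  \sw_(x1, x2 <- x) f (a * x1) x2 = \sw_(x1, x2 <- x) f x1 (x2 * a).
Proof.
move=> hf; have := congr1 (fun t => sweedler t f) (sep_central hx a).
by rewrite !sw_sw; under eq_sw do rewrite sw_tens //; under [in RHS]eq_sw do rewrite sw_tens //.
Qed.
Lemma sep_flip (Z : lmodType k) (f : A -> A -> Z) : bil f ->
  \sw_(x1, x2 <- x) f x1 x2 = \sw_(x1, x2 <- x) f x2 x1.
Proof. by move=> hf; rewrite -{1}(sep_sym hx) sw_flip. Qed.

Lemma sep_dual1 b : \sw_(x1, x2 <- x) ((α (b * x2) : k) *: x1) = b.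
Proof.
rewrite (sep_flip (f := fun x1 x2 => (α (b * x2) : k) *: x1)); last by bil.
rewrite (sep_sw b (f := fun x1 x2 => (α x1 : k) *: x2)); last by bil.
under eq_sw do rewrite scalerAl.
by rewrite -(sw_lin _ _ (F := fun u => u * b)) ?hα ?mul1r //; lin.
Qed.
Lemma sep_dual2 b : \sw_(x1, x2 <- x) ((α (x2 * b) : k) *: x1) = b.
Proof.
rewrite -(sep_sw b (f := fun x1 x2 => (α x2 : k) *: x1)); last by bil.
rewrite (sep_flip (f := fun x1 x2 => (α x2 : k) *: (b * x1))); last by bil.
under eq_sw do rewrite scalerAr.
by rewrite -(sw_lin _ _ (F := fun u => b * u)) ?hα ?mulr1 //; lin.
Qed.
End StronglySeparable.

Lemma lin_add2 (k : fieldType) (Z Z' : lmodType k) (F : Z -> Z') : lin F -> forall u v, F (u + v) = F u + F v.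
Proof. by move=> hF u v; rewrite -[u]scale1r hF !scale1r. Qed.

Section Endo.
Variables (k : fieldType) (H A : falgType k) (x : tensor A A) (α : dual A).
Hypothesis hx : symmetric_separability_idempotent x.
Hypothesis hα : sep_counit x α.

(* B = A ⊗ H ⊗ A^*; the two proofs are needed for its unit to be one. *)
Definition endoHopf (_ : symmetric_separability_idempotent x) (_ : sep_counit x α)
  : Type := tensor A (tensor H (dual A)).
Local Notation B := (endoHopf hx hα).
HB.instance Definition _ := Vector.copy B (tensor A (tensor H (dual A))).

Definition bpure (a : A) (h : H) (f : dual A) : B := a ⊗ (h ⊗ f).
Definition bmul (s t : B) : B :=
  \sw_(a, h, f <- s) \sw_(b, g, p <- t) ((p a : k) *: bpure b (h * g) f).
Definition bone : B := \sw_(x1, x2 <- x) bpure x1 1 (rharp x2 α).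

Lemma rharp_lin : bil (@rharp k A).
Proof. by rewrite /rharp; bil. Qed.
Lemma bpure_lin (a : A) h f (Z : lmodType k) (g : Z -> A) (g' : Z -> H) (g'' : Z -> dual A) :
  (lin g -> lin (fun z => bpure (g z) h f)) /\
  (lin g' -> lin (fun z => bpure a (g' z) f)) /\
  (lin g'' -> lin (fun z => bpure a h (g'' z))).
Proof. by rewrite /bpure; split; [|split] => *; lin. Qed.
Lemma bpure_ext (Z : lmodType k) (F G : B -> Z) : lin F -> lin G ->
  (forall a h f, F (bpure a h f) = G (bpure a h f)) -> F =1 G.
Proof. exact: tens3_ext. Qed.
Lemma bmul_bil : bil bmul.
Proof.
rewrite /bmul /bpure; split=> t.
  by apply: (lin_sw3l (g := id)).
apply: lin_sw3r => a h f; exact: (lin_sw3l (g := id)).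
Qed.
Lemma bmul_pure a h f b g p :
  bmul (bpure a h f) (bpure b g p) = (p a : k) *: bpure b (h * g) f.
Proof.
rewrite /bmul sw3_tens; last first.
  split=> *; apply: lin_sw3r => *; rewrite /bpure; lin.
rewrite sw3_tens //; split=> *; rewrite /bpure; lin.
Qed.
Lemma bmulA : associative bmul.
Proof.
move=> s t u; move: s; apply: bpure_ext.
- exact: (bmul_bil.1 _).
- by apply: (lin_comp (bmul_bil.1 u)); exact: (bmul_bil.1 _).
move=> a h f; move: t; apply: bpure_ext.
- by apply: (lin_comp (bmul_bil.2 _)); exact: (bmul_bil.1 _).
- by apply: (lin_comp (bmul_bil.1 u)); exact: (bmul_bil.2 _).
move=> b g p; move: u; apply: bpure_ext.
- by apply: (lin_comp (bmul_bil.2 _)); exact: (bmul_bil.2 _).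
- exact: (bmul_bil.2 _).
move=> c l q; rewrite !bmul_pure (linZ (bmul_bil.2 _)) (linZ (bmul_bil.1 _)) !bmul_pure.
by rewrite !scalerA mulrC mulrA.
Qed.
Lemma bmul1l : left_id bone bmul.
Proof.
apply: bpure_ext; [exact: (bmul_bil.2 _) | exact: lin_id | move=> a h f].
rewrite /bone (sw_lin _ _ (bmul_bil.1 _)).
transitivity (\sw_(x1, x2 <- x) bpure a h ((f x1 : k) *: rharp x2 α)).
  by apply: eq_sw => x1 x2; rewrite bmul_pure mul1r /bpure (linZ (lin_tensr _ (lin_tensr _ (@lin_id _ _)))).
rewrite -(sw_lin _ _ (F := fun u => bpure a h u)); last by rewrite /bpure; lin.
congr bpure; apply/lfunP => b.
rewrite (sw_lin _ _ (F := fun u : dual A => u b)); last by lin.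
rewrite -[in RHS](sep_dual1 hx hα b) (sw_lin _ _ (F := fun u => f u)); last by lin.
apply: (@eq_sw _ _ _ k^o) => x1 x2; rewrite scale_lfunE linfun_lin; last by lin.
by rewrite linearZ /GRing.scale /= mulrC.
Qed.
Lemma bmul1r : right_id bone bmul.
Proof.
apply: bpure_ext; [exact: (bmul_bil.1 _) | exact: lin_id | move=> a h f].
rewrite /bone (sw_lin _ _ (bmul_bil.2 _)).
transitivity (\sw_(x1, x2 <- x) bpure ((α (a * x2) : k) *: x1) h f).
  apply: eq_sw => x1 x2; rewrite bmul_pure mulr1 /bpure.
  by rewrite (linZ (lin_tensl _ (@lin_id _ _))) linfun_lin //; lin.
rewrite -(sw_lin _ _ (F := fun u => bpure u h f)); last by rewrite /bpure; lin.
by rewrite sep_dual1.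
Qed.
Lemma bone_neq0 : bone != 0.
Proof.
apply/negP => /eqP e0.
have all0 (t : B) : t = 0.
  have := linZ (bmul_bil.1 t) 0 0; rewrite !scale0r => b0.
  by rewrite -(bmul1l t) e0 b0.
have hd : (0 < dim (tensor H (dual A)))%N by rewrite /= !muln_gt0 !FalgType_proper.
have := congr1 (fun M : 'M[k]_(_, _) => M (Ordinal (FalgType_proper A)) (Ordinal hd))
   (all0 (const_mx 1 : 'M[k]_(dim A, dim (tensor H (dual A))))).
by rewrite !mxE => /eqP; rewrite oner_eq0.
Qed.
HB.instance Definition _ := GRing.Zmodule_isNzRing.Build B bmulA bmul1l bmul1r
  (fun s t u => lin_add2 (bmul_bil.1 u) s t) (fun s t u => lin_add2 (bmul_bil.2 s) t u) bone_neq0.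
Lemma bmul_scalel c (s t : B) : c *: (s * t) = (c *: s) * t.
Proof. by rewrite -(linZ (bmul_bil.1 t)). Qed.
HB.instance Definition _ := GRing.Lmodule_isLalgebra.Build k B bmul_scalel.
Lemma bmul_scaler c (s t : B) : c *: (s * t) = s * (c *: t).
Proof. by rewrite -(linZ (bmul_bil.2 s)). Qed.
HB.instance Definition _ := GRing.Lalgebra_isAlgebra.Build k B bmul_scaler.
HB.instance Definition _ := Algebra_isFalgebra.Build k B.

Variables (D : hopfData H) (R : tensor H H) (act : 'Hom(H, 'End(A))).
(* f ◁ h *)
Definition dact (f : dual A) (h : H) : dual A := (f \o act h)%VF.

(* In the next three formulas R_1 = r1 ⊗ r2, R_2 = s1 ⊗ s2 and R_3 = t1 ⊗ t2. *)
Definition comulB : 'Hom(B, tensor B B) :=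
  linfun (fun b : B => \sw_(a, h, f <- b)
    \sw_(x1, x2 <- x) \sw_(h1, h2 <- comul D h) \sw_(f1, f2 <- dcomul f)
    \sw_(r1, r2 <- R) \sw_(s1, s2 <- R)
      (bpure (act r2 x1 * a) (s1 * h1 * r1) f2 ⊗ bpure x2 h2 (dact f1 s2))).
Definition counitB : 'Hom(B, k^o) :=
  linfun (fun b : B => \sw_(a, h, f <- b) (α a * counit D h * f 1 : k^o)).
Definition antipodeB : 'End(B) :=
  linfun (fun b : B => \sw_(a, h, f <- b)
    \sw_(x1, x2 <- x) \sw_(r1, r2 <- R) \sw_(s1, s2 <- R)
      ((dact f s2 x1 : k) *:
        bpure x2 (r1 * antipode D (s1 * h)) (lharp α (act r2 a)))).
Definition hopfB : hopfData B := HopfData comulB counitB antipodeB.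
(* x_1 = x1 ⊗ x2 and x_2 = y1 ⊗ y2 *)
Definition RB : tensor B B :=
  \sw_(x1, x2 <- x) \sw_(y1, y2 <- x) \sw_(α1, α2 <- dcomul α)
  \sw_(r1, r2 <- R) \sw_(s1, s2 <- R) \sw_(t1, t2 <- R)
    (bpure (act t2 y1 * x1) (s1 * t1) (dact α1 r2) ⊗
     bpure y2 (r1 * s2) (rharp x2 α2)).

Lemma comulB_pure a h f : comulB (bpure a h f) =
  \sw_(x1, x2 <- x) \sw_(h1, h2 <- comul D h) \sw_(f1, f2 <- dcomul f)
  \sw_(r1, r2 <- R) \sw_(s1, s2 <- R)
      (bpure (act r2 x1 * a) (s1 * h1 * r1) f2 ⊗ bpure x2 h2 (dact f1 s2)).
Proof.
rewrite /comulB linfun_lin; last by apply: (lin_sw3l (g := id)).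
rewrite sw3_tens // /bpure; split=> *; lin.
exact: dcomul_lin.
Qed.
Lemma counitB_pure a h f : counitB (bpure a h f) = α a * counit D h * f 1.
Proof.
rewrite /counitB linfun_lin; last by apply: (lin_sw3l (g := id)).
rewrite sw3_tens //; split=> *; lin.
Qed.
Lemma antipodeB_pure a h f : antipodeB (bpure a h f) =
  \sw_(x1, x2 <- x) \sw_(r1, r2 <- R) \sw_(s1, s2 <- R)
      ((dact f s2 x1 : k) *:
        bpure x2 (r1 * antipode D (s1 * h)) (lharp α (act r2 a))).
Proof.
rewrite /antipodeB linfun_lin; last by apply: (lin_sw3l (g := id)).
rewrite sw3_tens // /bpure /dact /lharp; split=> *; lin.
Qed.
End Endo.

Section Hypotheses.
Variables (k : fieldType) (H A : falgType k).

(* Every left ideal of H has a complementary left ideal. *)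
Definition semisimple : Prop :=
  forall U : {vspace H}, (forall h u, u \in U -> h * u \in U) ->
  exists W : {vspace H}, [/\ forall h w, w \in W -> h * w \in W,
    (U + W = fullv)%VS & (U :&: W = 0)%VS].

Record module_algebra (D : hopfData H) (act : 'Hom(H, 'End(A))) : Prop := {
  mact1 : act 1 = \1%VF;
  mactM : forall g h, act (g * h) = (act g \o act h)%VF;
  mact_mul : forall h a b,
    act h (a * b) = \sw_(h1, h2 <- comul D h) (act h1 a * act h2 b);
  mact_one : forall h, act h 1 = (counit D h : k) *: 1 }.

Definition quantum_commutative (R : tensor H H) (act : 'Hom(H, 'End(A))) : Prop :=
  forall a b, a * b = \sw_(r1, r2 <- R) (act r2 b * act r1 a).
End Hypotheses.

(* Main.v *)
Require Import Defs.
From HB Require Import structures.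
From mathcomp Require Import all_boot all_algebra all_field.

(** As an algebra B = End(A^* ) ⊗ H, so V |-> A^* ⊗ V is an equivalence from
    H-modules to B-modules. What has to be seen is that the coproduct of B makes
    it monoidal and that the R-matrix of B makes it braided; the axioms of a
    quasi-triangular weak Hopf algebra come out of the same computations.

    Write A^* ⊗ V as F V = Hom(A, V) ([imod]), where a ⊗ h ⊗ f sends φ to the map
    c |-> f(c) h φ(a). The idempotent x and the R-matrix of H give a product
    μ : F U ⊗ F V -> F (U ⊗ V) ([imul]),
      μ(φ, ψ)(c) = Σ R^1 φ((R^2 x^1) c) ⊗ ψ(x^2),
    and a map in the other direction,
      ν(Φ)(c, d) = Σ (R^1 ⊗ 1) Φ((R^2 d) c).
    If A^* is identified with A through α, then μ moves the second copy of A past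
    U by the braiding and multiplies in A. As R^2 distributes over x^2 x^1 = 1, one
    has μ ν = 1 ([R_sep_collapse], [imul_comul]). The formula for Δ_B says exactly
    that b in B acts on F U ⊗ F V as ν b μ ([comulB_act]).

    Since F H is a faithful B-module and a separating family of operators on each
    factor separates the elements of a tensor product ([tens_separated],
    [imod_faithful], [tensB_ext], [tensB3_ext]), every identity in a tensor power of
    B may be checked on elements of F H, where it becomes a property of μ and ν:
    - Δ_B is coassociative as μ is associative ([imul_assoc]: centrality of x and
      both hexagon identities), multiplicative as μ ν = 1, and the
      two conditions on Δ_B(1) are the Frobenius relations
      (μ ⊗ 1)(1 ⊗ ν) = ν μ = (1 ⊗ μ)(ν ⊗ 1) ([comulB_1l], [comulB_1r]);
    - ε_B is evaluation at the unit α of μ ([ounit], [counitB_eval]);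
    - the antipode identities are obtained by contracting with [R_sep_collapse]
      and with the antipode of H ([antipodeBr], [antipodeBl], [antipodeB_S]);
    - R_B is, up to the flip, F applied to the braiding, put between μ and ν
      ([RB_act]); hence R_B intertwines Δ_B with its opposite, its quasi-inverse is
      built in the same way from the inverse of R ([QB]), and the hexagons reduce to
      the Yang-Baxter equation ([hexagonBl], [hexagonBr]).

    The same μ is the monoidal structure of F ([iten]). Since Δ_B(1) acts as ν μ,
    the truncated tensor product Δ_B(1)(F U ⊗ F V) is the image of ν, on which μ is
    injective ([iten_inj]), and μ is onto as it has a section ([iten_invK]). Finally, for
    a in A and f in A^* with f(a) = 1, the element e = a ⊗ 1 ⊗ f is an idempotent
    of B with e B e isomorphic to H, and M |-> e M is inverse to F
    ([induction_equivalence]). *)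

Set Implicit Arguments.
Unset Strict Implicit.
Unset Printing Implicit Defensive.

Import GRing.Theory VectorInternalTheory.
Local Open Scope ring_scope.

Local Notation "h • v" := (modact _ h v) (at level 35, right associativity).

(** * Elements of tensor products *)

Section Separation.
Variable k : fieldType.

Lemma v2r_lin (V : vectType k) i : lin (fun v : V => (v2r v 0 i : k^o)).
Proof. by move=> c u v; rewrite linearP /= !mxE. Qed.

Lemma sw_coord (V W : vectType k) (t : tensor V W) i j :
  \sw_(v, w <- t) (v2r v 0 i * v2r w 0 j : k^o) = (t : 'M[k]_(_, _)) i j.
Proof.
rewrite -[in RHS](tens_sw t).
rewrite (sw_lin t _ (F := fun u : tensor V W => (u : 'M[k]_(_, _)) i j : k^o)); last first.
  by move=> c u v; rewrite !mxE.
by apply: eq_sw => v w; rewrite /tens !mxE big_ord1 mxE.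
Qed.

(** Functionals on one factor reduce the claim to the other factor. This turns
    identities between elements of tensor powers of B into identities between
    operators, where no coordinates are needed. *)
Lemma tens_separated (V W X Y : vectType k) (I J : Type)
    (r : I -> V -> X) (s : J -> W -> Y) (t u : tensor V W) :
  (forall i, lin (r i)) -> (forall j, lin (s j)) ->
  (forall v v', (forall i, r i v = r i v') -> v = v') ->
  (forall w w', (forall j, s j w = s j w') -> w = w') ->
  (forall i j, \sw_(v, w <- t) (r i v ⊗ s j w) = \sw_(v, w <- u) (r i v ⊗ s j w)) ->
  t = u.
Proof.
move=> hr hs iV iW e.
have e1 j l : \sw_(v, w <- t) ((v2r (s j w) 0 l : k) *: v) =
              \sw_(v, w <- u) ((v2r (s j w) 0 l : k) *: v).
  apply: iV => i; have hl := lin_comp (@v2r_lin _ l) (hs j).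
  have /(congr1 (fun m => \sw_(a, b <- m) ((v2r b 0 l : k) *: a))) := e i j.
  rewrite !sw_sw !(sw_lin _ _ (hr i)) => e'.
  transitivity (\sw_(v, w <- t) ((v2r (s j w) 0 l : k) *: r i v)).
    by apply: eq_sw => v w; rewrite (linZ (hr i)).
  transitivity (\sw_(v, w <- u) ((v2r (s j w) 0 l : k) *: r i v)); last first.
    by apply: eq_sw => v w; rewrite (linZ (hr i)).
  have hb : bil (fun (a : X) (b : Y) => (v2r b 0 l : k) *: a).
    split=> [b|a]; first by lin.
    by apply: lin_scalel; exact: v2r_lin.
  under eq_sw do rewrite -(sw_tens _ _ hb).
  by rewrite e'; apply: eq_sw => v w; rewrite (sw_tens _ _ hb).
apply/matrixP => i j; rewrite -!sw_coord.
have e2 : \sw_(v, w <- t) ((v2r v 0 i : k) *: w) = \sw_(v, w <- u) ((v2r v 0 i : k) *: w).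
  apply: iW => j'; rewrite -[LHS]v2rK -[RHS]v2rK; congr (r2v _).
  apply/rowP => l; rewrite !(sw_lin _ _ (hs j')).
  have hc := @v2r_lin Y l; have hd := @v2r_lin V i.
  rewrite !(sw_lin _ _ (F := fun y : Y => v2r y 0 l : k^o)) //.
  have /(congr1 (fun v => v2r v 0 i)) := e1 j' l.
  rewrite !(sw_lin _ _ hd) => e'.
  transitivity (\sw_(v, w <- t) (v2r ((v2r (s j' w) 0 l : k) *: v) 0 i : k^o)).
    by apply: (@eq_sw _ _ _ k^o) => v w; rewrite (linZ (hs j')) !linearZ !mxE mulrC.
  by rewrite e'; apply: (@eq_sw _ _ _ k^o) => v w; rewrite (linZ (hs j')) !linearZ !mxE mulrC.
have hj := @v2r_lin W j.
have /(congr1 (fun v => v2r v 0 j)) := e2.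
rewrite !(sw_lin _ _ hj) => e'.
transitivity (\sw_(v, w <- t) (v2r ((v2r v 0 i : k) *: w) 0 j : k^o)).
  by apply: (@eq_sw _ _ _ k^o) => v w; rewrite linearZ !mxE.
by rewrite e'; apply: (@eq_sw _ _ _ k^o) => v w; rewrite linearZ !mxE.
Qed.
End Separation.

Section LinTril.
Variables (k : fieldType) (Z U V W X : lmodType k) (f : U -> V -> W -> X).
Hypothesis hf : tril f.
Lemma lin_tril1 (g : Z -> U) b c : lin g -> lin (fun z => f (g z) b c).
Proof. by case: hf => h _ _ hg; apply: (lin_comp (h b c) hg). Qed.
Lemma lin_tril2 (g : Z -> V) a c : lin g -> lin (fun z => f a (g z) c).
Proof. by case: hf => _ h _ hg; apply: (lin_comp (h a c) hg). Qed.
Lemma lin_tril3 (g : Z -> W) a b : lin g -> lin (fun z => f a b (g z)).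
Proof. by case: hf => _ _ h hg; apply: (lin_comp (h a b) hg). Qed.
End LinTril.

Lemma modactZ (k : fieldType) (L : falgType k) (V : fdmod L) h c (v : V) :
  modact V h (c *: v) = c *: modact V h v.
Proof. exact: linearZ. Qed.

Lemma linearZ_bil (k : fieldType) (U V Z : lmodType k) (β : U -> V -> Z) c d u v : bil β ->
  β (c *: u) (d *: v) = (d * c) *: β u v.
Proof. by move=> hβ; rewrite (linZ (hβ.1 _)) (linZ (hβ.2 _)) scalerA mulrC. Qed.
Lemma sw_modact (k : fieldType) (L : falgType k) (V : fdmod L) (X Y : vectType k) (t : tensor X Y)
  (f : X -> Y -> V) h : modact V h (sweedler t f) = \sw_(a, b <- t) modact V h (f a b).
Proof. by rewrite (sw_lin _ _ (F := fun u => modact V h u)) //; lin. Qed.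

Lemma sw_scale_act (k : fieldType) (L : falgType k) (V : fdmod L) (X Y : vectType k)
    (t : tensor X Y) (f : X -> Y -> V) c h :
  c *: modact V h (sweedler t f) = \sw_(a, b <- t) (c *: modact V h (f a b)).
Proof. by rewrite (sw_lin _ _ (F := fun u => c *: modact V h u)) //; lin. Qed.

Lemma sw_scalel (k : fieldType) (V : lmodType k) (X Y : vectType k) (t : tensor X Y)
    (f : X -> Y -> k^o) (v : V) c :
  \sw_(a, b <- t) ((f a b * c : k) *: v) = (((sweedler t f : k) * c) : k) *: v.
Proof. by rewrite (sw_lin _ _ (F := fun u : k^o => ((u : k) * c) *: v)) //; lin. Qed.

Section Pull.
Variable k : fieldType.
Variables (Z : lmodType k) (V1 W1 V2 W2 V3 W3 V4 W4 V5 W5 : vectType k).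
Variables (t1 : tensor V1 W1) (t2 : tensor V2 W2) (t3 : tensor V3 W3) (t4 : tensor V4 W4)
  (t5 : tensor V5 W5).
(** These four move the innermost of several independent summations to the
    outermost place. *)
Lemma sw_pull2 f :
  \sw_(a1, b1 <- t1) \sw_(a2, b2 <- t2) \sw_(a3, b3 <- t3) (f a1 b1 a2 b2 a3 b3 : Z) =
  \sw_(a3, b3 <- t3) \sw_(a1, b1 <- t1) \sw_(a2, b2 <- t2) f a1 b1 a2 b2 a3 b3.
Proof. by under eq_sw => a b do rewrite sw_exch; rewrite sw_exch. Qed.
Lemma sw_pull3 f :
  \sw_(a1, b1 <- t1) \sw_(a2, b2 <- t2) \sw_(a3, b3 <- t3) \sw_(a4, b4 <- t4)
    (f a1 b1 a2 b2 a3 b3 a4 b4 : Z) =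
  \sw_(a4, b4 <- t4) \sw_(a1, b1 <- t1) \sw_(a2, b2 <- t2) \sw_(a3, b3 <- t3)
     f a1 b1 a2 b2 a3 b3 a4 b4.
Proof.
under eq_sw => a b.
  under eq_sw => c d do rewrite sw_exch.
  rewrite sw_exch.
  over.
by rewrite sw_exch.
Qed.
Lemma sw_pull4 f :
  \sw_(a1, b1 <- t1) \sw_(a2, b2 <- t2) \sw_(a3, b3 <- t3) \sw_(a4, b4 <- t4) \sw_(a5, b5 <- t5)
    (f a1 b1 a2 b2 a3 b3 a4 b4 a5 b5 : Z) =
  \sw_(a5, b5 <- t5) \sw_(a1, b1 <- t1) \sw_(a2, b2 <- t2) \sw_(a3, b3 <- t3) \sw_(a4, b4 <- t4)
     f a1 b1 a2 b2 a3 b3 a4 b4 a5 b5.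
Proof.
under eq_sw => a b.
  under eq_sw => c d.
    under eq_sw => e g do rewrite sw_exch.
    rewrite sw_exch.
    over.
  rewrite sw_exch.
  over.
by rewrite sw_exch.
Qed.
Variables (V6 W6 : vectType k) (t6 : tensor V6 W6).
Lemma sw_pull5 f :
  \sw_(a1, b1 <- t1) \sw_(a2, b2 <- t2) \sw_(a3, b3 <- t3) \sw_(a4, b4 <- t4) \sw_(a5, b5 <- t5)
  \sw_(a6, b6 <- t6) (f a1 b1 a2 b2 a3 b3 a4 b4 a5 b5 a6 b6 : Z) =
  \sw_(a6, b6 <- t6) \sw_(a1, b1 <- t1) \sw_(a2, b2 <- t2) \sw_(a3, b3 <- t3) \sw_(a4, b4 <- t4)
  \sw_(a5, b5 <- t5) f a1 b1 a2 b2 a3 b3 a4 b4 a5 b5 a6 b6.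
Proof.
under eq_sw => a b.
  under eq_sw => c d.
    under eq_sw => e g.
      under eq_sw => i j do rewrite sw_exch.
      rewrite sw_exch.
      over.
    rewrite sw_exch.
    over.
  rewrite sw_exch.
  over.
by rewrite sw_exch.
Qed.
End Pull.

Section HopfTensor.
Variables (k : fieldType) (H : falgType k) (D : hopfData H).
Hypotheses (hD : hopf_axioms D) (hW : weak_hopf_axioms D).
Implicit Types U V W : fdmod H.
Local Notation Δ := (comul D).

(** As Δ(1) = 1 ⊗ 1, nothing is cut off from a tensor product of H-modules, and
    its elements may be expanded into pure tensors by a summation over [uptm m]. *)
Definition uptm U V (m : tobj hW U V) : tensor U V := vsval (m : tcar D U V).

Lemma lin_uptm (Z : lmodType k) U V (g : Z -> tobj hW U V) : lin g -> lin (fun z => uptm (g z)).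
Proof. by rewrite /uptm => h; apply: lin_vsval. Qed.

Lemma uptm_ptm U V (u : U) (v : V) : uptm (ptm hW u v) = u ⊗ v.
Proof.
rewrite /uptm /ptm ptE vsval_tpr tact_tens (hopf_comul1 hD) sw_tens; last by bil.
by rewrite !modact1E.
Qed.

Lemma uptm_act U V h (m : tobj hW U V) :
  uptm (modact _ h m) = tact U V (Δ h) (uptm m).
Proof. exact: (tact_sub_val hW). Qed.
End HopfTensor.

Ltac constant_fun a := assert_succeeds
  (cut (forall v, a v = a v); [ | let v := fresh in intro v; cbv beta; clear v ]).
(** Linearity is decided by recursion on the term: at a binary operation, the
    side on which the variable does not occur is held fixed. *)
Ltac pstep := lineta; lazymatch goal with
 | |- lin (fun v => ptm _ (@?a v) (@?b v)) =>
     tryif constant_fun a then apply: lin_ptmr else apply: lin_ptml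
 | |- lin (fun v => GRing.mul (@?a v) (@?b v)) =>
     tryif constant_fun a then apply: lin_mulr else apply: lin_mull
 | |- lin (fun v => GRing.scale (@?a v) (@?b v)) =>
     tryif constant_fun a then apply: lin_scaler else apply: lin_scalel
 | |- lin (fun v => fun_of_lfun (@?a v) (@?b v)) =>
     tryif constant_fun a then apply: lin_lf else apply: lin_lapp
 | |- lin (fun v => tens (@?a v) (@?b v)) =>
     tryif constant_fun a then apply: lin_tensr else apply: lin_tensl
 | |- lin (fun v => sweedler (@?a v) (@?b v)) =>
     tryif constant_fun a then apply: lin_swr else apply: lin_swl
 | |- lin (fun v => uptm (@?a v)) => apply: lin_uptm
 | |- lin (fun v => rharp (@?a v) (@?b v)) =>
     first [apply: (lin_bill _ (@rharp_lin _ _)) | apply: (lin_bilr _ (@rharp_lin _ _))]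
 | |- _ => first [linstep
   | match goal with h : lin ?f |- lin (fun v => ?f _) => apply: (lin_comp h) end
   | match goal with h : tril ?f |- lin (fun v => ?f _ _ _) =>
       first [apply: (lin_tril1 h) | apply: (lin_tril2 h) | apply: (lin_tril3 h)] end] end.
Ltac lin ::= intros; repeat (pstep; intros).

Section HopfTensor2.
Variables (k : fieldType) (H : falgType k) (D : hopfData H).
Hypotheses (hD : hopf_axioms D) (hW : weak_hopf_axioms D).
Implicit Types U V W : fdmod H.
Local Notation Δ := (comul D).
Local Notation "u ⊠ v" := (ptm hW u v) (at level 40, left associativity).

Lemma sw_ptm U V (Z : lmodType k) (f : U -> V -> Z) u v : bil f ->
  \sw_(a, b <- uptm (u ⊠ v)) f a b = f u v.
Proof. by move=> hf; rewrite uptm_ptm // sw_tens. Qed.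

Lemma sw_uptm_act U V (Z : lmodType k) (f : U -> V -> Z) h (m : tobj hW U V) : bil f ->
  \sw_(u, v <- uptm (modact _ h m)) f u v =
  \sw_(a, b <- Δ h) \sw_(u, v <- uptm m) f (modact U a u) (modact V b v).
Proof.
move=> hf; rewrite uptm_act; move: m; apply: ptm_ext => [||u v]; try by lin.
rewrite uptm_ptm // tact_tens sw_sw; apply: eq_sw => a b.
by rewrite !sw_tens //; bil.
Qed.

Lemma ptm_uptm U V (m : tobj hW U V) : \sw_(u, v <- uptm m) (u ⊠ v) = m.
Proof. by move: m; apply: ptm_ext => [||u v]; [lin | lin | rewrite sw_ptm //; bil]. Qed.

Lemma sw_assoc U V W (Z : lmodType k) (f : U -> V -> W -> Z) (m : tobj hW (tobj hW U V) W) :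
  tril f ->
  \sw_(p, w <- uptm m) \sw_(u, v <- uptm p) f u v w =
  \sw_(u, q <- uptm (vsval (rassoc hW U V W) m)) \sw_(v, w <- uptm q) f u v w.
Proof.
move=> [f1 f2 f3]; move: m; apply: ptm_ext => [||p w]; try by lin.
move: p; apply: ptm_ext => [||u v]; try by lin.
rewrite rassoc_pt !sw_ptm //; try bil; by [apply: f1 | apply: f2 | apply: f3].
Qed.
End HopfTensor2.

(** * The universal R-matrix of H *)

Section UniversalR.
Variables (k : fieldType) (H : falgType k) (D : hopfData H) (R : tensor H H).
Hypothesis hH : qt_hopf D R.
Local Notation Δ := (comul D).
Local Notation ε := (counit D).
Local Notation S := (antipode D).
Local Notation hD := (qth_hopf hH).
Local Notation hR := (qt_hopf_weak hH).

Lemma sw_counitl (Z : lmodType k) (f : H -> Z) h : lin f ->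
  \sw_(a, b <- Δ h) ((ε a : k) *: f b) = f h.
Proof.
move=> hf; rewrite -[in RHS](counitl (hopf_coalg hD) h) (sw_lin _ _ hf).
by apply: eq_sw => a b; rewrite (linZ hf).
Qed.
Lemma sw_counitr (Z : lmodType k) (f : H -> Z) h : lin f ->
  \sw_(a, b <- Δ h) ((ε b : k) *: f a) = f h.
Proof.
move=> hf; rewrite -[in RHS](counitr (hopf_coalg hD) h) (sw_lin _ _ hf).
by apply: eq_sw => a b; rewrite (linZ hf).
Qed.

(** Applying ε to the first leg of (Δ ⊗ 1) R = R_13 R_23 gives R = (1 ⊗ e) R with
    e = Σ ε(R^1) R^2, and R can be cancelled. *)
Lemma R_counitl (Z : lmodType k) (f : H -> Z) : lin f ->
  \sw_(r1, r2 <- R) ((ε r1 : k) *: f r2) = f 1.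
Proof.
move=> hf; pose e := \sw_(r1, r2 <- R) ((ε r1 : k) *: r2).
have eR : tmul (1 ⊗ e) R = R.
  rewrite /tmul sw_tens; last by bil.
  under eq_sw do rewrite mul1r.
  transitivity (\sw_(r1, r2 <- R) \sw_(a, b <- Δ r1) ((ε a : k) *: (b ⊗ r2))); last first.
    rewrite -[RHS](tens_sw R); apply: eq_sw => r1 r2.
    by rewrite (sw_counitl (f := fun b => b ⊗ r2)) //; lin.
  rewrite (hexl3 hR (f := fun a b c => (ε a : k) *: (b ⊗ c))); last by tril.
  rewrite sw_exch; apply: eq_sw => s1 s2.
  rewrite /e (sw_lin _ _ (F := fun u => s1 ⊗ (u * s2))); last by lin.
  by apply: eq_sw => r1 r2; rewrite (linZ (F := fun u => s1 ⊗ (u * s2))) //; lin.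
have e1 : e = 1.
  have [Q [RQ _]] := qth_inv hH.
  have := congr1 (fun t => tmul t Q) eR.
  rewrite -tmulA RQ tmult1 => /(congr1 (fun t => \sw_(a, b <- t) ((ε a : k) *: b))).
  by rewrite !sw_tens ?(hopf_counit1 hD) ?scale1r //; bil.
rewrite -e1 (sw_lin _ _ hf); apply: eq_sw => a b; by rewrite (linZ hf).
Qed.

Lemma R_counitr (Z : lmodType k) (f : H -> Z) : lin f ->
  \sw_(r1, r2 <- R) ((ε r2 : k) *: f r1) = f 1.
Proof.
move=> hf; pose e := \sw_(r1, r2 <- R) ((ε r2 : k) *: r1).
have eR : tmul (e ⊗ 1) R = R.
  rewrite /tmul sw_tens; last by bil.
  under eq_sw do rewrite mul1r.
  transitivity (\sw_(r1, r2 <- R) \sw_(a, b <- Δ r2) ((ε b : k) *: (r1 ⊗ a))); last first.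
    rewrite -[RHS](tens_sw R); apply: eq_sw => r1 r2.
    by rewrite (sw_counitr (f := fun b => r1 ⊗ b)) //; lin.
  rewrite (hexr3 hR (f := fun a b c => (ε c : k) *: (a ⊗ b))); last by tril.
  rewrite sw_exch; apply: eq_sw => s1 s2.
  rewrite /e (sw_lin _ _ (F := fun u => (u * s1) ⊗ s2)); last by lin.
  by apply: eq_sw => r1 r2; rewrite (linZ (F := fun u => (u * s1) ⊗ s2)) //; lin.
have e1 : e = 1.
  have [Q [RQ _]] := qth_inv hH.
  have := congr1 (fun t => tmul t Q) eR.
  rewrite -tmulA RQ tmult1 => /(congr1 (fun t => \sw_(a, b <- t) ((ε b : k) *: a))).
  by rewrite !sw_tens ?(hopf_counit1 hD) ?scale1r //; bil.
rewrite -e1 (sw_lin _ _ hf); apply: eq_sw => a b; by rewrite (linZ hf).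
Qed.

(** (S ⊗ 1) R is a right inverse of R: contract the first two legs of
    (Δ ⊗ 1) R = R_13 R_23 by h1 S(h2) = ε(h). *)
Lemma R_antipode (Z : lmodType k) (f : H -> H -> Z) : bil f ->
  \sw_(r1, r2 <- R) \sw_(s1, s2 <- R) f (r1 * S s1) (r2 * s2) = f 1 1.
Proof.
move=> hf; have /= <- := hexl3 hR (f := fun a b c => f (a * S b) c); last by tril.
transitivity (\sw_(r1, r2 <- R) ((ε r1 : k) *: f 1 r2)).
  apply: eq_sw => r1 r2; rewrite -(sw_lin _ _ (F := fun u => f u r2)); last by lin.
  by rewrite (hopf_antipoder hD) (linZ (F := fun u => f u r2)) //; lin.
by apply: R_counitl; lin.
Qed.

Lemma R_comul (Z : lmodType k) (f : H -> H -> Z) h : bil f ->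
  \sw_(r1, r2 <- R) \sw_(a, b <- Δ h) f (r1 * a) (r2 * b) =
  \sw_(a, b <- Δ h) \sw_(r1, r2 <- R) f (b * r1) (a * r2).
Proof.
move=> hf; rewrite -sw_tmul // (qth_comul hH) sw_tmul // sw_flip //.
by clear -hf; bil.
Qed.
End UniversalR.

(** * The separability idempotent and its dual functional *)

Section SeparableTheory.
Variables (k : fieldType) (A : falgType k) (x : tensor A A) (α : 'Hom(A, k^o)).
Hypotheses (hx : symmetric_separability_idempotent x) (hα : sep_counit x α).

(** By symmetry of x the centrality condition also holds with its two legs
    exchanged. *)
Lemma sep_swC (Z : lmodType k) a (f : A -> A -> Z) : bil f ->
  \sw_(x1, x2 <- x) f x1 (a * x2) = \sw_(x1, x2 <- x) f (x1 * a) x2.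
Proof.
move=> hf; rewrite (sep_flip hx (f := fun x1 x2 => f x1 (a * x2))); last by bil.
rewrite (sep_sw hx a (f := fun x1 x2 => f x2 x1)); last by bil.
by rewrite (sep_flip hx (f := fun x1 x2 => f (x1 * a) x2)) //; bil.
Qed.
Lemma sep_mul1 (Z : lmodType k) (f : A -> Z) : lin f -> \sw_(x1, x2 <- x) f (x1 * x2) = f 1.
Proof. by move=> hf; rewrite -(sep_mul hx) (sw_lin _ _ hf). Qed.
Lemma sep_mul2 (Z : lmodType k) (f : A -> Z) : lin f -> \sw_(x1, x2 <- x) f (x2 * x1) = f 1.
Proof.
move=> hf; rewrite -(sep_flip hx (f := fun x1 x2 => f (x1 * x2))); last by bil.
exact: sep_mul1.
Qed.

(** The legs of x are dual bases for the form α(ab); the variants below account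
    for the order of the two arguments of the form. *)
Lemma sep_expand (Z : lmodType k) (f : A -> Z) b : lin f ->
  \sw_(x1, x2 <- x) ((α (b * x2) : k) *: f x1) = f b.
Proof.
move=> hf; rewrite -[in RHS](sep_dual1 hx hα b) (sw_lin _ _ hf).
by apply: eq_sw => x1 x2; rewrite (linZ hf).
Qed.
Lemma sep_expandl (Z : lmodType k) (f : A -> Z) b : lin f ->
  \sw_(x1, x2 <- x) ((α (x2 * b) : k) *: f x1) = f b.
Proof.
move=> hf; rewrite -[in RHS](sep_dual2 hx hα b) (sw_lin _ _ hf).
by apply: eq_sw => x1 x2; rewrite (linZ hf).
Qed.
Lemma sep_expand2 (Z : lmodType k) (f : A -> Z) b : lin f ->
  \sw_(x1, x2 <- x) ((α (x1 * b) : k) *: f x2) = f b.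
Proof.
move=> hf; rewrite (sep_flip hx (f := fun x1 x2 => (α (x1 * b) : k) *: f x2)); last by bil.
exact: sep_expandl.
Qed.
(** The same expansion in the dual space, whose elements are all of the form
    α(· a). *)
Lemma rharp_expand (f : 'Hom(A, k^o)) : \sw_(x1, x2 <- x) ((f x1 : k) *: rharp x2 α) = f.
Proof.
apply/lfunP => c; rewrite (sw_lin _ _ (F := fun g : 'Hom(A, k^o) => g c)); last by lin.
rewrite -[in RHS](sep_expand (f := fun u => f u) c); last by lin.
apply: (@eq_sw _ _ _ k^o) => y1 y2; rewrite scale_lfunE linfun_lin; last by lin.
by rewrite /GRing.scale /= mulrC.
Qed.
End SeparableTheory.

(** * The B-module Hom(A, V) *)

Section Induction.
Variables (k : fieldType) (H A : falgType k) (x : tensor A A) (α : 'Hom(A, k^o)).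
Hypotheses (hx : symmetric_separability_idempotent x) (hα : sep_counit x α).
Implicit Types U V W : fdmod H.
Local Notation B := (endoHopf H hx hα).
Local Notation pure := (bpure (H := H) hx hα).

Lemma bpureM a h f b g p : pure a h f * pure b g p = (p a : k) *: pure b (h * g) f.
Proof. exact: bmul_pure. Qed.
Lemma bpure1 : (1 : B) = \sw_(x1, x2 <- x) pure x1 1 (rharp x2 α).
Proof. by []. Qed.

Definition iact V : 'Hom(B, 'End('Hom(A, V))) :=
  linfun (fun b : B => linfun (fun φ : 'Hom(A, V) => linfun (fun c : A =>
    \sw_(a, h, f <- b) ((f c : k) *: modact V h (φ a))))).

Lemma iact_lin V (b : B) :
  (forall φ : 'Hom(A, V), lin (fun c : A => \sw_(a, h, f <- b) ((f c : k) *: modact V h (φ a)))).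
Proof. by move=> *; apply: lin_sw3r; lin. Qed.

Lemma iactE V b φ c : iact V b φ c = \sw_(a, h, f <- b) ((f c : k) *: modact V h (φ a)).
Proof.
rewrite /iact linfun_lin.
  rewrite linfun_lin; first by rewrite linfun_lin //; apply: iact_lin.
  by apply: lin_linfun => *; apply: lin_sw3r; lin.
apply: lin_linfun => [b'|φ'].
  by apply: lin_linfun => *; apply: lin_sw3r; lin.
by apply: lin_linfun => *; [apply: lin_sw3r; lin | apply: (lin_sw3l (g := id))].
Qed.

Lemma iact_pure V a h f φ c : iact V (pure a h f) φ c = (f c : k) *: modact V h (φ a).
Proof. by rewrite iactE sw3_tens //; tril. Qed.

(** A^* ⊗ V is realised as Hom(A, V) so that its elements can be evaluated,
    which removes the dual space from all later computations. *)
Definition imod V : fdmod B.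
Proof.
apply: (@Fdmod k B 'Hom(A, V) (iact V)).
  apply/lfunP => φ; apply/lfunP => c; rewrite id_lfunE bpure1.
  rewrite (sw_lin _ _ (F := fun b : B => iact V b φ c)); last by lin.
  rewrite -[RHS](sep_expand hx hα (f := fun u => φ u)); last by lin.
  by apply: eq_sw => x1 x2; rewrite iact_pure modact1E linfun_lin //; lin.
move=> b b'; apply/lfunP => φ; apply/lfunP => c; rewrite comp_lfunE; move: b.
apply: bpure_ext; try by lin.
move=> a h f; move: b'; apply: bpure_ext; try by lin.
by move=> a' h' f'; rewrite bpureM linearZ !scale_lfunE !iact_pure modactZ modactME !scalerA mulrC.
Defined.

Definition ev V (φ : imod V) (c : A) : V := (φ : 'Hom(A, V)) c.
Definition mkind V (f : A -> V) : imod V := linfun f.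
Local Notation "φ ⟨ c ⟩" := (ev φ c) (at level 2, left associativity, format "φ ⟨ c ⟩").
Lemma evE V (f : A -> V) c : lin f -> (mkind f)⟨c⟩ = f c.
Proof. by move=> hf; rewrite /ev /mkind linfun_lin. Qed.
Lemma ev_ext V (φ ψ : imod V) : (forall c, φ⟨c⟩ = ψ⟨c⟩) -> φ = ψ.
Proof. by move=> e; apply/lfunP. Qed.
Lemma lin_evl (Z : lmodType k) V (g : Z -> imod V) c : lin g -> lin (fun z => (g z)⟨c⟩).
Proof. by rewrite /ev => hg; apply: lin_lapp. Qed.
Lemma lin_evr (Z : lmodType k) V (g : Z -> A) (φ : imod V) : lin g -> lin (fun z => φ⟨g z⟩).
Proof. by rewrite /ev; lin. Qed.
Lemma lin_mkind (Z : lmodType k) V (g : Z -> A -> V) :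
  (forall z, lin (g z)) -> (forall c, lin (fun z => g z c)) -> lin (fun z => mkind (g z)).
Proof. exact: lin_linfun. Qed.
Lemma ev_pure V a h f (φ : imod V) c :
  (modact (imod V) (pure a h f) φ)⟨c⟩ = (f c : k) *: modact V h φ⟨a⟩.
Proof. exact: iact_pure. Qed.
Lemma lin_bpure1 (Z : lmodType k) (g : Z -> A) h f : lin g -> lin (fun z => pure (g z) h f).
Proof. by have [? _] := bpure_lin (H := H) hx hα 0 h f g (fun=> 0) (fun=> 0). Qed.
Lemma lin_bpure2 (Z : lmodType k) (g : Z -> H) a f : lin g -> lin (fun z => pure a (g z) f).
Proof. by have [_ [? _]] := bpure_lin (H := H) hx hα a 0 f (fun=> 0) g (fun=> 0). Qed.
Lemma lin_bpure3 (Z : lmodType k) (g : Z -> 'Hom(A, k^o)) a h : lin g -> lin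
  (fun z => pure a h (g z)).
Proof. by have [_ [_ ?]] := bpure_lin (H := H) hx hα a h 0 (fun=> 0) (fun=> 0) g. Qed.
End Induction.

Local Notation "φ ⟨ c ⟩" := (ev φ c) (at level 2, left associativity, format "φ ⟨ c ⟩").

Ltac qstep := lineta; lazymatch goal with
 | |- lin (fun v => ev (@?a v) (@?b v)) =>
     tryif constant_fun a then apply: lin_evr else apply: lin_evl
 | |- lin (fun v => mkind _ _ (@?a v)) => apply: lin_mkind
 | |- lin (fun v => bpure _ _ (@?a v) (@?b v) (@?c v)) =>
     tryif constant_fun a then (tryif constant_fun b then apply: lin_bpure3
       else apply: lin_bpure2) else apply: lin_bpure1
 | |- lin (fun v => sweedler3 (@?a v) (@?f v)) =>
     first [apply: lin_sw3r | apply: lin_sw3l]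
 | |- _ => pstep end.
Ltac lin ::= intros; repeat (qstep; intros).

(** * The R-matrix acting on A *)

Section ModuleAlgebra.
Variables (k : fieldType) (H : falgType k) (D : hopfData H) (R : tensor H H).
Hypothesis hH : qt_hopf D R.
Variables (A : falgType k) (act : 'Hom(H, 'End(A))).
Hypothesis hA : module_algebra D act.
Local Notation hR := (qt_hopf_weak hH).
Local Notation Δ := (comul D).

Lemma act1E a : act 1 a = a.
Proof. by rewrite (mact1 hA) id_lfunE. Qed.
Lemma actME g h a : act (g * h) a = act g (act h a).
Proof. by rewrite (mactM hA) comp_lfunE. Qed.

(** R^2 acts on a product through the coproduct, which the second hexagon
    identity turns into two copies of R. *)
Lemma R_actM (Z : lmodType k) (f : H -> A -> Z) a b : bil f ->
  \sw_(r1, r2 <- R) f r1 (act r2 (a * b)) =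
  \sw_(r1, r2 <- R) \sw_(s1, s2 <- R) f (r1 * s1) (act s2 a * act r2 b).
Proof.
move=> hf; rewrite -(hexr3 hR (f := fun r c d => f r (act c a * act d b))); last by tril.
apply: eq_sw => r1 r2; rewrite (mact_mul hA).
by rewrite (sw_lin _ _ (F := fun u => f r1 u)) //; lin.
Qed.
Lemma R_act1 (Z : lmodType k) (f : H -> A -> Z) : bil f ->
  \sw_(r1, r2 <- R) f r1 (act r2 1) = f 1 1.
Proof.
move=> hf; rewrite -(R_counitr hH (f := fun r => f r 1)); last by lin.
by apply: eq_sw => r1 r2; rewrite (mact_one hA) (linZ (F := fun u => f r1 u)) //; lin.
Qed.
(** The first hexagon identity, with the third leg acting on A. *)
Lemma R_comul_act (Z : lmodType k) (f : H -> H -> A -> Z) a : tril f ->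
  \sw_(r1, r2 <- R) \sw_(p, q <- Δ r1) f p q (act r2 a) =
  \sw_(r1, r2 <- R) \sw_(s1, s2 <- R) f r1 s1 (act r2 (act s2 a)).
Proof.
move=> [h1 h2 h3].
rewrite (hexl3 hR (f := fun p q r => f p q (act r a))); last by tril;
  [apply: h1|apply: h2|apply: (lin_comp (h3 _ _)); lin].
by apply: eq_sw => r1 r2; apply: eq_sw => s1 s2; rewrite actME.
Qed.
End ModuleAlgebra.

(** * The product of induced modules *)

Section Transfer.
Variables (k : fieldType) (H : falgType k) (D : hopfData H) (R : tensor H H).
Hypothesis hH : qt_hopf D R.
Variables (A : falgType k) (act : 'Hom(H, 'End(A))).
Hypothesis hA : module_algebra D act.
Variables (x : tensor A A) (α : 'Hom(A, k^o)).
Hypotheses (hx : symmetric_separability_idempotent x) (hα : sep_counit x α).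
Implicit Types U V W : fdmod H.
Local Notation hR := (qt_hopf_weak hH).
Local Notation hW := (qtw_weak hR).
Local Notation hD := (qth_hopf hH).
Local Notation Δ := (comul D).
Local Notation ΔB := (comulB hx hα D R act).
Local Notation "u ⊠ v" := (ptm hW u v) (at level 40, left associativity).
Local Notation F := (imod hx hα).

(** Under A^* ≅ A, a |-> α(· a), this is the product of A ⊗ U and A ⊗ V in
    which the second copy of A passes U by the braiding and is then multiplied
    with the first. *)
Definition imul U V (φ : F U) (ψ : F V) : F (tobj hW U V) :=
  mkind hx hα (fun c : A => \sw_(x1, x2 <- x) \sw_(r1, r2 <- R)
    ((r1 • φ⟨act r2 x1 * c⟩) ⊠ ψ⟨x2⟩)).
Lemma imulE U V (φ : F U) (ψ : F V) c : (imul φ ψ)⟨c⟩ =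
  \sw_(x1, x2 <- x) \sw_(r1, r2 <- R) ((r1 • φ⟨act r2 x1 * c⟩) ⊠ ψ⟨x2⟩).
Proof. by rewrite /imul evE //; lin. Qed.
Lemma sw_imul U V (Z : lmodType k) (β : U -> V -> Z) (φ : F U) (ψ : F V) c : bil β ->
  \sw_(u, v <- uptm (imul φ ψ)⟨c⟩) β u v =
  \sw_(x1, x2 <- x) \sw_(r1, r2 <- R) β (r1 • φ⟨act r2 x1 * c⟩) ψ⟨x2⟩.
Proof.
move=> hβ; rewrite imulE.
rewrite (sw_lin _ _ (F := fun m => \sw_(u, v <- uptm m) β u v)); last by lin.
apply: eq_sw => x1 x2.
rewrite (sw_lin _ _ (F := fun m => \sw_(u, v <- uptm m) β u v)); last by lin.
by apply: eq_sw => r1 r2; rewrite (sw_ptm hD).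
Qed.
Lemma imul_bil U V : bil (@imul U V).
Proof. by rewrite /imul; bil. Qed.
Lemma lin_imull (Z : lmodType k) U V (g : Z -> F U) (ψ : F V) : lin g -> lin
  (fun z => imul (g z) ψ).
Proof. exact: lin_bill (@imul_bil U V). Qed.
Lemma lin_imulr (Z : lmodType k) U V (g : Z -> F V) (φ : F U) : lin g -> lin
  (fun z => imul φ (g z)).
Proof. exact: lin_bilr (@imul_bil U V). Qed.

(** This is what the definition of Δ_B means: b acts on F U ⊗ F V by taking the
    product, acting by b, and splitting again by the section
    Φ |-> Σ (R^1 ⊗ 1) Φ((R^2 d) c) of the product. *)
Lemma comulB_act U V (Z : lmodType k) (β : U -> V -> Z) (φ : F U) (ψ : F V) c d b :
  bil β ->
  \sw_(p, q <- ΔB b) β (p • φ)⟨c⟩ (q • ψ)⟨d⟩ =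
  \sw_(s1, s2 <- R) \sw_(u, v <- uptm (b • imul φ ψ)⟨act s2 d * c⟩) β (s1 • u) v.
Proof.
move=> hβ; move: b; apply: bpure_ext; [lin | lin | move=> a h f].
transitivity (\sw_(x1, x2 <- x) \sw_(h1, h2 <- Δ h) \sw_(f1, f2 <- dcomul f)
    \sw_(r1, r2 <- R) \sw_(s1, s2 <- R)
    ((f1 (act s2 d) * f2 c : k) *: β ((s1 * h1 * r1) • φ⟨act r2 x1 * a⟩) (h2 • ψ⟨x2⟩))).
  rewrite comulB_pure; do 5!(rewrite sw_sw; apply: eq_sw => ? ?).
  rewrite sw_tens; last by bil.
  by rewrite !ev_pure (linearZ_bil _ _ _ _ hβ) comp_lfunE.
transitivity (\sw_(s1, s2 <- R) \sw_(x1, x2 <- x) \sw_(r1, r2 <- R) \sw_(h1, h2 <- Δ h)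
    ((f (act s2 d * c) : k) *: β ((s1 * h1 * r1) • φ⟨act r2 x1 * a⟩) (h2 • ψ⟨x2⟩))); last first.
  apply: eq_sw => s1 s2; rewrite ev_pure imulE sw_modact.
  rewrite (linZ (F := fun m => \sw_(u, v <- uptm m) β (s1 • u) v)); last by lin.
  rewrite (sw_lin _ _ (F := fun m => _ *: \sw_(u, v <- uptm m) β (s1 • u) v)); last by lin.
  apply: eq_sw => x1 x2.
  rewrite sw_modact (sw_lin _ _ (F := fun m => _ *: \sw_(u, v <- uptm m) β (s1 • u) v));
    last by lin.
  apply: eq_sw => r1 r2.
  rewrite ptm_act (sw_lin _ _ (F := fun m => _ *: \sw_(u, v <- uptm m) β (s1 • u) v)); last by lin.
  apply: eq_sw => h1 h2; rewrite (sw_ptm hD); last by bil.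
  by rewrite -!modactME.
rewrite [RHS]sw_exch; apply: eq_sw => x1 x2.
under [RHS]eq_sw => s1 s2 do rewrite sw_exch.
rewrite [RHS]sw_exch; apply: eq_sw => h1 h2.
rewrite sw_exch [RHS]sw_exch; apply: eq_sw => r1 r2.
rewrite sw_exch; apply: eq_sw => s1 s2.
rewrite -(dcomulP f) (sw_lin _ _ (F := fun u : k^o => (u : k) *: β _ _)) //; lin.
Qed.

(** R^2 distributes over x^2 x^1 = 1 and is then absorbed by the unit of A. This
    is why the section is a right inverse of the product. *)
Lemma R_sep_collapse (Z : lmodType k) (g : H -> A -> Z) : bil g ->
  \sw_(x1, x2 <- x) \sw_(r1, r2 <- R) \sw_(s1, s2 <- R)
    g (r1 * s1) (act s2 x2 * act r2 x1) = g 1 1.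
Proof.
move=> hg; transitivity (\sw_(x1, x2 <- x) \sw_(r1, r2 <- R) g r1 (act r2 (x2 * x1))).
  by apply: eq_sw => x1 x2; rewrite (R_actM hH hA) //.
rewrite sw_exch -[RHS](R_act1 hH hA hg); apply: eq_sw => r1 r2.
by rewrite (sep_mul2 hx (f := fun a => g r1 (act r2 a))) //; lin.
Qed.

(** The section is a right inverse of the product, hence the product is
    B-linear. *)
Lemma imul_comul U V (φ : F U) (ψ : F V) b :
  \sw_(p, q <- ΔB b) imul (p • φ) (q • ψ) = b • imul φ ψ.
Proof.
apply: ev_ext => z; rewrite (sw_lin _ _ (F := fun Φ => Φ⟨z⟩)); last by lin.
transitivity (\sw_(x1, x2 <- x) \sw_(r1, r2 <- R) \sw_(p, q <- ΔB b)
    ((r1 • (p • φ)⟨act r2 x1 * z⟩) ⊠ (q • ψ)⟨x2⟩)).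
  under [RHS]eq_sw => x1 x2 do rewrite sw_exch.
  by rewrite [RHS]sw_exch; apply: eq_sw => p q; rewrite imulE.
transitivity (\sw_(x1, x2 <- x) \sw_(r1, r2 <- R) \sw_(s1, s2 <- R)
    \sw_(u, v <- uptm (b • imul φ ψ)⟨act s2 x2 * act r2 x1 * z⟩) (((r1 * s1) • u) ⊠ v)).
  apply: eq_sw => x1 x2; apply: eq_sw => r1 r2.
  rewrite (comulB_act (β := fun u v => (r1 • u) ⊠ v)); last by bil.
  apply: eq_sw => s1 s2; rewrite mulrA; apply: eq_sw => u v; by rewrite modactME.
rewrite (R_sep_collapse (g := fun h a =>
   \sw_(u, v <- uptm (b • imul φ ψ)⟨a * z⟩) ((h • u) ⊠ v))); last by bil.
rewrite mul1r -[RHS](ptm_uptm hD); by apply: eq_sw => u v; rewrite modact1E.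
Qed.

(** The left bracketing is expanded with the first hexagon identity, and the two
    copies of R acting on φ are joined by the second one; as x is central, a leg of
    one copy of x then passes through the other copy, which gives the right
    bracketing. *)
Lemma imul_assoc U V W (φ : F U) (ψ : F V) (χ : F W) c :
  vsval (rassoc hW U V W) (imul (imul φ ψ) χ)⟨c⟩ = (imul φ (imul ψ χ))⟨c⟩.
Proof.
rewrite !imulE rsw.
transitivity (\sw_(x1, x2 <- x) \sw_(y1, y2 <- x) \sw_(r1, r2 <- R) \sw_(s1, s2 <- R)
  \sw_(q1, q2 <- R)
   ((r1 • q1 • φ⟨act q2 y1 * (act r2 (act s2 x1) * c)⟩) ⊠ ((s1 • ψ⟨y2⟩) ⊠ χ⟨x2⟩))).
  apply: eq_sw => x1 x2; rewrite rsw.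
  transitivity (\sw_(r1, r2 <- R) \sw_(p, q <- Δ r1) \sw_(y1, y2 <- x) \sw_(q1, q2 <- R)
   ((p • q1 • φ⟨act q2 y1 * (act r2 x1 * c)⟩) ⊠ ((q • ψ⟨y2⟩) ⊠ χ⟨x2⟩))).
    apply: eq_sw => r1 r2; rewrite imulE.
    rewrite (sw_lin _ _ (F := fun u => vsval (rassoc hW U V W) ((r1 • u) ⊠ χ⟨x2⟩))); last by lin.
    under eq_sw => y1 y2.
      rewrite (sw_lin _ _ (F := fun u => vsval (rassoc hW U V W) ((r1 • u) ⊠ χ⟨x2⟩))); last by lin.
      under eq_sw => q1 q2.
        rewrite ptm_act (sw_lin _ _ (F := fun u => vsval (rassoc hW U V W) (u ⊠ χ⟨x2⟩)));
          last by lin.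
        under eq_sw => a b do rewrite rassoc_pt.
        over.
      rewrite sw_exch.
      over.
    by rewrite sw_exch.
  rewrite (R_comul_act hH hA (f := fun p q a => \sw_(y1, y2 <- x) \sw_(q1, q2 <- R)
   ((p • q1 • φ⟨act q2 y1 * (a * c)⟩) ⊠ ((q • ψ⟨y2⟩) ⊠ χ⟨x2⟩)))); last by tril.
  under eq_sw => r1 r2 do rewrite sw_exch.
  by rewrite sw_exch.
transitivity (\sw_(x1, x2 <- x) \sw_(y1, y2 <- x) \sw_(s1, s2 <- R) \sw_(q1, q2 <- R)
   ((q1 • φ⟨act q2 (y1 * act s2 x1) * c⟩) ⊠ ((s1 • ψ⟨y2⟩) ⊠ χ⟨x2⟩))).
  apply: eq_sw => x1 x2; apply: eq_sw => y1 y2.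
  rewrite sw_exch; apply: eq_sw => s1 s2.
  rewrite [RHS](R_actM hH hA (f := fun h a => ((h • φ⟨a * c⟩) ⊠ ((s1 • ψ⟨y2⟩) ⊠ χ⟨x2⟩))));
    last by bil.
  by apply: eq_sw => r1 r2; apply: eq_sw => q1 q2; rewrite modactME mulrA.
rewrite sw_exch.
transitivity (\sw_(y1, y2 <- x) \sw_(x1, x2 <- x) \sw_(s1, s2 <- R) \sw_(q1, q2 <- R)
   ((q1 • φ⟨act q2 y1 * c⟩) ⊠ ((s1 • ψ⟨act s2 x1 * y2⟩) ⊠ χ⟨x2⟩))).
  rewrite sw_exch [RHS]sw_exch; apply: eq_sw => x1 x2.
  rewrite sw_exch [RHS]sw_exch; apply: eq_sw => s1 s2.
  rewrite [RHS](sep_swC hx (act s2 x1) (f := fun y1 y2 => \sw_(q1, q2 <- R)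
   ((q1 • φ⟨act q2 y1 * c⟩) ⊠ ((s1 • ψ⟨y2⟩) ⊠ χ⟨x2⟩)))) //.
  by bil.
apply: eq_sw => y1 y2.
under eq_sw => x1 x2 do rewrite sw_exch.
rewrite sw_exch; apply: eq_sw => q1 q2.
rewrite imulE (sw_lin _ _ (F := fun m => _ ⊠ m)); last by lin.
apply: eq_sw => x1 x2; by rewrite (sw_lin _ _ (F := fun m => _ ⊠ m)) //; lin.
Qed.

Definition imap U V (g : rhom U V) : rhom (F U) (F V).
Proof.
apply: (@mkhom _ _ (F U) (F V) (linfun (fun φ : F U => mkind hx hα (fun c => vsval g φ⟨c⟩)))).
have hl : lin (fun φ : F U => mkind hx hα (fun c => vsval g φ⟨c⟩)) by lin.
move=> b φ; rewrite !(linfun_lin hl).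
apply: ev_ext => c; rewrite evE; last by lin.
move: b; apply: bpure_ext; try by lin.
move=> a h f; rewrite !ev_pure (linZ (F := fun v => vsval g v)); last by lin.
by rewrite rhomP evE //; lin.
Defined.
Lemma imapE U V (g : rhom U V) (φ : F U) c : (vsval (imap g) φ)⟨c⟩ = vsval g φ⟨c⟩.
Proof.
have hl : lin (fun φ : F U => mkind hx hα (fun c => vsval g φ⟨c⟩)) by lin.
by rewrite /= (linfun_lin hl) evE //; lin.
Qed.
Lemma imap_act U V (g : rhom U V) b (φ : F U) c :
  vsval g (b • φ)⟨c⟩ = (b • vsval (imap g) φ)⟨c⟩.
Proof. by rewrite -imapE rhomP. Qed.
Lemma imul_assoc_act U V W (φ : F U) (ψ : F V) (χ : F W) b c :
  vsval (rassoc hW U V W) (b • imul (imul φ ψ) χ)⟨c⟩ = (b • imul φ (imul ψ χ))⟨c⟩.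
Proof.
rewrite imap_act; congr (b • _)⟨c⟩; apply: ev_ext => z.
by rewrite imapE imul_assoc.
Qed.
End Transfer.

(** * Faithfulness of Hom(A, H) *)

Definition regmod (k : fieldType) (L : falgType k) : fdmod L.
Proof.
apply: (@Fdmod k L L (linfun (fun h => linfun (fun g => h * g)))).
  by apply/lfunP => g; rewrite linfun_lin ?linfun_lin ?mul1r ?id_lfunE //; lin.
move=> h h'; apply/lfunP => g; rewrite comp_lfunE.
by rewrite !(linfun_lin (f := fun h => linfun (fun g => h * g))) ?linfun_lin ?mulrA //; lin.
Defined.
Lemma regmodE (k : fieldType) (L : falgType k) (h g : L) : modact (regmod L) h g = h * g.
Proof. by rewrite /= linfun_lin ?linfun_lin //; lin. Qed.

Ltac istep := lineta; lazymatch goal with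
 | |- lin (fun v => imul _ _ (@?a v) (@?b v)) =>
     tryif constant_fun a then apply: lin_imulr else apply: lin_imull
 | |- _ => qstep end.
Ltac lin ::= intros; repeat (istep; intros).

Section Faithful.
Variables (k : fieldType) (H A : falgType k) (x : tensor A A) (α : 'Hom(A, k^o)).
Hypotheses (hx : symmetric_separability_idempotent x) (hα : sep_counit x α).
Local Notation B := (endoHopf H hx hα).
Local Notation pure := (bpure (H := H) hx hα).
Local Notation F := (imod hx hα).
Local Notation reg := (regmod H).

(** By [rharp_expand] these are all the functionals on A, with values in the
    line spanned by 1 in H; they suffice to recover an element of B. *)
Definition freg (c : A) : F reg := mkind hx hα (V := reg)
  (fun a => (α (a * c) : k) *: ((1 : H) : reg)).
Lemma fregE c a : (freg c)⟨a⟩ = (α (a * c) : k) *: ((1 : H) : reg).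
Proof. by rewrite /freg evE //; lin. Qed.
Lemma freg_lin : lin freg.
Proof. by rewrite /freg; lin. Qed.

Lemma bpureZ2 a c h f : pure a (c *: h) f = c *: pure a h f.
Proof. exact: (linZ (lin_bpure2 hx hα a f (@lin_id _ H))). Qed.

(** The legs in A and A^* are expanded by x, and the leg in H is its own action
    on 1. *)
Lemma imod_rec (b : B) : b = \sw_(x1, x2 <- x) \sw_(y1, y2 <- x)
  pure x1 (b • freg x2)⟨y1⟩ (rharp y2 α).
Proof.
have hl := freg_lin.
pose rec (b : B) := \sw_(x1, x2 <- x) \sw_(y1, y2 <- x) pure x1 (b • freg x2)⟨y1⟩ (rharp y2 α).
rewrite -[RHS]/(rec b); move: b; apply: (@bpure_ext _ _ _ _ _ hx hα B id rec).
- exact: lin_id.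
- rewrite /rec; apply: lin_swr => ? b2; apply: lin_swr => c1 ?; apply: lin_bpure2.
  by have h : lin (fun z : B => (z • freg b2)⟨c1⟩) by lin.
move=> a h f; rewrite /rec.
rewrite -[in LHS](sep_expand hx hα (f := fun u => pure u h f) a); last by lin.
apply: eq_sw => x1 x2.
transitivity (\sw_(y1, y2 <- x) ((α (a * x2) * f y1 : k) *: pure x1 h (rharp y2 α))); last first.
  apply: eq_sw => y1 y2; rewrite ev_pure fregE modactZ regmodE mulr1 scalerA mulrC.
  by symmetry; apply: bpureZ2.
have hp : lin (fun g => pure x1 h g) by lin.
rewrite -{1}(rharp_expand hx hα f) (sw_lin _ _ hp)
  (sw_lin _ _ (F := fun b : B => (α (a * x2) : k) *: b)); last by lin.
by apply: eq_sw => y1 y2; rewrite (linZ hp) scalerA.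
Qed.

Lemma imod_faithful (b b' : B) :
  (forall (φ : F reg) c, (b • φ)⟨c⟩ = (b' • φ)⟨c⟩) -> b = b'.
Proof.
by move=> e; rewrite [b]imod_rec [b']imod_rec; apply: eq_sw => ? ?; apply: eq_sw => ? ?; rewrite e.
Qed.

Lemma tensB_ext (t t' : tensor B B) :
  (forall (φ ψ : F reg) c d, \sw_(p, q <- t) ((p • φ)⟨c⟩ ⊗ (q • ψ)⟨d⟩) =
     \sw_(p, q <- t') ((p • φ)⟨c⟩ ⊗ (q • ψ)⟨d⟩)) -> t = t'.
Proof.
move=> e; apply: (@tens_separated k B B reg reg (F reg * A) (F reg * A)
   (fun i p => (p • i.1)⟨i.2⟩) (fun i p => (p • i.1)⟨i.2⟩)).
- by lin.
- by lin.
- by move=> b b' eb; apply: imod_faithful => φ c; apply: (eb (φ, c)).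
- by move=> b b' eb; apply: imod_faithful => φ c; apply: (eb (φ, c)).
by move=> [φ c] [ψ d]; apply: e.
Qed.

Lemma tensB3_ext (t t' : tensor B (tensor B B)) :
  (forall (φ ψ χ : F reg) c d e,
     \sw_(p, q, r <- t) ((p • φ)⟨c⟩ ⊗ ((q • ψ)⟨d⟩ ⊗ (r • χ)⟨e⟩)) =
     \sw_(p, q, r <- t') ((p • φ)⟨c⟩ ⊗ ((q • ψ)⟨d⟩ ⊗ (r • χ)⟨e⟩))) -> t = t'.
Proof.
move=> e; apply: (@tens_separated k B (tensor B B) reg (tensor reg reg)
   (F reg * A) ((F reg * A) * (F reg * A))
   (fun i p => (p • i.1)⟨i.2⟩)
   (fun i u => \sw_(q, r <- u) ((q • i.1.1)⟨i.1.2⟩ ⊗ (r • i.2.1)⟨i.2.2⟩))).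
- by lin.
- by lin.
- by move=> b b' eb; apply: imod_faithful => φ c; apply: (eb (φ, c)).
- by move=> b b' eb; apply: tensB_ext => φ ψ c d; apply: (eb ((φ, c), (ψ, d))).
move=> [φ c] [[ψ d] [χ g]] /=; have := e φ ψ χ c d g; rewrite /sweedler3 => e'.
transitivity (\sw_(p, u <- t) \sw_(q, r <- u) ((p • φ)⟨c⟩ ⊗ ((q • ψ)⟨d⟩ ⊗ (r • χ)⟨g⟩))).
  by apply: eq_sw => p u; rewrite (sw_lin _ _ (F := fun m => _ ⊗ m)) //; lin.
by rewrite e'; apply: eq_sw => p u; rewrite (sw_lin _ _ (F := fun m => _ ⊗ m)) //; lin.
Qed.
End Faithful.

(** * Coassociativity and multiplicativity of the coproduct of B *)

Section WeakHopf.
Variables (k : fieldType) (H : falgType k) (D : hopfData H) (R : tensor H H).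
Hypothesis hH : qt_hopf D R.
Variables (A : falgType k) (act : 'Hom(H, 'End(A))).
Hypothesis hA : module_algebra D act.
Variables (x : tensor A A) (α : 'Hom(A, k^o)).
Hypotheses (hx : symmetric_separability_idempotent x) (hα : sep_counit x α).
Implicit Types U V W : fdmod H.
Local Notation hR := (qt_hopf_weak hH).
Local Notation hW := (qtw_weak hR).
Local Notation hD := (qth_hopf hH).
Local Notation Δ := (comul D).
Local Notation ΔB := (comulB hx hα D R act).
Local Notation F := (imod hx hα).
Local Notation imul := (imul hH act).

Section Triple.
Variables (U V W : fdmod H) (Z : lmodType k) (γ : U -> V -> W -> Z).
Hypothesis hγ : tril γ.

(** The section for three factors: the product e d c in A is distributed over
    the legs, each factor being moved by R past the modules on its left. *)
Definition eval3 (Φ : F (tobj hW U (tobj hW V W))) c d e : Z :=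
  \sw_(t1, t2 <- R) \sw_(r1, r2 <- R) \sw_(s1, s2 <- R)
  \sw_(u, m <- uptm Φ⟨act r2 (act s2 e) * act t2 d * c⟩) \sw_(v, w <- uptm m)
    γ ((t1 * r1) • u) (s1 • v) w.

Lemma comulB3r (φ : F U) (ψ : F V) (χ : F W) b c d e :
  \sw_(p, q <- ΔB b) \sw_(q1, q2 <- ΔB q) γ (p • φ)⟨c⟩ (q1 • ψ)⟨d⟩ (q2 • χ)⟨e⟩ =
  eval3 (b • imul φ (imul ψ χ)) c d e.
Proof.
transitivity (\sw_(s1, s2 <- R) \sw_(p, q <- ΔB b) \sw_(v, w <- uptm (q • imul ψ χ)⟨act s2 e * d⟩)
   γ (p • φ)⟨c⟩ (s1 • v) w).
  rewrite sw_exch; apply: eq_sw => p q.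
  by rewrite (comulB_act hH act (β := fun v w => γ (p • φ)⟨c⟩ v w)) //; bil.
transitivity (\sw_(s1, s2 <- R) \sw_(t1, t2 <- R)
   \sw_(u, m <- uptm (b • imul φ (imul ψ χ))⟨act t2 (act s2 e * d) * c⟩)
   \sw_(v, w <- uptm m) γ (t1 • u) (s1 • v) w).
  apply: eq_sw => s1 s2.
  rewrite (comulB_act hH act (β := fun u m => \sw_(v, w <- uptm m) γ u (s1 • v) w)) //.
  by bil.
rewrite /eval3 [RHS]sw_pull2; apply: eq_sw => s1 s2.
by rewrite (R_actM hH hA (f := fun t a => \sw_(u, m <- uptm (b • imul φ (imul ψ χ))⟨a * c⟩)
   \sw_(v, w <- uptm m) γ (t • u) (s1 • v) w)) //; bil.
Qed.

Lemma comulB3l (φ : F U) (ψ : F V) (χ : F W) b c d e :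
  \sw_(p, q <- ΔB b) \sw_(p1, p2 <- ΔB p) γ (p1 • φ)⟨c⟩ (p2 • ψ)⟨d⟩ (q • χ)⟨e⟩ =
  \sw_(s1, s2 <- R) \sw_(t1, t2 <- R) \sw_(r1, r2 <- R)
  \sw_(m, w <- uptm (b • imul (imul φ ψ) χ)⟨act t2 (act r2 e) * (act s2 d * c)⟩)
  \sw_(u, v <- uptm m) γ (s1 • t1 • u) (r1 • v) w.
Proof.
transitivity (\sw_(s1, s2 <- R) \sw_(p, q <- ΔB b) \sw_(u, v <- uptm (p • imul φ ψ)⟨act s2 d * c⟩)
   γ (s1 • u) v (q • χ)⟨e⟩).
  rewrite sw_exch; apply: eq_sw => p q.
  by rewrite (comulB_act hH act (β := fun u v => γ u v (q • χ)⟨e⟩)) //; bil.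
apply: eq_sw => s1 s2.
rewrite (comulB_act hH act (β := fun m w => \sw_(u, v <- uptm m) γ (s1 • u) v w)); last first.
  by bil.
rewrite -(R_comul_act hH hA (f := fun t r a =>
   \sw_(m, w <- uptm (b • imul (imul φ ψ) χ)⟨a * (act s2 d * c)⟩)
   \sw_(u, v <- uptm m) γ (s1 • t • u) (r • v) w)); last by tril.
apply: eq_sw => t1 t2; rewrite [RHS]sw_exch; apply: eq_sw => m w.
by rewrite (sw_uptm_act hD) //; bil.
Qed.

(** The product is associative, so both iterated coproducts are given by the same
    section. *)
Lemma comulB3A (φ : F U) (ψ : F V) (χ : F W) b c d e :
  \sw_(p, q <- ΔB b) \sw_(p1, p2 <- ΔB p) γ (p1 • φ)⟨c⟩ (p2 • ψ)⟨d⟩ (q • χ)⟨e⟩ =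
  eval3 (b • imul φ (imul ψ χ)) c d e.
Proof.
rewrite comulB3l; do 3![apply: eq_sw => ? ?].
rewrite (sw_assoc hD (f := fun u v w => γ (_ • _ • u) (_ • v) w)); last by tril.
rewrite (imul_assoc_act hH hA) mulrA; apply: eq_sw => u m; apply: eq_sw => v w.
by rewrite modactME.
Qed.

Lemma eval3_imul (φ : F U) (Ψ : F (tobj hW V W)) c d e :
  eval3 (imul φ Ψ) c d e =
  \sw_(t1, t2 <- R) \sw_(r1, r2 <- R) \sw_(s1, s2 <- R) \sw_(x1, x2 <- x) \sw_(q1, q2 <- R)
  \sw_(v, w <- uptm Ψ⟨x2⟩)
    γ ((t1 * r1 * q1) • φ⟨act q2 x1 * (act r2 (act s2 e) * act t2 d * c)⟩) (s1 • v) w.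
Proof.
rewrite /eval3; apply: eq_sw => t1 t2; apply: eq_sw => r1 r2; apply: eq_sw => s1 s2.
rewrite (sw_imul hH act (β := fun u m => \sw_(v, w <- uptm m) γ ((t1 * r1) • u) (s1 • v) w));
  last by bil.
by do 3![apply: eq_sw => ? ?]; rewrite -modactME.
Qed.
End Triple.

Lemma comulB_coassoc h :
  \sw_(h1, h2 <- ΔB h) \sw_(h11, h12 <- ΔB h1) (h11 ⊗ (h12 ⊗ h2)) =
  \sw_(h1, h2 <- ΔB h) \sw_(h21, h22 <- ΔB h2) (h1 ⊗ (h21 ⊗ h22)).
Proof.
apply: tensB3_ext => φ ψ χ c d e; rewrite !sw3_sw; try by tril.
have hγ : tril (fun u v w : regmod H => u ⊗ (v ⊗ w)) by tril.
by rewrite (comulB3A hγ) (comulB3r hγ).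
Qed.

(** Between the two actions the product meets its section, and they cancel. *)
Lemma comulB_mul g h : ΔB (g * h) = tmul (ΔB g) (ΔB h).
Proof.
apply: tensB_ext => φ ψ c d; rewrite sw_tmul; last by bil.
have hβ : bil (fun u v : regmod H => u ⊗ v) by bil.
rewrite sw_exch.
transitivity (\sw_(p, q <- ΔB h) \sw_(s1, s2 <- R)
   \sw_(u, v <- uptm (g • imul (p • φ) (q • ψ))⟨act s2 d * c⟩) ((s1 • u) ⊗ v)); last first.
  apply: eq_sw => p q; rewrite -(comulB_act hH act _ _ _ _ _ hβ).
  by apply: eq_sw => p' q'; rewrite !modactME.
rewrite sw_exch (comulB_act hH act _ _ _ _ _ hβ); apply: eq_sw => s1 s2.
rewrite modactME -(imul_comul hH hA).
by rewrite (sw_lin _ _ (F := fun Φ => \sw_(u, v <- uptm (g • Φ)⟨act s2 d * c⟩) ((s1 • u) ⊗ v)))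
  //; lin.
Qed.

(** With μ the product and ν its section, this is the Frobenius relation
    (μ ⊗ 1)(1 ⊗ ν) = ν μ. *)
Lemma comulB_1l : \sw_(e1, e2 <- ΔB 1) \sw_(e21, e22 <- ΔB e2) (e1 ⊗ (e21 ⊗ e22)) =
    \sw_(e1, e2 <- ΔB 1) \sw_(f1, f2 <- ΔB 1) (e1 ⊗ ((e2 * f1) ⊗ f2)).
Proof.
apply: tensB3_ext => φ ψ χ c d e; rewrite !sw3_sw; try by tril.
have hγ : tril (fun u v w : regmod H => u ⊗ (v ⊗ w)) by tril.
rewrite (comulB3r hγ) modact1E (eval3_imul hγ).
transitivity (\sw_(t1, t2 <- R) \sw_(x1, x2 <- x) \sw_(r1, r2 <- R) \sw_(f1, f2 <- ΔB 1)
   ((t1 • r1 • φ⟨act r2 x1 * (act t2 d * c)⟩) ⊗ ((f1 • ψ)⟨x2⟩ ⊗ (f2 • χ)⟨e⟩))); last first.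
  rewrite sw_pull3 [RHS]sw_exch; apply: eq_sw => f1 f2.
  transitivity (\sw_(e1, e2 <- ΔB 1) ((e1 • φ)⟨c⟩ ⊗ ((e2 • f1 • ψ)⟨d⟩ ⊗ (f2 • χ)⟨e⟩))); last first.
    by apply: eq_sw => e1 e2; rewrite modactME.
  rewrite (comulB_act hH act (β := fun u v => u ⊗ (v ⊗ (f2 • χ)⟨e⟩))); last by bil.
  apply: eq_sw => t1 t2; rewrite modact1E.
  by rewrite (sw_imul hH act (β := fun u v => (t1 • u) ⊗ (v ⊗ (f2 • χ)⟨e⟩))) //; bil.
apply: eq_sw => t1 t2.
transitivity (\sw_(s1, s2 <- R) \sw_(x1, x2 <- x) \sw_(r1, r2 <- R)
  \sw_(v, w <- uptm (imul ψ χ)⟨x2⟩)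
   ((t1 • r1 • φ⟨act r2 (x1 * act s2 e) * (act t2 d * c)⟩) ⊗ ((s1 • v) ⊗ w))).
  rewrite sw_exch; apply: eq_sw => s1 s2; rewrite sw_exch; apply: eq_sw => x1 x2.
  pose f (h : H) (a : A) := \sw_(v, w <- uptm (imul ψ χ)⟨x2⟩)
   ((t1 • h • φ⟨a * (act t2 d * c)⟩) ⊗ ((s1 • v) ⊗ w)).
  rewrite -/(f _ _) (R_actM hH hA (f := f)); last by rewrite /f; bil.
  apply: eq_sw => r1 r2; apply: eq_sw => q1 q2; rewrite /f.
  by apply: eq_sw => v w; rewrite !modactME !mulrA.
transitivity (\sw_(s1, s2 <- R) \sw_(x1, x2 <- x) \sw_(r1, r2 <- R)
  \sw_(v, w <- uptm (imul ψ χ)⟨act s2 e * x2⟩)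
   ((t1 • r1 • φ⟨act r2 x1 * (act t2 d * c)⟩) ⊗ ((s1 • v) ⊗ w))).
  apply: eq_sw => s1 s2.
  rewrite [RHS](sep_swC hx (act s2 e) (f := fun x1 x2 =>
    \sw_(r1, r2 <- R) \sw_(v, w <- uptm (imul ψ χ)⟨x2⟩)
   ((t1 • r1 • φ⟨act r2 x1 * (act t2 d * c)⟩) ⊗ ((s1 • v) ⊗ w)))) //.
  by bil.
rewrite sw_exch; apply: eq_sw => x1 x2; rewrite sw_exch; apply: eq_sw => r1 r2.
rewrite (comulB_act hH act (β := fun v w => _ ⊗ (v ⊗ w))); last by bil.
by rewrite modact1E.
Qed.

(** With μ the product and ν its section, this is the other Frobenius relation,
    (1 ⊗ μ)(ν ⊗ 1) = ν μ. *)
Lemma comulB_1r : \sw_(e1, e2 <- ΔB 1) \sw_(e21, e22 <- ΔB e2) (e1 ⊗ (e21 ⊗ e22)) =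
    \sw_(e1, e2 <- ΔB 1) \sw_(f1, f2 <- ΔB 1) (e1 ⊗ ((f1 * e2) ⊗ f2)).
Proof.
rewrite -comulB_coassoc.
apply: tensB3_ext => φ ψ χ c d e; rewrite !sw3_sw; try by tril.
have hγ : tril (fun u v w : regmod H => u ⊗ (v ⊗ w)) by tril.
rewrite (comulB3l hγ) modact1E.
transitivity (\sw_(s1, s2 <- R) \sw_(x1, x2 <- x) \sw_(r1, r2 <- R) \sw_(t1, t2 <- R)
   \sw_(u, v <- uptm (imul φ ψ)⟨act t2 (act r2 x1 * (act s2 e * d)) * c⟩)
   ((t1 • u) ⊗ ((s1 • r1 • v) ⊗ χ⟨x2⟩))); last first.
  transitivity (\sw_(s1, s2 <- R) \sw_(x1, x2 <- x) \sw_(r1, r2 <- R) \sw_(e1, e2 <- ΔB 1)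
    ((e1 • φ)⟨c⟩ ⊗ ((s1 • r1 • (e2 • ψ)⟨act r2 x1 * (act s2 e * d)⟩) ⊗ χ⟨x2⟩))).
    apply: eq_sw => s1 s2; apply: eq_sw => x1 x2; apply: eq_sw => r1 r2.
    rewrite (comulB_act hH act (β := fun u v => u ⊗ ((s1 • r1 • v) ⊗ χ⟨x2⟩))); last by bil.
    by rewrite modact1E.
  rewrite sw_pull3; apply: eq_sw => e1 e2.
  transitivity (\sw_(f1, f2 <- ΔB 1) ((e1 • φ)⟨c⟩ ⊗ ((f1 • e2 • ψ)⟨d⟩ ⊗ (f2 • χ)⟨e⟩))); last first.
    by apply: eq_sw => f1 f2; rewrite modactME.
  rewrite (comulB_act hH act (β := fun v w => (e1 • φ)⟨c⟩ ⊗ (v ⊗ w))); last by bil.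
  apply: eq_sw => s1 s2; rewrite modact1E.
  by rewrite (sw_imul hH act (β := fun u v => (e1 • φ)⟨c⟩ ⊗ ((s1 • u) ⊗ v))) //; bil.
(* [E] collects the dependence on the factors in H and A which R and x change. *)
pose E h1 h2 a x2 := \sw_(u, v <- uptm (imul φ ψ)⟨a * c⟩) ((h1 • u) ⊗ ((h2 • v) ⊗ χ⟨x2⟩)).
transitivity (\sw_(s1, s2 <- R) \sw_(t1, t2 <- R) \sw_(p1, p2 <- R) \sw_(x1, x2 <- x)
  \sw_(r1, r2 <- R) \sw_(q1, q2 <- R)
  E (s1 * t1 * r1) (p1 * q1) (act r2 (act q2 x1) * (act t2 (act p2 e) * act s2 d)) x2).
  transitivity (\sw_(s1, s2 <- R) \sw_(t1, t2 <- R) \sw_(p1, p2 <- R) \sw_(x1, x2 <- x)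
    \sw_(r1, r2 <- R)
    \sw_(a, b <- Δ r1) E (s1 * t1 * a) (p1 * b) (act r2 x1 * (act t2 (act p2 e) * act s2 d)) x2).
    apply: eq_sw => s1 s2; apply: eq_sw => t1 t2; apply: eq_sw => p1 p2.
    rewrite (sw_imul hH act (β := fun m w => \sw_(u, v <- uptm m)
      ((s1 • t1 • u) ⊗ ((p1 • v) ⊗ w)))); last by bil.
    apply: eq_sw => x1 x2; apply: eq_sw => r1 r2.
    rewrite (sw_uptm_act hD (f := fun u v => (s1 • t1 • u) ⊗ ((p1 • v) ⊗ χ⟨x2⟩))); last by bil.
    apply: eq_sw => a b; rewrite /E !mulrA.
    by apply: eq_sw => u v; rewrite !modactME.
  apply: eq_sw => s1 s2; apply: eq_sw => t1 t2; apply: eq_sw => p1 p2; apply: eq_sw => x1 x2.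
  rewrite (R_comul_act hH hA (f := fun h1 h2 a => E (s1 * t1 * h1) (p1 * h2)
    (a * (act t2 (act p2 e) * act s2 d)) x2)) //.
  by rewrite /E; tril.
transitivity (\sw_(p1, p2 <- R) \sw_(x1, x2 <- x) \sw_(q1, q2 <- R) \sw_(s1, s2 <- R)
  \sw_(t1, t2 <- R) \sw_(r1, r2 <- R)
  E (s1 * t1 * r1) (p1 * q1) (act r2 (act q2 x1) * (act t2 (act p2 e) * act s2 d)) x2).
  rewrite sw_pull2; apply: eq_sw => p1 p2; rewrite sw_pull2; apply: eq_sw => x1 x2.
  by rewrite sw_pull3.
apply: eq_sw => p1 p2; apply: eq_sw => x1 x2; apply: eq_sw => q1 q2.
(* Three copies of R acting on three factors of A are one acting on their product. *)
transitivity (\sw_(s1, s2 <- R) E s1 (p1 * q1) (act s2 (act q2 x1 * (act p2 e * d))) x2).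
  rewrite (R_actM hH hA (f := fun h a => E h (p1 * q1) a x2)); last by rewrite /E; bil.
  rewrite -(R_actM hH hA (f := fun h a => \sw_(r1, r2 <- R) E (h * r1) (p1 * q1)
    (act r2 (act q2 x1) * a) x2)) //.
  by rewrite /E; bil.
rewrite /E; apply: eq_sw => s1 s2; by apply: eq_sw => u v; rewrite modactME.
Qed.
End WeakHopf.

(** * The counit of B *)

Lemma source_counitalE (k : fieldType) (L : falgType k) (D : hopfData L) h :
  source_counital D h = \sw_(e1, e2 <- comul D 1) ((counit D (h * e2) : k) *: e1).
Proof. by rewrite /source_counital linfun_lin //; lin. Qed.
Lemma target_counitalE (k : fieldType) (L : falgType k) (D : hopfData L) h :
  target_counital D h = \sw_(e1, e2 <- comul D 1) ((counit D (e1 * h) : k) *: e2).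
Proof. by rewrite /target_counital linfun_lin //; lin. Qed.

Section HopfUnit.
Variables (k : fieldType) (H : falgType k) (D : hopfData H).
Hypotheses (hD : hopf_axioms D) (hW : weak_hopf_axioms D).
Local Notation one := (uobj hW).
Local Notation ε := (counit D).

(** Over a Hopf algebra the unit object is the line spanned by 1; [ucoef] is the
    coordinate on it. *)
Definition ucoef (z : one) : k^o := ε (uval z).
Definition uone : one := uproj hW 1.
Lemma lin_ucoef (Z : lmodType k) (g : Z -> one) : lin g -> lin (fun z => ucoef (g z)).
Proof. by move=> hg; rewrite /ucoef; apply: lin_lf; apply: lin_uval. Qed.
Lemma uval_ucoef z : uval z = (ucoef z : k) *: 1.
Proof. by rewrite -[LHS]uval_fix (hopf_target hD). Qed.
Lemma ucoef_one : ucoef uone = 1.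
Proof. by rewrite /ucoef /uone uval_proj (hopf_target hD) !(hopf_counit1 hD) scale1r
  (hopf_counit1 hD). Qed.
Lemma ucoefE z : z = (ucoef z : k) *: uone.
Proof.
rewrite -[LHS]uproj_val uval_ucoef /uone.
by rewrite (linZ (F := fun u => uproj hW u)) //; apply: lin_uproj; lin.
Qed.
Lemma ucoef_act h z : ucoef (h • z) = ε h * ucoef z.
Proof.
by rewrite /ucoef uval_act (hopf_target hD) linearZ /= (hopf_counitM hD) (hopf_counit1 hD)
  /GRing.scale /= mulr1.
Qed.

Lemma uobj_act h (z : one) : h • z = (ε h : k) *: z.
Proof.
rewrite [LHS]ucoefE [z in RHS]ucoefE ucoef_act scalerA.
by [].
Qed.
End HopfUnit.

Ltac ustep := lineta; lazymatch goal with
 | |- lin (fun v => ucoef (@?a v)) => apply: lin_ucoef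
 | |- _ => istep end.
Ltac lin ::= intros; repeat (ustep; intros).

Section Counit.
Variables (k : fieldType) (H : falgType k) (D : hopfData H) (R : tensor H H).
Hypothesis hH : qt_hopf D R.
Variables (A : falgType k) (act : 'Hom(H, 'End(A))).
Hypothesis hA : module_algebra D act.
Variables (x : tensor A A) (α : 'Hom(A, k^o)).
Hypotheses (hx : symmetric_separability_idempotent x) (hα : sep_counit x α).
Implicit Types U V W : fdmod H.
Local Notation hR := (qt_hopf_weak hH).
Local Notation hW := (qtw_weak hR).
Local Notation hD := (qth_hopf hH).
Local Notation B := (endoHopf H hx hα).
Local Notation pure := (bpure (H := H) hx hα).
Local Notation ε := (counit D).
Local Notation ΔB := (comulB hx hα D R act).
Local Notation F := (imod hx hα).
Local Notation imul := (imul hH act).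
Local Notation imap := (imap hx hα).
Local Notation one := (uobj hW).
Local Notation εB := (counitB hx hα D).

Local Notation uone := (uone hW).
(** The functional α corresponds to 1 in A, and is the unit for the product of
    induced modules. *)
Definition ounit : F one := mkind hx hα (fun a => (α a : k) *: uone).
Lemma ounitE c : ounit⟨c⟩ = (α c : k) *: uone.
Proof. by rewrite /ounit evE //; lin. Qed.

(** The element a ⊗ h ⊗ f sends α to α(a) ε(h) f, whose value at 1 is the
    counit. *)
Lemma counitB_eval b : εB b = ucoef (b • ounit)⟨1⟩.
Proof.
have hl : lin (fun b : B => ucoef (b • ounit)⟨1⟩) by lin.
have hl' : lin (fun b : B => εB b) by lin.
move: b; apply: (bpure_ext hl' hl) => {hl hl'} a h f.
have hu : lin (fun z : one => ucoef z) by lin.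
rewrite counitB_pure ev_pure ounitE (linZ hu) (ucoef_act hD) (linZ hu) (ucoef_one hD).
by rewrite /GRing.scale /= mulr1 mulrC [ε h * _]mulrC.
Qed.

Lemma counitB_eval_pure a h f b : εB (pure a h f * b) = f 1 * (ε h * ucoef (b • ounit)⟨a⟩).
Proof.
rewrite counitB_eval modactME ev_pure.
have hu : lin (fun z : one => ucoef z) by lin.
by rewrite (linZ hu) (ucoef_act hD).
Qed.

Lemma sw_lunit V (m : tobj hW one V) :
  \sw_(z, v <- uptm m) ((ucoef z : k) *: v) = vsval (rlunit hW V) m.
Proof.
move: m; apply: ptm_ext => [||z v]; try by lin.
rewrite rlunit_pt (uval_ucoef hD) linearZ scale_lfunE modact1E
  (sw_ptm hD hW (f := fun z v => (ucoef z : k) *: v)) //.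
by bil.
Qed.
Lemma sw_runit V (m : tobj hW V one) :
  \sw_(v, z <- uptm m) ((ucoef z : k) *: v) = vsval (rrunit hW V) m.
Proof.
move: m; apply: ptm_ext => [||v z]; try by lin.
rewrite rrunit_pt /osource (hopf_sw1 hD); last by bil.
rewrite mul1r -/(ucoef z) linearZ scale_lfunE modact1E
  (sw_ptm hD hW (f := fun v z => (ucoef z : k) *: v)) //.
by bil.
Qed.

Lemma imul_lunit V (φ : F one) (ψ : F V) c :
  vsval (rlunit hW V) (imul φ ψ)⟨c⟩ = \sw_(x1, x2 <- x) ((ucoef φ⟨x1 * c⟩ : k) *: ψ⟨x2⟩).
Proof.
rewrite -sw_lunit (sw_imul hH act (β := fun z v => (ucoef z : k) *: v)); last first.  by bil.
apply: eq_sw => x1 x2; rewrite -[in RHS](act1E hA x1).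
rewrite -(R_counitl hH (f := fun r => (ucoef φ⟨act r x1 * c⟩ : k) *: ψ⟨x2⟩)); last first.
  by lin.
by apply: eq_sw => r1 r2; rewrite (ucoef_act hD) scalerA.
Qed.
Lemma imul_runit V (φ : F V) (ψ : F one) c :
  vsval (rrunit hW V) (imul φ ψ)⟨c⟩ =
  \sw_(x1, x2 <- x) \sw_(r1, r2 <- R) ((ucoef ψ⟨x2⟩ : k) *: (r1 • φ⟨act r2 x1 * c⟩)).
Proof.
rewrite -sw_runit (sw_imul hH act (β := fun v z => (ucoef z : k) *: v)) //.
by bil.
Qed.
Lemma imul_ounitl V (ψ : F V) : vsval (imap (rlunit hW V)) (imul ounit ψ) = ψ.
Proof.
apply: ev_ext => c; rewrite imapE imul_lunit.
rewrite -[RHS](sep_expand2 hx hα (f := fun u => ψ⟨u⟩)); last by lin.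
have hu : lin (fun z : one => ucoef z) by lin.
by apply: eq_sw => x1 x2; rewrite ounitE (linZ hu) (ucoef_one hD) /GRing.scale /= mulr1.
Qed.
Lemma imul_ounitr V (φ : F V) : vsval (imap (rrunit hW V)) (imul φ ounit) = φ.
Proof.
apply: ev_ext => c; rewrite imapE imul_runit sw_exch.
have hu : lin (fun z : one => ucoef z) by lin.
transitivity (\sw_(r1, r2 <- R) (r1 • φ⟨act r2 1 * c⟩)).
  apply: eq_sw => r1 r2.
  rewrite -(sep_expand hx hα (f := fun a => r1 • φ⟨act r2 a * c⟩) 1); last by lin.
  by apply: eq_sw => x1 x2; rewrite ounitE (linZ hu) (ucoef_one hD) /GRing.scale /= mulr1 mul1r.
by rewrite (R_act1 hH hA (f := fun r a => r • φ⟨a * c⟩)) ?mul1r ?modact1E //; bil.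
Qed.

Lemma counitlB h : \sw_(h1, h2 <- ΔB h) ((εB h1 : k) *: h2) = h.
Proof.
apply: imod_faithful => ψ d.
transitivity (\sw_(h1, h2 <- ΔB h) ((ucoef (h1 • ounit)⟨1⟩ : k) *: (h2 • ψ)⟨d⟩)).
  rewrite (sw_lin _ _ (F := fun b : B => (b • ψ)⟨d⟩)); last by lin.
  apply: eq_sw => h1 h2; rewrite counitB_eval.
  by rewrite (linZ (F := fun b : B => (b • ψ)⟨d⟩)) //; lin.
rewrite (comulB_act hH act (β := fun z v => (ucoef z : k) *: v)); last by bil.
pose f r := \sw_(z, v <- uptm (h • imul ounit ψ)⟨act r d * 1⟩) ((ucoef z : k) *: v).
transitivity (\sw_(s1, s2 <- R) ((ε s1 : k) *: f s2)).
  apply: eq_sw => s1 s2; rewrite (sw_lin _ _ (F := fun u => _ *: u)); last by lin.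
  by apply: eq_sw => z v; rewrite (ucoef_act hD) scalerA.
rewrite (R_counitl hH); last by rewrite /f; lin.
by rewrite /f (act1E hA) mulr1 sw_lunit imap_act imul_ounitl.
Qed.

Lemma counitrB h : \sw_(h1, h2 <- ΔB h) ((εB h2 : k) *: h1) = h.
Proof.
apply: imod_faithful => φ c.
transitivity (\sw_(h1, h2 <- ΔB h) ((ucoef (h2 • ounit)⟨1⟩ : k) *: (h1 • φ)⟨c⟩)).
  rewrite (sw_lin _ _ (F := fun b : B => (b • φ)⟨c⟩)); last by lin.
  apply: eq_sw => h1 h2; rewrite counitB_eval.
  by rewrite (linZ (F := fun b : B => (b • φ)⟨c⟩)) //; lin.
rewrite (comulB_act hH act (β := fun v z => (ucoef z : k) *: v)); last by bil.
pose f s a := \sw_(v, z <- uptm (h • imul φ ounit)⟨a * c⟩) ((ucoef z : k) *: (s • v)).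
rewrite (R_act1 hH hA (f := f)); last by rewrite /f; bil.
rewrite /f mul1r; under eq_sw do rewrite modact1E.
by rewrite sw_runit imap_act imul_ounitr.
Qed.

Lemma counitB_Ml f g h : εB (f * g * h) = \sw_(g1, g2 <- ΔB g) (εB (f * g1) * εB (g2 * h)).
Proof.
have hl : lin (fun f : B => εB (f * g * h)) by lin.
have hr : lin (fun f : B => \sw_(g1, g2 <- ΔB g) (εB (f * g1) * εB (g2 * h) : k^o)) by lin.
move: f; apply: (bpure_ext hl hr) => {hl hr} a l p.
rewrite -mulrA counitB_eval_pure modactME.
pose G (z : one) : k^o := p 1 * (ε l * ucoef z).
have hG : lin G by rewrite /G; lin.
pose β (z w : one) := G ((ucoef z : k) *: w).
have hβ : bil β by rewrite /β; bil.
have hu : lin (fun z : one => ucoef z) by lin.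
transitivity (\sw_(g1, g2 <- ΔB g) β (g1 • ounit)⟨a⟩ (g2 • h • ounit)⟨1⟩); last first.
  apply: (@eq_sw _ _ _ k^o) => g1 g2.
  rewrite counitB_eval_pure counitB_eval modactME /β /G (linZ hu) /GRing.scale /= .
  by rewrite !mulrA.
rewrite (comulB_act hH act _ _ _ _ _ hβ).
rewrite (R_act1 hH hA (f := fun s b => \sw_(z, w <- uptm (g • imul ounit (h • ounit))⟨b * a⟩) β
  (s • z) w)); last by bil.
rewrite mul1r; under eq_sw do rewrite modact1E.
by rewrite -(sw_lin _ _ hG) sw_lunit imap_act imul_ounitl.
Qed.

Lemma counitB_Mr f g h : εB (f * g * h) = \sw_(g1, g2 <- ΔB g) (εB (f * g2) * εB (g1 * h)).
Proof.
have hl : lin (fun f : B => εB (f * g * h)) by lin.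
have hr : lin (fun f : B => \sw_(g1, g2 <- ΔB g) (εB (f * g2) * εB (g1 * h) : k^o)) by lin.
move: f; apply: (bpure_ext hl hr) => {hl hr} a l p.
rewrite -mulrA counitB_eval_pure modactME.
pose G (z : one) : k^o := p 1 * (ε l * ucoef z).
have hG : lin G by rewrite /G; lin.
pose β (z w : one) := G ((ucoef w : k) *: z).
have hβ : bil β by rewrite /β; bil.
have hu : lin (fun z : one => ucoef z) by lin.
transitivity (\sw_(g1, g2 <- ΔB g) β (g1 • h • ounit)⟨1⟩ (g2 • ounit)⟨a⟩); last first.
  apply: (@eq_sw _ _ _ k^o) => g1 g2.
  rewrite counitB_eval_pure counitB_eval modactME /β /G (linZ hu) /GRing.scale /=.
  by rewrite -!mulrA [ucoef _ * ucoef _]mulrC.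
rewrite (comulB_act hH act _ _ _ _ _ hβ).
pose f b := \sw_(z, w <- uptm (g • imul (h • ounit) ounit)⟨b * 1⟩) β z w.
transitivity (\sw_(s1, s2 <- R) ((ε s1 : k) *: f (act s2 a))); last first.
  apply: eq_sw => s1 s2; rewrite (sw_lin _ _ (F := fun u : k^o => (ε s1 : k) *: u)); last by lin.
  by apply: eq_sw => z w; rewrite (uobj_act hD) (linZ (hβ.1 w)).
rewrite (R_counitl hH (f := fun s => f (act s a))); last by rewrite /f; lin.
rewrite /f (act1E hA) mulr1 -(sw_lin _ _ hG) sw_runit imap_act imul_ounitr //.
Qed.

Lemma source_evalB a h f V (φ : F V) c :
  (source_counital (hopfB hx hα D R act) (pure a h f) • φ)⟨c⟩ =
  (f 1 * ε h : k) *: \sw_(s1, s2 <- R) (s1 • φ⟨act s2 a * c⟩).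
Proof.
rewrite source_counitalE (sw_lin _ _ (F := fun b : B => (b • φ)⟨c⟩)); last by lin.
transitivity (\sw_(e1, e2 <- ΔB 1) ((f 1 * ε h : k) *:
  ((ucoef (e2 • ounit)⟨a⟩ : k) *: (e1 • φ)⟨c⟩))).
  apply: eq_sw => e1 e2; rewrite (linZ (F := fun b : B => (b • φ)⟨c⟩)); last by lin.
  by rewrite /= counitB_eval_pure scalerA mulrA.
rewrite -(sw_lin _ _ (F := fun u => (f 1 * ε h : k) *: u)); last by lin.
congr (_ *: _).
rewrite (comulB_act hH act (β := fun v z => (ucoef z : k) *: v)); last by bil.
apply: eq_sw => s1 s2; rewrite modact1E.
transitivity (s1 • \sw_(u, v <- uptm (imul φ ounit)⟨act s2 a * c⟩) ((ucoef v : k) *: u)).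
  by rewrite sw_modact; apply: eq_sw => u v; rewrite modactZ.
by rewrite sw_runit -imapE imul_ounitr.
Qed.

(** The target counital map depends on b only through its action on the unit,
    and acts on A^* ≅ A as a left multiplication. *)
Lemma target_evalB b V (ψ : F V) d :
  (target_counital (hopfB hx hα D R act) b • ψ)⟨d⟩ =
  \sw_(x1, x2 <- x) ((ucoef (b • ounit)⟨x1 * d⟩ : k) *: ψ⟨x2⟩).
Proof.
rewrite target_counitalE (sw_lin _ _ (F := fun b : B => (b • ψ)⟨d⟩)); last by lin.
transitivity (\sw_(e1, e2 <- ΔB 1) ((ucoef (e1 • b • ounit)⟨1⟩ : k) *: (e2 • ψ)⟨d⟩)).
  apply: eq_sw => e1 e2; rewrite (linZ (F := fun b : B => (b • ψ)⟨d⟩)); last by lin.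
  by rewrite /= counitB_eval modactME.
rewrite (comulB_act hH act (β := fun z v => (ucoef z : k) *: v)); last by bil.
pose f r := \sw_(z, v <- uptm (1 • imul (b • ounit) ψ)⟨act r d * 1⟩) ((ucoef z : k) *: v).
transitivity (\sw_(s1, s2 <- R) ((ε s1 : k) *: f s2)).
  apply: eq_sw => s1 s2; rewrite (sw_lin _ _ (F := fun u => _ *: u)); last by lin.
  by apply: eq_sw => z v; rewrite (ucoef_act hD) scalerA.
rewrite (R_counitl hH); last by rewrite /f; lin.
by rewrite /f (act1E hA) mulr1 modact1E sw_lunit imul_lunit.
Qed.
End Counit.

(** * The antipode of B *)

Section HopfAntipode.
Variables (k : fieldType) (H : falgType k) (D : hopfData H).
Hypothesis hD : hopf_axioms D.
Local Notation Δ := (comul D).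
Local Notation ε := (counit D).
Local Notation S := (antipode D).
Local Notation hC := (hopf_coalg hD).

(** S(h1 g) h2 = S(h1 g1) h2 g2 S(g3), where the coproduct of h g1 is
    contracted by the antipode. *)
Lemma antipode_cancel g h : \sw_(h1, h2 <- Δ h) (S (h1 * g) * h2) = (ε h : k) *: S g.
Proof.
have hW := hopf_weak hD.
transitivity (\sw_(g1, g2 <- Δ g) \sw_(h1, h2 <- Δ h) \sw_(p, q <- Δ g1)
  (S (h1 * p) * (h2 * q) * S g2)).
  rewrite sw_exch; apply: eq_sw => h1 h2.
  rewrite (comulA3 hW g (f := fun a b c => S (h1 * a) * (h2 * b) * S c)); last by tril.
  rewrite -[in LHS](counitr hC g) (sw_lin _ _ (F := fun u => S (h1 * u) * h2)); last by lin.
  apply: eq_sw => g1 g2; rewrite (linZ (F := fun u => S (h1 * u) * h2)); last by lin.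
  transitivity (S (h1 * g1) * h2 * \sw_(p, q <- Δ g2) (p * S q)).
    by rewrite (hopf_antipoder hD) -scalerAr mulr1.
  rewrite (sw_lin _ _ (F := fun u => S (h1 * g1) * h2 * u)); last by lin.
  by apply: eq_sw => p q; rewrite !mulrA.
transitivity (\sw_(g1, g2 <- Δ g) ((ε h * ε g1 : k) *: S g2)).
  apply: eq_sw => g1 g2.
  transitivity ((\sw_(h1, h2 <- Δ (h * g1)) (S h1 * h2)) * S g2); last first.
    by rewrite (hopf_antipodel hD) (hopf_counitM hD) -scalerAl mul1r.
  rewrite (sw_lin _ _ (F := fun u => u * S g2)); last by lin.
  by rewrite (comulM2 hW h g1 (f := fun a b => S a * b * S g2)) //; bil.
rewrite -[g in RHS](counitl hC) (sw_lin _ _ (F := fun u => (ε h : k) *: S u)); last by lin.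
by apply: eq_sw => g1 g2; rewrite (linZ (F := fun u => S u)) ?scalerA //; lin.
Qed.

Variable R : tensor H H.
Hypothesis hH : qt_hopf D R.
(** By the first hexagon identity the sum is k1 S(k2) with k = R^1 h. *)
Lemma R_antipode_shift (Z : lmodType k) (G : H -> H -> Z) h : bil G ->
  \sw_(t1, t2 <- R) \sw_(s1, s2 <- R) \sw_(h1, h2 <- Δ h)
    G (t1 * h1 * S (s1 * h2)) (t2 * s2) = (ε h : k) *: G 1 1.
Proof.
move=> hG; have hW := hopf_weak hD.
rewrite -(hexl3 (qt_hopf_weak hH) (f := fun a b c => \sw_(h1, h2 <- Δ h) G (a * h1 * S (b * h2))
  c)); last by tril.
rewrite -(R_counitl hH (f := fun r => (ε h : k) *: G 1 r)); last by lin.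
apply: eq_sw => r1 r2.
rewrite -(comulM2 hW r1 h (f := fun a b => G (a * S b) r2)); last by bil.
rewrite -(sw_lin _ _ (F := fun u => G u r2)); last by lin.
rewrite (hopf_antipoder hD) (linZ (F := fun u => G u r2)); last by lin.
by rewrite (hopf_counitM hD) scalerA.
Qed.
End HopfAntipode.

Section Antipode.
Variables (k : fieldType) (H : falgType k) (D : hopfData H) (R : tensor H H).
Hypothesis hH : qt_hopf D R.
Variables (A : falgType k) (act : 'Hom(H, 'End(A))).
Hypothesis hA : module_algebra D act.
Variables (x : tensor A A) (α : 'Hom(A, k^o)).
Hypotheses (hx : symmetric_separability_idempotent x) (hα : sep_counit x α).
Implicit Types U V W : fdmod H.
Local Notation hR := (qt_hopf_weak hH).
Local Notation hW := (qtw_weak hR).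
Local Notation hD := (qth_hopf hH).
Local Notation B := (endoHopf H hx hα).
Local Notation pure := (bpure (H := H) hx hα).
Local Notation Δ := (comul D).
Local Notation ε := (counit D).
Local Notation S := (antipode D).
Local Notation ΔB := (comulB hx hα D R act).
Local Notation F := (imod hx hα).
Local Notation one := (uobj hW).
Local Notation ounit := (ounit hH hx hα).
Local Notation SB := (antipodeB hx hα D R act).

(** The summations are put in the order in which the antipode identities contract
    them. *)
Lemma sw_comulB_pure (Z : lmodType k) (G : B -> B -> Z) a h f : bil G ->
  \sw_(p, q <- ΔB (pure a h f)) G p q =
  \sw_(h1, h2 <- Δ h) \sw_(t1, t2 <- R) \sw_(y1, y2 <- x) \sw_(q1, q2 <- R)
  \sw_(f1, f2 <- dcomul f)
    G (pure (act q2 y1 * a) (t1 * h1 * q1) f2) (pure y2 h2 (dact act f1 t2)).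
Proof.
move=> hG; rewrite comulB_pure.
transitivity (\sw_(x1, x2 <- x) \sw_(h1, h2 <- Δ h) \sw_(f1, f2 <- dcomul f)
  \sw_(r1, r2 <- R) \sw_(s1, s2 <- R)
    G (pure (act r2 x1 * a) (s1 * h1 * r1) f2) (pure x2 h2 (dact act f1 s2))).
  by do 5!(rewrite sw_sw; apply: eq_sw => ? ?); rewrite sw_tens.
rewrite sw_exch; apply: eq_sw => h1 h2; rewrite sw_pull3.
apply: eq_sw => t1 t2; apply: eq_sw => y1 y2; by rewrite sw_exch.
Qed.

Lemma ucoef_pure_ounit a h f c : ucoef (pure a h f • ounit)⟨c⟩ = f c * (ε h * α a).
Proof.
have hu : lin (fun z : one => ucoef z) by lin.
rewrite ev_pure ounitE (linZ hu) (ucoef_act hD) (linZ hu) (ucoef_one hD).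
by rewrite /GRing.scale /= mulr1.
Qed.

Lemma antipodeB_eval a h f V (φ : F V) c :
  (SB (pure a h f) • φ)⟨c⟩ =
  \sw_(x1, x2 <- x) \sw_(s1, s2 <- R) \sw_(r1, r2 <- R)
    ((f (act s2 x1) * α (act r2 a * c) : k) *: (r1 * S (s1 * h)) • φ⟨x2⟩).
Proof.
rewrite antipodeB_pure.
have hl : lin (fun b : B => (b • φ)⟨c⟩) by lin.
rewrite (sw_lin _ _ hl); apply: eq_sw => x1 x2; rewrite sw_exch.
do 2!(rewrite (sw_lin _ _ hl); apply: eq_sw => ? ?).
by rewrite (linZ hl) ev_pure scalerA comp_lfunE linfun_lin //; lin.
Qed.

(** The two copies of R that meet x collapse to 1; what remains is contracted by
    the antipode of H. *)
Lemma antipodeBr b :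
  \sw_(p, q <- ΔB b) (p * SB q) = target_counital (hopfB hx hα D R act) b.
Proof.
have hl : lin (fun b => \sw_(p, q <- ΔB b) (p * SB q)) by lin.
have hr : lin (fun b => target_counital (hopfB hx hα D R act) b) by lin.
move: b; apply: (bpure_ext hl hr) => {hl hr} a h f; apply: imod_faithful => φ d.
rewrite [RHS](target_evalB hH hA) (sw_lin _ _ (F := fun b : B => (b • φ)⟨d⟩)); last by lin.
rewrite (sw_comulB_pure (G := fun p q => ((p * SB q) • φ)⟨d⟩)); last by bil.
transitivity (\sw_(h1, h2 <- Δ h) \sw_(t1, t2 <- R) \sw_(y1, y2 <- x) \sw_(q1, q2 <- R)
  \sw_(f1, f2 <- dcomul f) \sw_(x1, x2 <- x) \sw_(s1, s2 <- R) \sw_(r1, r2 <- R)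
  (((f1 (act t2 (act s2 x1)) * f2 d) * α (act r2 y2 * act q2 y1 * a) : k) *:
    (t1 * h1 * (q1 * r1) * S (s1 * h2)) • φ⟨x2⟩)).
  apply: eq_sw => h1 h2; apply: eq_sw => t1 t2; apply: eq_sw => y1 y2.
  apply: eq_sw => q1 q2; apply: eq_sw => f1 f2.
  rewrite modactME ev_pure antipodeB_eval.
  do 3!(rewrite sw_scale_act; apply: eq_sw => ? ?).
  rewrite modactZ scalerA comp_lfunE -modactME !mulrA.
  by congr (_ *: _); rewrite -!mulrA mulrCA.
rewrite sw_pull5; apply: eq_sw => x1 x2; rewrite sw_pull5.
transitivity (\sw_(s1, s2 <- R) \sw_(h1, h2 <- Δ h) \sw_(t1, t2 <- R)
  ((f (act t2 (act s2 x1) * d) * α a : k) *: (t1 * h1 * S (s1 * h2)) • φ⟨x2⟩)).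
  apply: eq_sw => s1 s2; apply: eq_sw => h1 h2; apply: eq_sw => t1 t2.
  (* [E] is the dependence on the two factors which collapse against x. *)
  pose E (z : H) (b : A) : regmod H :=
    (f (act t2 (act s2 x1) * d) * α (b * a) : k) *: (t1 * h1 * z * S (s1 * h2)) • φ⟨x2⟩.
  have hE : bil E by rewrite /E; bil.
  transitivity (E 1 1); last by rewrite /E mulr1 mul1r.
  rewrite -(R_sep_collapse hH hA hx hE).
  apply: eq_sw => y1 y2; apply: eq_sw => q1 q2; rewrite sw_exch; apply: eq_sw => r1 r2.
  by rewrite sw_scalel dcomulP.
rewrite sw_pull2.
pose G (z w : H) : regmod H := (f (act w x1 * d) * α a : k) *: z • φ⟨x2⟩.
have hG : bil G by rewrite /G; bil.
transitivity (\sw_(t1, t2 <- R) \sw_(s1, s2 <- R) \sw_(h1, h2 <- Δ h)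
    G (t1 * h1 * S (s1 * h2)) (t2 * s2)).
  by do 3![apply: eq_sw => ? ?]; rewrite /G (actME hA).
rewrite (R_antipode_shift hD hH) // /G modact1E (act1E hA) ucoef_pure_ounit scalerA.
by congr (_ *: _); rewrite mulrCA.
Qed.

(** One copy of x collapses, the antipode of H cancels h, and the last two copies
    of R cancel each other as (S ⊗ 1) R is inverse to R. *)
Lemma antipodeBl b :
  \sw_(p, q <- ΔB b) (SB p * q) = source_counital (hopfB hx hα D R act) b.
Proof.
have hl : lin (fun b => \sw_(p, q <- ΔB b) (SB p * q)) by lin.
have hr : lin (fun b => source_counital (hopfB hx hα D R act) b) by lin.
move: b; apply: (bpure_ext hl hr) => {hl hr} a h f; apply: imod_faithful => φ c.
rewrite [RHS](source_evalB hH hA) (sw_lin _ _ (F := fun b : B => (b • φ)⟨c⟩)); last by lin.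
rewrite (sw_comulB_pure (G := fun p q => ((SB p * q) • φ)⟨c⟩)); last by bil.
transitivity (\sw_(h1, h2 <- Δ h) \sw_(t1, t2 <- R) \sw_(y1, y2 <- x) \sw_(q1, q2 <- R)
  \sw_(f1, f2 <- dcomul f) \sw_(x1, x2 <- x) \sw_(s1, s2 <- R) \sw_(r1, r2 <- R)
  (((f1 (act t2 x2) * f2 (act s2 x1)) * α (act r2 (act q2 y1 * a) * c) : k) *:
    (r1 * S (s1 * t1 * (h1 * q1)) * h2) • φ⟨y2⟩)).
  apply: eq_sw => h1 h2; apply: eq_sw => t1 t2; apply: eq_sw => y1 y2.
  apply: eq_sw => q1 q2; apply: eq_sw => f1 f2.
  rewrite modactME antipodeB_eval.
  do 3![apply: eq_sw => ? ?].
  rewrite ev_pure modactZ scalerA comp_lfunE -modactME !mulrA.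
  by congr (_ *: _); rewrite mulrC !mulrA.
transitivity (\sw_(h1, h2 <- Δ h) \sw_(y1, y2 <- x) \sw_(q1, q2 <- R) \sw_(r1, r2 <- R)
  ((f 1 * α (act r2 (act q2 y1 * a) * c) : k) *: (r1 * (S (h1 * q1) * h2)) • φ⟨y2⟩)).
  apply: eq_sw => h1 h2; rewrite sw_exch; apply: eq_sw => y1 y2.
  rewrite sw_exch; apply: eq_sw => q1 q2; rewrite sw_pull4; apply: eq_sw => r1 r2.
  rewrite sw_pull2.
  pose E (z : H) (b : A) : regmod H :=
    (f b * α (act r2 (act q2 y1 * a) * c) : k) *: (r1 * S (z * (h1 * q1)) * h2) • φ⟨y2⟩.
  have hE : bil E by rewrite /E; bil.
  transitivity (E 1 1); last by rewrite /E mul1r mulrA.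
  rewrite -(R_sep_collapse hH hA hx hE).
  apply: eq_sw => x1 x2; rewrite sw_pull2; apply: eq_sw => s1 s2; apply: eq_sw => t1 t2.
  by rewrite sw_scalel dcomulP.
rewrite -sw_pull3.
transitivity (\sw_(y1, y2 <- x) \sw_(q1, q2 <- R) \sw_(r1, r2 <- R)
  ((f 1 * ε h * α (act r2 (act q2 y1 * a) * c) : k) *: (r1 * S q1) • φ⟨y2⟩)).
  apply: eq_sw => y1 y2; apply: eq_sw => q1 q2; apply: eq_sw => r1 r2.
  pose G u := (f 1 * α (act r2 (act q2 y1 * a) * c) : k) *: (r1 * u) • φ⟨y2⟩.
  have hG : lin G by rewrite /G; lin.
  transitivity (G (\sw_(h1, h2 <- Δ h) (S (h1 * q1) * h2))); first by rewrite (sw_lin _ _ hG).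
  by rewrite (antipode_cancel hD) (linZ hG) /G scalerA mulrCA mulrA.
rewrite [RHS](sw_lin _ _ (F := fun u => (f 1 * ε h : k) *: u)); last by lin.
transitivity (\sw_(y1, y2 <- x) \sw_(r1, r2 <- R)
  ((f 1 * ε h * α (y1 * (act r2 a * c)) : k) *: r1 • φ⟨y2⟩)); last first.
  rewrite sw_exch; apply: eq_sw => r1 r2.
  rewrite -(sep_expand2 hx hα (f := fun u => r1 • φ⟨u⟩) (act r2 a * c)); last by lin.
  rewrite (sw_lin _ _ (F := fun u => _ *: u)); last by lin.
  by apply: eq_sw => y1 y2; rewrite scalerA.
apply: eq_sw => y1 y2.
pose E r1 (b : A) z w := (f 1 * ε h * α (act w y1 * b * c) : k) *: (r1 * z) • φ⟨y2⟩.
transitivity (\sw_(r1, r2 <- R) E r1 (act r2 a) 1 1); last first.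
  by apply: eq_sw => r1 r2; rewrite /E mulr1 (act1E hA) mulrA.
transitivity (\sw_(r1, r2 <- R) \sw_(s1, s2 <- R) \sw_(q1, q2 <- R) E r1 (act r2 a) (s1 * S q1)
  (s2 * q2)).
  rewrite [RHS]sw_pull2; apply: eq_sw => q1 q2.
  pose f' (z : H) b := (f 1 * ε h * α (b * c) : k) *: (z * S q1) • φ⟨y2⟩.
  rewrite (R_actM hH hA (f := f')); last by rewrite /f'; bil.
  by do 2![apply: eq_sw => ? ?]; rewrite /f' /E (actME hA) !mulrA.
apply: eq_sw => r1 r2; rewrite (R_antipode hH (f := E r1 (act r2 a))) //.
by rewrite /E; bil.
Qed.

(** By [antipodeBr] the sum is that of S_B(b1) ε_t(b2), and the counital map acts by
    a left multiplication on A, in which the remaining copies of x collapse. *)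
Lemma antipodeB_S b :
  \sw_(h1, h2 <- ΔB b) \sw_(h21, h22 <- ΔB h2) (SB h1 * h21 * SB h22) = SB b.
Proof.
transitivity (\sw_(p, q <- ΔB b) (SB p * target_counital (hopfB hx hα D R act) q)).
  apply: eq_sw => p q; rewrite -antipodeBr (sw_lin _ _ (F := fun u => SB p * u)); last by lin.
  by apply: eq_sw => ? ?; rewrite mulrA.
have hl : lin (fun b => \sw_(p, q <- ΔB b) (SB p * target_counital (hopfB hx hα D R act) q)) by lin.
have hr : lin (fun b => SB b) by lin.
move: b; apply: (bpure_ext hl hr) => {hl hr} a h f; apply: imod_faithful => φ c.
rewrite antipodeB_eval (sw_lin _ _ (F := fun b : B => (b • φ)⟨c⟩)); last by lin.
rewrite (sw_comulB_pure (G := fun p q => ((SB p * target_counital (hopfB hx hα D R act) q) •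
  φ)⟨c⟩)); last by bil.
have hu : lin (fun z : one => ucoef z) by lin.
transitivity (\sw_(h1, h2 <- Δ h) \sw_(t1, t2 <- R) \sw_(y1, y2 <- x) \sw_(q1, q2 <- R)
  \sw_(f1, f2 <- dcomul f) \sw_(x1, x2 <- x) \sw_(s1, s2 <- R) \sw_(r1, r2 <- R) \sw_(z1, z2 <- x)
  ((α y2 : k) *: ((ε h2 : k) *: (((f1 (act t2 (z1 * x2)) * f2 (act s2 x1)) * α
    (act r2 (act q2 y1 * a) * c) : k) *:
    (r1 * S (s1 * t1 * (h1 * q1))) • φ⟨z2⟩)))).
  apply: eq_sw => h1 h2; apply: eq_sw => t1 t2; apply: eq_sw => y1 y2.
  apply: eq_sw => q1 q2; apply: eq_sw => f1 f2.
  rewrite modactME antipodeB_eval.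
  apply: eq_sw => x1 x2; apply: eq_sw => s1 s2; apply: eq_sw => r1 r2.
  rewrite (target_evalB hH hA) sw_scale_act; apply: eq_sw => z1 z2.
  rewrite ucoef_pure_ounit modactZ !scalerA comp_lfunE.
  have mulAC (u v w y z : k) : u * v * (w * (y * z)) = z * y * (w * u * v).
    by rewrite [LHS](AC (2*(1*2)) ((5*4)*((3*1)*2))).
  by congr (_ *: _); [exact: mulAC | rewrite !mulrA].
transitivity (\sw_(h1, h2 <- Δ h) ((ε h2 : k) *: \sw_(t1, t2 <- R) \sw_(z1, z2 <- x)
  \sw_(f1, f2 <- dcomul f) \sw_(x1, x2 <- x) \sw_(s1, s2 <- R) \sw_(r1, r2 <- R)
  (((f1 (act t2 (z1 * x2)) * f2 (act s2 x1)) * α (act r2 a * c) : k) *: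
    (r1 * S (s1 * t1 * h1)) • φ⟨z2⟩))).
  apply: eq_sw => h1 h2.
  rewrite [RHS](sw_lin _ _ (F := fun u => (ε h2 : k) *: u)); last by lin.
  apply: eq_sw => t1 t2.
  rewrite [RHS](sw_lin _ _ (F := fun u => (ε h2 : k) *: u)); last by lin.
  under eq_sw => y1 y2 do rewrite sw_pull5.
  rewrite sw_exch; apply: eq_sw => z1 z2.
  (* [K] is the dependence on q and y: α contracts y to 1, on which q acts by ε. *)
  pose K (v : H) (b : A) := (ε h2 : k) *: \sw_(f1, f2 <- dcomul f) \sw_(x1, x2 <- x)
    \sw_(s1, s2 <- R) \sw_(r1, r2 <- R)
    (((f1 (act t2 (z1 * x2)) * f2 (act s2 x1)) * α (act r2 (b * a) * c) : k) *:
    (r1 * S (s1 * t1 * (h1 * v))) • φ⟨z2⟩).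
  have hK : bil K by rewrite /K; bil.
  transitivity (K 1 1); last by rewrite /K mulr1 mul1r.
  transitivity (\sw_(y1, y2 <- x) \sw_(q1, q2 <- R) ((α y2 : k) *: K q1 (act q2 y1))).
    apply: eq_sw => y1 y2; apply: eq_sw => q1 q2; rewrite /K.
    rewrite scalerA; do 4!(rewrite [RHS](sw_lin _ _ (F := fun u => (α y2 * ε h2 : k) *: u));
      [apply: eq_sw => ? ? | by lin]).
    by rewrite scalerA.
  rewrite sw_exch -(R_act1 hH hA hK); apply: eq_sw => q1 q2.
  transitivity (\sw_(y1, y2 <- x) ((α (1 * y2) : k) *: K q1 (act q2 y1))).
    by apply: eq_sw => y1 y2; rewrite mul1r.
  have hl : lin (fun u => K q1 (act q2 u)) by apply: (lin_comp (hK.2 q1)); exact: lin_lf.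
  exact: (sep_expand hx hα 1 hl).
rewrite (sw_counitr hH (f := fun h1 => \sw_(t1, t2 <- R) \sw_(z1, z2 <- x)
  \sw_(f1, f2 <- dcomul f) \sw_(x1, x2 <- x) \sw_(s1, s2 <- R) \sw_(r1, r2 <- R)
  (((f1 (act t2 (z1 * x2)) * f2 (act s2 x1)) * α (act r2 a * c) : k) *:
    (r1 * S (s1 * t1 * h1)) • φ⟨z2⟩))); last by lin.
rewrite sw_exch; apply: eq_sw => z1 z2.
rewrite sw_pull4 [RHS]sw_exch; apply: eq_sw => r1 r2.
pose E (v : H) (b : A) := (f b * α (act r2 a * c) : k) *: (r1 * S (v * h)) • φ⟨z2⟩.
have hE : bil E by rewrite /E; bil.
transitivity (\sw_(x1, x2 <- x) \sw_(s1, s2 <- R) \sw_(t1, t2 <- R)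
   E (s1 * t1) (act t2 (z1 * x2) * act s2 x1)).
  rewrite sw_pull2; apply: eq_sw => x1 x2; rewrite sw_pull2; apply: eq_sw => s1 s2.
  by apply: eq_sw => t1 t2; rewrite sw_scalel dcomulP.
transitivity (\sw_(x1, x2 <- x) \sw_(s1, s2 <- R) E s1 (act s2 (z1 * (x2 * x1)))).
  by apply: eq_sw => x1 x2; rewrite -(R_actM hH hA _ _ hE) mulrA.
rewrite sw_exch; apply: eq_sw => s1 s2.
have hl : lin (fun u => E s1 (act s2 (z1 * u))) by apply: (lin_comp (hE.2 s1)); lin.
by rewrite (sep_mul2 hx hl) mulr1.
Qed.

Lemma hopfB_weak : weak_hopf_axioms (hopfB hx hα D R act).
Proof.
split.
- split; [exact: (comulB_coassoc hH hA) | exact: (counitlB hH hA) | exact: (counitrB hH hA)].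
- exact: (comulB_mul hH hA).
- exact: (counitB_Ml hH hA).
- exact: (counitB_Mr hH hA).
- exact: (comulB_1l hH hA).
- exact: (comulB_1r hH hA).
- exact: antipodeBl.
- exact: antipodeBr.
- exact: antipodeB_S.
Qed.
End Antipode.

(** * The R-matrix of B *)

Section YangBaxter.
Variables (k : fieldType) (H : falgType k) (D : hopfData H) (R : tensor H H).
Hypothesis hH : qt_hopf D R.
Variables (Z : lmodType k) (f : H -> H -> H -> Z).
Hypothesis hf : tril f.
Local Notation Δ := (comul D).
Local Notation hR := (qt_hopf_weak hH).

(** R_12 R_13 R_23 = R_23 R_13 R_12: R intertwines Δ with its opposite, which
    exchanges the two factors of (Δ ⊗ 1) R = R_13 R_23. *)
Lemma yang_baxter :
  \sw_(r1, r2 <- R) \sw_(s1, s2 <- R) \sw_(t1, t2 <- R) f (r1 * s1) (r2 * t1) (s2 * t2) =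
  \sw_(r1, r2 <- R) \sw_(s1, s2 <- R) \sw_(t1, t2 <- R) f (s1 * r1) (t1 * r2) (t2 * s2).
Proof.
transitivity (\sw_(s1, s2 <- R) \sw_(a, b <- Δ s1) \sw_(r1, r2 <- R) f (b * r1) (a * r2) s2).
  transitivity (\sw_(s1, s2 <- R) \sw_(a, b <- Δ s1) \sw_(r1, r2 <- R) f (r1 * a) (r2 * b) s2).
    rewrite (hexl3 hR (f := fun a b c => \sw_(r1, r2 <- R) f (r1 * a) (r2 * b) c)); last by tril.
    by rewrite [RHS]sw_pull2.
  apply: eq_sw => s1 s2; rewrite sw_exch.
  by rewrite (R_comul hH (f := fun a b => f a b s2)) //; bil.
rewrite (hexl3 hR (f := fun a b c => \sw_(r1, r2 <- R) f (b * r1) (a * r2) c)); last by tril.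
rewrite sw_pull2; apply: eq_sw => r1 r2; rewrite sw_exch.
by apply: eq_sw => s1 s2; apply: eq_sw => t1 t2.
Qed.

(** R_32 R_12 R_13 = R_13 R_12 R_32, in the same way from (1 ⊗ Δ) R. *)
Lemma yang_baxter32 :
  \sw_(r1, r2 <- R) \sw_(s1, s2 <- R) \sw_(t1, t2 <- R) f (r1 * s1) (t2 * r2) (t1 * s2) =
  \sw_(r1, r2 <- R) \sw_(s1, s2 <- R) \sw_(t1, t2 <- R) f (s1 * r1) (r2 * t2) (s2 * t1).
Proof.
transitivity (\sw_(r1, r2 <- R) \sw_(a, b <- Δ r2) \sw_(t1, t2 <- R) f r1 (a * t2) (b * t1)).
  transitivity (\sw_(r1, r2 <- R) \sw_(a, b <- Δ r2) \sw_(t1, t2 <- R) f r1 (t2 * b) (t1 * a)).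
    by rewrite (hexr3 hR (f := fun r a b => \sw_(t1, t2 <- R) f r (t2 * b) (t1 * a))) //; tril.
  apply: eq_sw => r1 r2; rewrite sw_exch.
  by rewrite (R_comul hH (f := fun a b => f r1 b a)) //; bil.
rewrite (hexr3 hR (f := fun r a b => \sw_(t1, t2 <- R) f r (a * t2) (b * t1))); last by tril.
by rewrite sw_exch.
Qed.
End YangBaxter.

Section RMatrix.
Variables (k : fieldType) (H : falgType k) (D : hopfData H) (R : tensor H H).
Hypothesis hH : qt_hopf D R.
Variables (A : falgType k) (act : 'Hom(H, 'End(A))).
Hypothesis hA : module_algebra D act.
Variables (x : tensor A A) (α : 'Hom(A, k^o)).
Hypotheses (hx : symmetric_separability_idempotent x) (hα : sep_counit x α).
Implicit Types U V W : fdmod H.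
Local Notation hR := (qt_hopf_weak hH).
Local Notation hW := (qtw_weak hR).
Local Notation hD := (qth_hopf hH).
Local Notation B := (endoHopf H hx hα).
Local Notation pure := (bpure (H := H) hx hα).
Local Notation ΔB := (comulB hx hα D R act).
Local Notation "u ⊠ v" := (ptm hW u v) (at level 40, left associativity).
Local Notation F := (imod hx hα).
Local Notation imul := (imul hH act).
Local Notation imap := (imap hx hα).
Local Notation RBm := (RB hx hα R act).
Local Notation ψR := (rbraid hW hR).

(** R_B takes the product, applies the braiding of U and V, and splits again with
    the legs in the opposite order. *)
Lemma RB_act U V (Z : lmodType k) (β : U -> V -> Z) (φ : F U) (ψ : F V) c d :
  bil β ->
  \sw_(p, q <- RBm) β (p • φ)⟨c⟩ (q • ψ)⟨d⟩ =
  \sw_(r1, r2 <- R) \sw_(s1, s2 <- R) \sw_(u, v <- uptm (imul φ ψ)⟨act r2 c * d⟩)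
    β (s1 • u) ((r1 * s2) • v).
Proof.
move=> hβ.
transitivity (\sw_(x1, x2 <- x) \sw_(y1, y2 <- x) \sw_(α1, α2 <- dcomul α)
  \sw_(r1, r2 <- R) \sw_(s1, s2 <- R) \sw_(t1, t2 <- R)
  ((α1 (act r2 c) * α2 (d * x2) : k) *:
    β (s1 • t1 • φ⟨act t2 y1 * x1⟩) ((r1 * s2) • ψ⟨y2⟩))).
  rewrite /RB; do 6!(rewrite sw_sw; apply: eq_sw => ? ?).
  rewrite sw_tens; last by bil.
  rewrite !ev_pure comp_lfunE linfun_lin; last by lin.
  by rewrite (linearZ_bil _ _ _ _ hβ) mulrC modactME.
rewrite sw_pull3 ; apply: eq_sw => r1 r2.
rewrite sw_pull3 ; apply: eq_sw => s1 s2.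
rewrite (sw_imul hH act (β := fun u v => β (s1 • u) ((r1 * s2) • v))); last by bil.
rewrite sw_exch; apply: eq_sw => y1 y2; rewrite sw_pull2; apply: eq_sw => t1 t2.
rewrite -(sep_expand hx hα (f := fun u => β (s1 • t1 • φ⟨act t2 y1 * u⟩) _) (act r2 c * d));
  last by lin.
apply: eq_sw => x1 x2; rewrite -mulrA -(dcomulP α).
by rewrite (sw_lin _ _ (F := fun u : k^o => (u : k) *: β _ _)) //; lin.
Qed.

Lemma sw_braid U V (m : tobj hW U V) :
  vsval (ψR U V) m = \sw_(s1, s2 <- R) \sw_(u, v <- uptm m) ((s2 • v) ⊠ (s1 • u)).
Proof.
move: m; apply: ptm_ext => [||u v]; try by lin.
rewrite rbraid_pt; apply: eq_sw => s1 s2.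
by rewrite (sw_ptm hD hW (f := fun u v => (s2 • v) ⊠ (s1 • u))) //; bil.
Qed.
Lemma sw_uptm_braid U V (Z : lmodType k) (β : V -> U -> Z) (m : tobj hW U V) : bil β ->
  \sw_(v, u <- uptm (vsval (ψR U V) m)) β v u =
  \sw_(s1, s2 <- R) \sw_(u, v <- uptm m) β (s2 • v) (s1 • u).
Proof.
move=> hβ; move: m; apply: ptm_ext => [||u v]; try by lin.
rewrite rbraid_pt (sw_lin _ _ (F := fun m => \sw_(v, u <- uptm m) β v u)); last by lin.
apply: eq_sw => s1 s2; rewrite (sw_ptm hD) //.
by rewrite (sw_ptm hD hW (f := fun u v => β (s2 • v) (s1 • u))) //; bil.
Qed.

(** As the section after the braiding cancels against the product, R_B followed by
    the opposite product is F applied to the braiding. *)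
Lemma imul_RB U V (φ : F U) (ψ : F V) :
  \sw_(p, q <- RBm) imul (q • ψ) (p • φ) = vsval (imap (ψR U V)) (imul φ ψ).
Proof.
apply: ev_ext => z; rewrite imapE sw_braid (sw_lin _ _ (F := fun Φ => Φ⟨z⟩)); last by lin.
transitivity (\sw_(x1, x2 <- x) \sw_(r1, r2 <- R) \sw_(p, q <- RBm)
    ((r1 • (q • ψ)⟨act r2 x1 * z⟩) ⊠ (p • φ)⟨x2⟩)).
  by rewrite [RHS]sw_pull2; apply: eq_sw => p q; rewrite imulE.
pose g h a := \sw_(s1, s2 <- R) \sw_(u, v <- uptm (imul φ ψ)⟨a * z⟩) (((h * s2) • v) ⊠ (s1 • u)).
have hg : bil g by rewrite /g; bil.
transitivity (g 1 1); last by rewrite /g mul1r; do 2!apply: eq_sw => ? ?; rewrite mul1r.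
rewrite -(R_sep_collapse hH hA hx hg).
apply: eq_sw => x1 x2; apply: eq_sw => r1 r2.
rewrite (RB_act (β := fun u v => (r1 • v) ⊠ u)); last by bil.
apply: eq_sw => q1 q2; apply: eq_sw => s1 s2; rewrite mulrA.
by apply: eq_sw => u v; rewrite -!modactME mulrA.
Qed.

Lemma RB_comul_act U V (Z : lmodType k) (β : U -> V -> Z) (φ : F U) (ψ : F V) b c d :
  bil β ->
  \sw_(p, q <- tmul RBm (ΔB b)) β (p • φ)⟨c⟩ (q • ψ)⟨d⟩ =
  \sw_(r1, r2 <- R) \sw_(s1, s2 <- R) \sw_(u, v <- uptm (b • imul φ ψ)⟨act r2 c * d⟩)
    β (s1 • u) ((r1 * s2) • v).
Proof.
move=> hβ; rewrite sw_tmul; last by bil.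
rewrite sw_exch -(imul_comul hH hA).
transitivity (\sw_(p, q <- ΔB b) \sw_(r1, r2 <- R) \sw_(s1, s2 <- R)
  \sw_(u, v <- uptm (imul (p • φ) (q • ψ))⟨act r2 c * d⟩) β (s1 • u) ((r1 * s2) • v)).
  apply: eq_sw => p q; rewrite -RB_act //.
  by apply: eq_sw => p' q'; rewrite !modactME.
rewrite sw_exch; apply: eq_sw => r1 r2; rewrite sw_exch; apply: eq_sw => s1 s2.
rewrite (sw_lin _ _ (F := fun Φ => \sw_(u, v <- uptm Φ⟨act r2 c * d⟩) β (s1 • u) ((r1 * s2) • v)))
  //.
by lin.
Qed.

Lemma comul_RB_act U V (Z : lmodType k) (β : U -> V -> Z) (φ : F U) (ψ : F V) b c d :
  bil β ->
  \sw_(p, q <- tmul (flip (ΔB b)) RBm) β (p • φ)⟨c⟩ (q • ψ)⟨d⟩ =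
  \sw_(r1, r2 <- R) \sw_(s1, s2 <- R) \sw_(u, v <- uptm (b • imul φ ψ)⟨act r2 c * d⟩)
    β (s1 • u) ((r1 * s2) • v).
Proof.
move=> hβ; rewrite sw_tmul; last by bil.
rewrite sw_flip; last by bil.
rewrite sw_exch.
transitivity (\sw_(p, q <- RBm) \sw_(t1, t2 <- R)
  \sw_(v, u <- uptm (b • imul (q • ψ) (p • φ))⟨act t2 c * d⟩) β u (t1 • v)).
  apply: eq_sw => p q.
  rewrite -(comulB_act hH act (β := fun v u => β u v)); last by bil.
  by apply: eq_sw => p' q'; rewrite !modactME.
rewrite sw_exch; apply: eq_sw => t1 t2.
rewrite -(sw_lin _ _ (F := fun Φ => \sw_(v, u <- uptm (b • Φ)⟨act t2 c * d⟩) β u (t1 • v)));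
  last by lin.
rewrite imul_RB -imap_act sw_uptm_braid; last by bil.
by apply: eq_sw => s1 s2; apply: eq_sw => u v; rewrite modactME.
Qed.

Lemma RB_comul b : tmul RBm (ΔB b) = tmul (flip (ΔB b)) RBm.
Proof.
have hβ : bil (fun u v : regmod H => u ⊗ v) by bil.
apply: tensB_ext => φ ψ c d.
by rewrite (RB_comul_act _ _ _ _ _ hβ) (comul_RB_act _ _ _ _ _ hβ).
Qed.
Lemma RB_1 : tmul RBm (ΔB 1) = RBm.
Proof.
have hβ : bil (fun u v : regmod H => u ⊗ v) by bil.
apply: tensB_ext => φ ψ c d.
by rewrite (RB_comul_act _ _ _ _ _ hβ) (RB_act _ _ _ _ hβ) modact1E.
Qed.
Lemma RB_corner : tmul (tmul (flip (ΔB 1)) RBm) (ΔB 1) = RBm.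
Proof. by rewrite -tmulA RB_1 -RB_comul RB_1. Qed.

Section QuasiInverse.
Variable Q : tensor H H.
Hypotheses (RQ : tmul R Q = 1 ⊗ 1) (QR : tmul Q R = 1 ⊗ 1).

(** The quasi-inverse of R_B: the opposite product, then the inverse braiding given
    by Q, then the section. *)
Definition QB : tensor B B :=
  \sw_(x1, x2 <- x) \sw_(y1, y2 <- x) \sw_(r1, r2 <- R) \sw_(s1, s2 <- R) \sw_(q1, q2 <- Q)
  \sw_(g1, g2 <- dcomul (lharp α (x2 * act r2 y1)))
    (pure y2 (s1 * q1) g2 ⊗ pure x1 (q2 * r1) (dact act g1 s2)).

Lemma QB_act U V (Z : lmodType k) (β : U -> V -> Z) (φ : F U) (ψ : F V) c d :
  bil β ->
  \sw_(p, q <- QB) β (p • φ)⟨c⟩ (q • ψ)⟨d⟩ =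
  \sw_(s1, s2 <- R) \sw_(v, u <- uptm (imul ψ φ)⟨act s2 d * c⟩)
    \sw_(q1, q2 <- Q) β ((s1 * q1) • u) (q2 • v).
Proof.
move=> hβ.
transitivity (\sw_(x1, x2 <- x) \sw_(y1, y2 <- x) \sw_(r1, r2 <- R) \sw_(s1, s2 <- R)
  \sw_(q1, q2 <- Q)
  ((α (x2 * (act r2 y1 * (act s2 d * c))) : k) *:
    β ((s1 * q1) • φ⟨y2⟩) ((q2 * r1) • ψ⟨x1⟩))).
  rewrite /QB; rewrite sw_sw; apply: eq_sw => x1 x2; rewrite sw_sw; apply: eq_sw => y1 y2.
  rewrite sw_sw; apply: eq_sw => r1 r2; rewrite sw_sw; apply: eq_sw => s1 s2.
  rewrite sw_sw; apply: eq_sw => q1 q2; rewrite sw_sw.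
  transitivity (\sw_(g1, g2 <- dcomul (lharp α (x2 * act r2 y1)))
    (((g1 (act s2 d) * g2 c) * 1 : k) *: β ((s1 * q1) • φ⟨y2⟩) ((q2 * r1) • ψ⟨x1⟩))).
    apply: eq_sw => g1 g2; rewrite sw_tens; last by bil.
    by rewrite !ev_pure comp_lfunE (linearZ_bil _ _ _ _ hβ) mulr1.
  by rewrite sw_scalel dcomulP mulr1 linfun_lin ?mulrA //; lin.
rewrite sw_pull3; apply: eq_sw => s1 s2.
rewrite (sw_imul hH act (β := fun v u => \sw_(q1, q2 <- Q) β ((s1 * q1) • u) (q2 • v)));
  last by bil.
rewrite sw_exch; apply: eq_sw => y1 y2; rewrite sw_exch; apply: eq_sw => r1 r2.
rewrite sw_exch; apply: eq_sw => q1 q2.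
rewrite -modactME -(sep_expandl hx hα (f := fun u => β ((s1 * q1) • φ⟨y2⟩) ((q2 * r1) • ψ⟨u⟩))) //.
by lin.
Qed.

Lemma imul_QB U V (Z : lmodType k) (β : U -> V -> Z) (φ : F U) (ψ : F V) z : bil β ->
  \sw_(u, v <- uptm (\sw_(p, q <- QB) imul (p • φ) (q • ψ))⟨z⟩) β u v =
  \sw_(v, u <- uptm (imul ψ φ)⟨z⟩) \sw_(q1, q2 <- Q) β (q1 • u) (q2 • v).
Proof.
move=> hβ; rewrite (sw_lin _ _ (F := fun Φ => \sw_(u, v <- uptm Φ⟨z⟩) β u v)); last by lin.
transitivity (\sw_(x1, x2 <- x) \sw_(r1, r2 <- R) \sw_(p, q <- QB)
    β (r1 • (p • φ)⟨act r2 x1 * z⟩) (q • ψ)⟨x2⟩).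
  by rewrite [RHS]sw_pull2; apply: eq_sw => p q; rewrite (sw_imul hH act _ _ _ hβ).
pose g h a := \sw_(v, u <- uptm (imul ψ φ)⟨a * z⟩) \sw_(q1, q2 <- Q) β ((h * q1) • u) (q2 • v).
have hg : bil g by rewrite /g; bil.
transitivity (g 1 1); last by rewrite /g mul1r; do 2!apply: eq_sw => ? ?; rewrite mul1r.
rewrite -(R_sep_collapse hH hA hx hg).
apply: eq_sw => x1 x2; apply: eq_sw => r1 r2.
rewrite (QB_act (β := fun u v => β (r1 • u) v)); last by bil.
apply: eq_sw => s1 s2; rewrite mulrA /g.
by do 2!apply: eq_sw => ? ?; rewrite -!modactME !mulrA.
Qed.

Lemma sw_RQ (Z : lmodType k) (f : H -> H -> Z) : bil f ->
  \sw_(r1, r2 <- R) \sw_(q1, q2 <- Q) f (r1 * q1) (r2 * q2) = f 1 1.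
Proof. by move=> hf; rewrite -sw_tmul // RQ sw_tens. Qed.
Lemma sw_QR (Z : lmodType k) (f : H -> H -> Z) : bil f ->
  \sw_(q1, q2 <- Q) \sw_(r1, r2 <- R) f (q1 * r1) (q2 * r2) = f 1 1.
Proof. by move=> hf; rewrite -sw_tmul // QR sw_tens. Qed.

Lemma QB_RB : tmul QB RBm = ΔB 1.
Proof.
have hβ : bil (fun u v : regmod H => u ⊗ v) by bil.
apply: tensB_ext => φ ψ c d; rewrite (comulB_act hH act _ _ _ _ _ hβ) sw_tmul; last by bil.
rewrite modact1E sw_exch.
transitivity (\sw_(p, q <- RBm) \sw_(s1, s2 <- R)
   \sw_(v, u <- uptm (imul (q • ψ) (p • φ))⟨act s2 d * c⟩)
    \sw_(q1, q2 <- Q) (((s1 * q1) • u) ⊗ (q2 • v))).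
  apply: eq_sw => p q; rewrite -(QB_act _ _ _ _ hβ).
  by apply: eq_sw => p' q'; rewrite !modactME.
rewrite sw_exch; apply: eq_sw => s1 s2.
rewrite -(sw_lin _ _ (F := fun Φ => \sw_(v, u <- uptm Φ⟨act s2 d * c⟩)
    \sw_(q1, q2 <- Q) (((s1 * q1) • u) ⊗ (q2 • v)))); last by lin.
rewrite imul_RB imapE sw_uptm_braid; last by bil.
rewrite sw_exch; apply: eq_sw => u v.
rewrite sw_exch.
transitivity (\sw_(q1, q2 <- Q) \sw_(r1, r2 <- R) ((s1 • (q1 * r1) • u) ⊗ ((q2 * r2) • v))).
  by do 2!apply: eq_sw => ? ?; rewrite -!modactME !mulrA.
by rewrite (sw_QR (f := fun h g => (s1 • h • u) ⊗ (g • v))) ?modact1E //; bil.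
Qed.

Lemma RB_QB : tmul RBm QB = flip (ΔB 1).
Proof.
have hβ : bil (fun u v : regmod H => u ⊗ v) by bil.
apply: tensB_ext => φ ψ c d; rewrite sw_flip; last by bil.
rewrite (comulB_act hH act (β := fun v u => u ⊗ v)); last by bil.
rewrite modact1E sw_tmul; last by bil.
rewrite sw_exch.
transitivity (\sw_(p, q <- QB) \sw_(r1, r2 <- R) \sw_(s1, s2 <- R)
   \sw_(u, v <- uptm (imul (p • φ) (q • ψ))⟨act r2 c * d⟩) ((s1 • u) ⊗ ((r1 * s2) • v))).
  apply: eq_sw => p q; rewrite -(RB_act _ _ _ _ hβ).
  by apply: eq_sw => p' q'; rewrite !modactME.
rewrite sw_exch; apply: eq_sw => r1 r2; rewrite sw_exch.
transitivity (\sw_(s1, s2 <- R) \sw_(v, u <- uptm (imul ψ φ)⟨act r2 c * d⟩)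
  \sw_(q1, q2 <- Q) ((s1 • q1 • u) ⊗ ((r1 * s2) • q2 • v))).
  apply: eq_sw => s1 s2.
  rewrite -(imul_QB (β := fun u v => (s1 • u) ⊗ ((r1 * s2) • v))); last by bil.
  rewrite (sw_lin _ _ (F := fun Φ => \sw_(u, v <- uptm Φ⟨act r2 c * d⟩)
    ((s1 • u) ⊗ ((r1 * s2) • v)))) //.
  by lin.
rewrite sw_exch; apply: eq_sw => v u.
transitivity (\sw_(s1, s2 <- R) \sw_(q1, q2 <- Q) (((s1 * q1) • u) ⊗ (r1 • (s2 * q2) • v))).
  by do 2!apply: eq_sw => ? ?; rewrite -!modactME !mulrA.
by rewrite (sw_RQ (f := fun h g => (h • u) ⊗ (r1 • g • v))) ?modact1E //; bil.
Qed.

Lemma QB_corner : tmul (tmul (ΔB 1) QB) (flip (ΔB 1)) = QB.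
Proof.
have hβ : bil (fun u v : regmod H => u ⊗ v) by bil.
have e1 : tmul (ΔB 1) QB = QB.
  apply: tensB_ext => φ ψ c d; rewrite (QB_act _ _ _ _ hβ) sw_tmul; last by bil.
  rewrite sw_exch.
  transitivity (\sw_(p, q <- QB) \sw_(s1, s2 <- R)
    \sw_(u, v <- uptm (imul (p • φ) (q • ψ))⟨act s2 d * c⟩) ((s1 • u) ⊗ v)).
    apply: eq_sw => p q; rewrite -[imul _ _]modact1E -(comulB_act hH act _ _ _ _ _ hβ).
    by apply: eq_sw => p' q'; rewrite !modactME.
  rewrite sw_exch; apply: eq_sw => s1 s2.
  rewrite -(sw_lin _ _ (F := fun Φ => \sw_(u, v <- uptm Φ⟨act s2 d * c⟩) ((s1 • u) ⊗ v)));
    last by lin.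
  rewrite (imul_QB (β := fun u v => (s1 • u) ⊗ v)); last by bil.
  by do 2!apply: eq_sw => ? ?; rewrite modactME.
have e2 : tmul QB (flip (ΔB 1)) = QB.
  apply: tensB_ext => φ ψ c d; rewrite (QB_act _ _ _ _ hβ) sw_tmul; last by bil.
  rewrite sw_exch sw_flip; last by bil.
  transitivity (\sw_(e1, e2 <- ΔB 1) \sw_(s1, s2 <- R)
    \sw_(v, u <- uptm (imul (e1 • ψ) (e2 • φ))⟨act s2 d * c⟩)
    \sw_(q1, q2 <- Q) (((s1 * q1) • u) ⊗ (q2 • v))).
    apply: eq_sw => e1' e2'; rewrite -(QB_act _ _ _ _ hβ).
    by apply: eq_sw => p' q'; rewrite !modactME.
  rewrite sw_exch; apply: eq_sw => s1 s2.
  rewrite -(sw_lin _ _ (F := fun Φ => \sw_(v, u <- uptm Φ⟨act s2 d * c⟩)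
    \sw_(q1, q2 <- Q) (((s1 * q1) • u) ⊗ (q2 • v)))); last by lin.
  by rewrite (imul_comul hH hA) modact1E.
by rewrite e1 e2.
Qed.
End QuasiInverse.
End RMatrix.

(** * The hexagon identities for B *)

Section Hexagons.
Variables (k : fieldType) (H : falgType k) (D : hopfData H) (R : tensor H H).
Hypothesis hH : qt_hopf D R.
Variables (A : falgType k) (act : 'Hom(H, 'End(A))).
Hypothesis hA : module_algebra D act.
Variables (x : tensor A A) (α : 'Hom(A, k^o)).
Hypotheses (hx : symmetric_separability_idempotent x) (hα : sep_counit x α).
Implicit Types U V W : fdmod H.
Local Notation hR := (qt_hopf_weak hH).
Local Notation hD := (qth_hopf hH).
Local Notation Δ := (comul D).
Local Notation ΔB := (comulB hx hα D R act).
Local Notation F := (imod hx hα).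
Local Notation imul := (imul hH act).
Local Notation RBm := (RB hx hα R act).

Section Triple.
Variables (U V W : fdmod H) (Z : lmodType k) (γ : U -> V -> W -> Z).
Hypothesis hγ : tril γ.
Variables (φ : F U) (ψ : F V) (χ : F W) (c d e : A).

(** Both sides expand to the same sum, in which three copies of R stand in the
    two orders of a Yang-Baxter equation. *)
Lemma hexagonBl :
  \sw_(p, r <- RBm) \sw_(p1, p2 <- ΔB p) γ (p1 • φ)⟨c⟩ (p2 • ψ)⟨d⟩ (r • χ)⟨e⟩ =
  \sw_(p, r <- RBm) \sw_(q, s <- RBm) γ (p • φ)⟨c⟩ (q • ψ)⟨d⟩ ((r * s) • χ)⟨e⟩.
Proof.
(* The Yang-Baxter equation is applied to the factors h1 and h3 and to the
   factor which acts on d. *)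
pose K t1 t2 h1 (a : A) (h3 : H) : Z :=
  \sw_(q1, q2 <- R) \sw_(x1, x2 <- x) \sw_(p1, p2 <- R) \sw_(v, w <- uptm (imul ψ χ)⟨x2⟩)
    γ ((h1 * p1) • φ⟨act p2 x1 * a * (act t2 c * e)⟩) (q1 • v) ((t1 * h3 * q2) • w).
have hK t1 t2 : tril (K t1 t2) by rewrite /K; tril.
have hK' t1 t2 : tril (fun h1 h2 h3 => K t1 t2 h1 (act h2 d) h3).
  by case: (hK t1 t2) => k1 k2 k3; split=> *; [exact: k1 | apply: (lin_comp (k2 _ _));
    lin | exact: k3].
transitivity (\sw_(t1, t2 <- R) \sw_(s1, s2 <- R) \sw_(q1, q2 <- R) \sw_(r1, r2 <- R)
  K t1 t2 (s1 * q1) (act (r2 * s2) d) (r1 * q2)); last first.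
  (* The right-hand side, where x is central and moves d next to c e. *)
  transitivity (\sw_(t1, t2 <- R) \sw_(s1, s2 <- R) \sw_(q1, q2 <- R) \sw_(r1, r2 <- R)
    K t1 t2 (q1 * s1) (act (s2 * r2) d) (q2 * r1)).
    by apply: eq_sw => t1 t2; exact: (yang_baxter32 hH (hK' t1 t2)).
  transitivity (\sw_(q, s <- RBm) \sw_(t1, t2 <- R) \sw_(q1, q2 <- R) \sw_(x1, x2 <- x)
    \sw_(p1, p2 <- R)
    γ (q1 • p1 • φ⟨act p2 x1 * (act t2 c * e)⟩) (q • ψ)⟨d⟩ ((t1 * q2) • (s • χ)⟨x2⟩)); last first.
    rewrite [RHS]sw_exch; apply: eq_sw => q s.
    transitivity (\sw_(p, r <- RBm) γ (p • φ)⟨c⟩ (q • ψ)⟨d⟩ (r • s • χ)⟨e⟩); last first.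
      by apply: eq_sw => p r; rewrite modactME.
    rewrite (RB_act hH act (β := fun u w => γ u (q • ψ)⟨d⟩ w)); last by bil.
    apply: eq_sw => t1 t2; apply: eq_sw => q1 q2.
    by rewrite (sw_imul hH act (β := fun u w => γ (q1 • u) (q • ψ)⟨d⟩ ((t1 * q2) • w))) //; bil.
  transitivity (\sw_(t1, t2 <- R) \sw_(q1, q2 <- R) \sw_(x1, x2 <- x) \sw_(p1, p2 <- R)
    \sw_(q, s <- RBm)
    γ (q1 • p1 • φ⟨act p2 x1 * (act t2 c * e)⟩) (q • ψ)⟨d⟩ ((t1 * q2) • (s • χ)⟨x2⟩)); last first.
    by rewrite sw_pull4.
  apply: eq_sw => t1 t2; rewrite sw_exch; apply: eq_sw => q1 q2.
  transitivity (\sw_(r1, r2 <- R) \sw_(k1, k2 <- R) \sw_(x1, x2 <- x) \sw_(p1, p2 <- R)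
    \sw_(v, w <- uptm (imul ψ χ)⟨act r2 d * x2⟩)
      γ (q1 • p1 • φ⟨act p2 x1 * (act t2 c * e)⟩) (k1 • v) ((t1 * q2 * r1 * k2) • w)); last first.
    rewrite [RHS]sw_exch.
    transitivity (\sw_(x1, x2 <- x) \sw_(p1, p2 <- R) \sw_(r1, r2 <- R) \sw_(k1, k2 <- R)
      \sw_(v, w <- uptm (imul ψ χ)⟨act r2 d * x2⟩)
      γ (q1 • p1 • φ⟨act p2 x1 * (act t2 c * e)⟩) (k1 • v) ((t1 * q2 * r1 * k2) • w)).
      by rewrite sw_pull2; apply: eq_sw => x1 x2; rewrite sw_pull2.
    rewrite [RHS]sw_exch; apply: eq_sw => x1 x2; apply: eq_sw => p1 p2.
    rewrite (RB_act hH act (β := fun v w => γ (q1 • p1 • φ⟨act p2 x1 * (act t2 c * e)⟩) v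
      ((t1 * q2) • w))); last by bil.
    do 3![apply: eq_sw => ? ?]; by rewrite -!modactME !mulrA.
  rewrite sw_exch; apply: eq_sw => r1 r2.
  transitivity (\sw_(k1, k2 <- R) \sw_(x1, x2 <- x) \sw_(s1, s2 <- R) \sw_(p1, p2 <- R)
    \sw_(v, w <- uptm (imul ψ χ)⟨x2⟩)
    γ ((q1 * (s1 * p1)) • φ⟨act p2 x1 * act s2 (act r2 d) * (act t2 c * e)⟩) (k1 • v)
      ((t1 * (q2 * r1) * k2) • w)).
    rewrite [RHS]sw_pull2; apply: eq_sw => s1 s2.
    do 4![apply: eq_sw => ? ?]; by rewrite (actME hA) !mulrA.
  apply: eq_sw => k1 k2.
  rewrite [RHS](sep_swC hx (act r2 d) (f := fun x1 x2 => \sw_(p1, p2 <- R)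
    \sw_(v, w <- uptm (imul ψ χ)⟨x2⟩)
      γ (q1 • p1 • φ⟨act p2 x1 * (act t2 c * e)⟩) (k1 • v) ((t1 * q2 * r1 * k2) • w))); last by bil.
  apply: eq_sw => x1 x2.
  pose f h a := \sw_(v, w <- uptm (imul ψ χ)⟨x2⟩)
      γ (q1 • h • φ⟨a * (act t2 c * e)⟩) (k1 • v) ((t1 * q2 * r1 * k2) • w).
  rewrite [RHS](R_actM hH hA (f := f)); last by rewrite /f; bil.
  by do 3![apply: eq_sw => ? ?]; rewrite -!modactME !mulrA.
(* The left-hand side, where Δ on R^1 gives two more copies of R. *)
transitivity (\sw_(s1, s2 <- R) \sw_(t1, t2 <- R) \sw_(q1, q2 <- R)
   \sw_(m, w <- uptm (imul (imul φ ψ) χ)⟨act t2 (act s2 d * c) * e⟩)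
   \sw_(a, b <- Δ q1) \sw_(u, v <- uptm m) γ (s1 • a • u) (b • v) ((t1 * q2) • w)).
  transitivity (\sw_(p, r <- RBm) \sw_(s1, s2 <- R) \sw_(u, v <- uptm (p • imul φ ψ)⟨act s2 d * c⟩)
    γ (s1 • u) v (r • χ)⟨e⟩).
    apply: eq_sw => p r.
    by rewrite (comulB_act hH act (β := fun u v => γ u v (r • χ)⟨e⟩)) //; bil.
  rewrite sw_exch; apply: eq_sw => s1 s2.
  rewrite (RB_act hH act (β := fun m w => \sw_(u, v <- uptm m) γ (s1 • u) v w)); last by bil.
  apply: eq_sw => t1 t2; apply: eq_sw => q1 q2; apply: eq_sw => m w.
  by rewrite (sw_uptm_act hD (f := fun u v => γ (s1 • u) v ((t1 * q2) • w))) //; bil.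
pose f s1 (h : H) (a : A) : Z :=
  \sw_(q1, q2 <- R) \sw_(k1, k2 <- R) \sw_(x1, x2 <- x) \sw_(p1, p2 <- R)
  \sw_(v, w <- uptm (imul ψ χ)⟨x2⟩)
    γ ((s1 * q1 * p1) • φ⟨act p2 x1 * (a * e)⟩) (k1 • v) ((h * q2 * k2) • w).
have hf s1 : bil (f s1) by rewrite /f; bil.
transitivity (\sw_(s1, s2 <- R) \sw_(t1, t2 <- R) f s1 t1 (act t2 (act s2 d * c))); last first.
  rewrite [RHS]sw_exch; apply: eq_sw => s1 s2.
  rewrite (R_actM hH hA _ _ (hf s1)); apply: eq_sw => t1 t2.
  rewrite [RHS]sw_exch; apply: eq_sw => r1 r2; apply: eq_sw => q1 q2.
  by do 4![apply: eq_sw => ? ?]; rewrite (actME hA) !mulrA.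
apply: eq_sw => s1 s2; apply: eq_sw => t1 t2.
set z := act t2 _.
transitivity (\sw_(q1, q2 <- R) \sw_(a, b <- Δ q1) \sw_(m, w <- uptm (imul (imul φ ψ) χ)⟨z * e⟩)
   \sw_(u, v <- uptm m) γ (s1 • a • u) (b • v) ((t1 * q2) • w)).
  by apply: eq_sw => q1 q2; rewrite sw_exch.
rewrite (hexl3 hR (f := fun a b q => \sw_(m, w <- uptm (imul (imul φ ψ) χ)⟨z * e⟩)
   \sw_(u, v <- uptm m) γ (s1 • a • u) (b • v) ((t1 * q) • w))); last by tril.
apply: eq_sw => q1 q2; apply: eq_sw => k1 k2.
rewrite (sw_assoc hD (f := fun u v w => γ (s1 • q1 • u) (k1 • v) ((t1 * (q2 * k2)) • w)));
  last by tril.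
rewrite (imul_assoc hH hA).
rewrite (sw_imul hH act (β := fun u m => \sw_(v, w <- uptm m) γ (s1 • q1 • u) (k1 • v)
  ((t1 * (q2 * k2)) • w))); last by bil.
by do 3![apply: eq_sw => ? ?]; rewrite -!modactME !mulrA.
Qed.

(** As for [hexagonBl], with the Yang-Baxter equation in its other form. *)
Lemma hexagonBr :
  \sw_(p, r <- RBm) \sw_(r1, r2 <- ΔB r) γ (p • φ)⟨c⟩ (r1 • ψ)⟨d⟩ (r2 • χ)⟨e⟩ =
  \sw_(p, r <- RBm) \sw_(q, s <- RBm) γ ((p * q) • φ)⟨c⟩ (s • ψ)⟨d⟩ (r • χ)⟨e⟩.
Proof.
(* [K] takes the three factors to which the Yang-Baxter equation applies; its
   last one acts on the leg x1. *)
pose K (t1 t2 q1 q2 s1 s2 y1 y2 : H) (x1 x2 : A) (h1 h2 h3 : H) : Z :=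
  \sw_(u, v <- uptm (imul φ ψ)⟨act h3 x1 * (act (y2 * t2) c * (act s2 e * d))⟩)
   γ ((q1 * h1) • u) ((s1 * y1 * h2) • v) ((t1 * q2) • χ⟨x2⟩).
have hK t1 t2 q1 q2 s1 s2 y1 y2 x1 x2 : tril (K t1 t2 q1 q2 s1 s2 y1 y2 x1 x2) by rewrite /K; tril.
transitivity (\sw_(s1, s2 <- R) \sw_(y1, y2 <- R) \sw_(t1, t2 <- R) \sw_(q1, q2 <- R)
  \sw_(x1, x2 <- x)
  \sw_(k1, k2 <- R) \sw_(p1, p2 <- R) \sw_(l1, l2 <- R)
  K t1 t2 q1 q2 s1 s2 y1 y2 x1 x2 (k1 * p1) (k2 * l1) (p2 * l2)).
  transitivity (\sw_(s1, s2 <- R) \sw_(t1, t2 <- R) \sw_(q1, q2 <- R)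
    \sw_(u, m <- uptm (imul φ (imul ψ χ))⟨act t2 c * (act s2 e * d)⟩)
    \sw_(v, w <- uptm ((t1 * q2) • m)) γ (q1 • u) (s1 • v) w).
    transitivity (\sw_(p, r <- RBm) \sw_(s1, s2 <- R) \sw_(v, w <- uptm (r • imul ψ χ)⟨act s2 e *
      d⟩)
      γ (p • φ)⟨c⟩ (s1 • v) w).
      apply: eq_sw => p r.
      by rewrite (comulB_act hH act (β := fun v w => γ (p • φ)⟨c⟩ v w)) //; bil.
    rewrite sw_exch; apply: eq_sw => s1 s2.
    by rewrite (RB_act hH act (β := fun u m => \sw_(v, w <- uptm m) γ u (s1 • v) w)) //; bil.
  apply: eq_sw => s1 s2.
  transitivity (\sw_(t1, t2 <- R) \sw_(a, b <- Δ t1) \sw_(q1, q2 <- R) \sw_(g, h <- Δ q2)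
    \sw_(u, m <- uptm (imul φ (imul ψ χ))⟨act t2 c * (act s2 e * d)⟩) \sw_(v, w <- uptm m)
    γ (q1 • u) (s1 • a • g • v) (b • h • w)).
    apply: eq_sw => t1 t2; rewrite [RHS]sw_exch; apply: eq_sw => q1 q2.
    transitivity (\sw_(u, m <- uptm (imul φ (imul ψ χ))⟨act t2 c * (act s2 e * d)⟩)
      \sw_(a, b <- Δ t1) \sw_(g, h <- Δ q2) \sw_(v, w <- uptm m)
      γ (q1 • u) (s1 • a • g • v) (b • h • w)); last by rewrite -sw_pull2.
    apply: eq_sw => u m; rewrite modactME.
    rewrite (sw_uptm_act hD (f := fun v w => γ (q1 • u) (s1 • v) w)); last by bil.
    apply: eq_sw => a b.
    by rewrite (sw_uptm_act hD (f := fun v w => γ (q1 • u) (s1 • a • v) (b • w))) //; bil.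
  transitivity (\sw_(y1, y2 <- R) \sw_(t1, t2 <- R) \sw_(q1, q2 <- R) \sw_(k1, k2 <- R)
    \sw_(u, m <- uptm (imul φ (imul ψ χ))⟨act (y2 * t2) c * (act s2 e * d)⟩) \sw_(v, w <- uptm m)
    γ ((q1 * k1) • u) (s1 • y1 • k2 • v) (t1 • q2 • w)).
    rewrite (hexl3 hR (f := fun a b t => \sw_(q1, q2 <- R) \sw_(g, h <- Δ q2)
      \sw_(u, m <- uptm (imul φ (imul ψ χ))⟨act t c * (act s2 e * d)⟩) \sw_(v, w <- uptm m)
      γ (q1 • u) (s1 • a • g • v) (b • h • w))); last by tril.
    apply: eq_sw => y1 y2; apply: eq_sw => t1 t2.
    by rewrite (hexr3 hR (f := fun q g h =>
      \sw_(u, m <- uptm (imul φ (imul ψ χ))⟨act (y2 * t2) c * (act s2 e * d)⟩) \sw_(v, w <- uptm m)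
      γ (q • u) (s1 • y1 • g • v) (t1 • h • w))) //; tril.
  apply: eq_sw => y1 y2; apply: eq_sw => t1 t2; apply: eq_sw => q1 q2; rewrite [RHS]sw_exch.
  apply: eq_sw => k1 k2.
  rewrite -(imul_assoc hH hA).
  rewrite -(sw_assoc hD (f := fun u v w => γ ((q1 * k1) • u) (s1 • y1 • k2 • v) (t1 • q2 • w)));
    last by tril.
  rewrite (sw_imul hH act (β := fun m w => \sw_(u, v <- uptm m) γ ((q1 * k1) • u)
    (s1 • y1 • k2 • v) (t1 • q2 • w))); last by bil.
  apply: eq_sw => x1 x2.
  pose f g h a := \sw_(u, v <- uptm (imul φ ψ)⟨a * (act (y2 * t2) c * (act s2 e * d))⟩)
    γ ((q1 * k1) • g • u) (s1 • y1 • k2 • h • v) (t1 • q2 • χ⟨x2⟩).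
  have hf : tril f by rewrite /f; tril.
  transitivity (\sw_(r1, r2 <- R) \sw_(g, h <- Δ r1) f g h (act r2 x1)).
    apply: eq_sw => r1 r2.
    by rewrite (sw_uptm_act hD (f := fun u v => γ ((q1 * k1) • u) (s1 • y1 • k2 • v)
      (t1 • q2 • χ⟨x2⟩))) //; bil.
  rewrite (R_comul_act hH hA _ hf).
  do 2![apply: eq_sw => ? ?]; rewrite /f /K !(actME hA).
  by apply: eq_sw => u v; rewrite -!modactME !mulrA.
transitivity (\sw_(s1, s2 <- R) \sw_(y1, y2 <- R) \sw_(t1, t2 <- R) \sw_(q1, q2 <- R)
  \sw_(x1, x2 <- x)
  \sw_(k1, k2 <- R) \sw_(p1, p2 <- R) \sw_(l1, l2 <- R)
  K t1 t2 q1 q2 s1 s2 y1 y2 x1 x2 (p1 * k1) (l1 * k2) (l2 * p2)).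
  do 5![apply: eq_sw => ? ?]; exact: (yang_baxter hH (hK _ _ _ _ _ _ _ _ _ _)).
rewrite sw_pull2.
transitivity (\sw_(t1, t2 <- R) \sw_(q1, q2 <- R) \sw_(x1, x2 <- x) \sw_(p1, p2 <- R)
  \sw_(q, s <- RBm)
  γ (q1 • p1 • (q • φ)⟨act p2 x1 * (act t2 c * e)⟩) (s • ψ)⟨d⟩ ((t1 * q2) • χ⟨x2⟩)); last first.
  rewrite [RHS]sw_exch sw_pull4; apply: eq_sw => q s.
  transitivity (\sw_(p, r <- RBm) γ (p • q • φ)⟨c⟩ (s • ψ)⟨d⟩ (r • χ)⟨e⟩); last first.
    by apply: eq_sw => p r; rewrite modactME.
  rewrite (RB_act hH act (β := fun u w => γ u (s • ψ)⟨d⟩ w)); last by bil.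
  apply: eq_sw => t1 t2; apply: eq_sw => q1 q2.
  by rewrite (sw_imul hH act (β := fun u w => γ (q1 • u) (s • ψ)⟨d⟩ ((t1 * q2) • w))) //; bil.
apply: eq_sw => t1 t2; rewrite sw_pull2; apply: eq_sw => q1 q2.
rewrite sw_pull2; apply: eq_sw => x1 x2; rewrite sw_pull3; apply: eq_sw => p1 p2.
rewrite (RB_act hH act (β := fun u v => γ (q1 • p1 • u) v ((t1 * q2) • χ⟨x2⟩))); last by bil.
pose f h a := \sw_(k1, k2 <- R) \sw_(u, v <- uptm (imul φ ψ)⟨a * d⟩)
  γ (q1 • p1 • k1 • u) ((h * k2) • v) ((t1 * q2) • χ⟨x2⟩).
have hf : bil f by rewrite /f; bil.
rewrite [RHS](R_actM hH hA _ _ hf).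
pose f' h a := \sw_(l1, l2 <- R) f (h * l1) (act l2 (act p2 x1) * a).
have hf' : bil f' by rewrite /f' /f; bil.
rewrite [RHS](R_actM hH hA _ _ hf').
rewrite {hf hf'}/f' /f /K.
apply: eq_sw => s1 s2; apply: eq_sw => y1 y2; rewrite sw_exch; apply: eq_sw => l1 l2.
apply: eq_sw => k1 k2; rewrite !(actME hA) -!mulrA.
by apply: eq_sw => u v; rewrite -!modactME !mulrA.
Qed.
End Triple.

Lemma RB_qt : qt_weak_hopf (hopfB hx hα D R act) RBm.
Proof.
have [Q [RQ QR]] := qth_inv hH.
split.
- exact: (hopfB_weak hH hA hx hα).
- exact: (RB_corner hH hA hx hα).
- exists (QB R act hx hα Q); first exact: (QB_corner hH hA hx hα).
  by split; [exact: (RB_QB hH hA) | exact: (QB_RB hH hA)].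
- exact: (RB_comul hH hA).
- apply: tensB3_ext => φ ψ χ c d e; rewrite !sw3_sw; try by tril.
  by apply: (@hexagonBl _ _ _ _ (fun u v w : regmod H => u ⊗ (v ⊗ w))); tril.
apply: tensB3_ext => φ ψ χ c d e; rewrite !sw3_sw; try by tril.
by apply: (@hexagonBr _ _ _ _ (fun u v w : regmod H => u ⊗ (v ⊗ w))); tril.
Qed.
End Hexagons.

(** * The induction functor is braided monoidal *)

Section MonoidalFunctor.
Variables (k : fieldType) (H : falgType k) (D : hopfData H) (R : tensor H H).
Hypothesis hH : qt_hopf D R.
Variables (A : falgType k) (act : 'Hom(H, 'End(A))).
Hypothesis hA : module_algebra D act.
Variables (x : tensor A A) (α : 'Hom(A, k^o)).
Hypotheses (hx : symmetric_separability_idempotent x) (hα : sep_counit x α).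
Implicit Types U V W : fdmod H.
Local Notation hR := (qt_hopf_weak hH).
Local Notation hW := (qtw_weak hR).
Local Notation hD := (qth_hopf hH).
Local Notation B := (endoHopf H hx hα).
Local Notation pure := (bpure (H := H) hx hα).
Local Notation ΔB := (comulB hx hα D R act).
Local Notation "u ⊠ v" := (ptm hW u v) (at level 40, left associativity).
Local Notation F := (imod hx hα).
Local Notation imul := (imul hH act).
Local Notation imap := (imap hx hα).
Local Notation RBm := (RB hx hα R act).
Local Notation one := (uobj hW).
Local Notation ounit := (ounit hH hx hα).
Local Notation tgtB := (target_counital (hopfB hx hα D R act)).
Variable hB : qt_weak_hopf (hopfB hx hα D R act) RBm.
Local Notation hWB := (qtw_weak hB).
Local Notation "φ ⊛ ψ" := (ptm hWB φ ψ) (at level 40, left associativity).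

Definition iten U V : rhom (tobj hWB (F U) (F V)) (F (tobj hW U V)).
Proof.
apply: (@mkhom2 _ _ _ hWB (F U) (F V) _ (fun φ ψ => imul φ ψ)).
- exact: imul_bil.
- by move=> φ ψ; rewrite [LHS](imul_comul hH hA) modact1E.
- by move=> b φ ψ; rewrite [LHS](imul_comul hH hA).
Defined.
Lemma iten_pt U V (φ : F U) (ψ : F V) : vsval (iten U V) (φ ⊛ ψ) = imul φ ψ.
Proof. exact: mkhom2_pt. Qed.

(** The pure tensor f ⊗ u of A^* ⊗ U. *)
Definition ifun U (f : 'Hom(A, k^o)) (u : U) : F U := mkind hx hα (fun c => (f c : k) *: u).
Lemma ifunE U (f : 'Hom(A, k^o)) (u : U) c : (ifun f u)⟨c⟩ = (f c : k) *: u.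
Proof. by rewrite evE //; lin. Qed.
Lemma ifun_bil U : bil (@ifun U).
Proof. by rewrite /ifun; bil. Qed.

(** The section of the product, with its value expanded in pure tensors by
    means of two copies of x. *)
Definition iten_inv U V (Φ : F (tobj hW U V)) : tobj hWB (F U) (F V) :=
  \sw_(y1, y2 <- x) \sw_(z1, z2 <- x) \sw_(s1, s2 <- R) \sw_(u, v <- uptm Φ⟨act s2 z1 * y1⟩)
    (ifun (rharp y2 α) (s1 • u) ⊛ ifun (rharp z2 α) v).

Lemma iten_invK U V (Φ : F (tobj hW U V)) : vsval (iten U V) (iten_inv Φ) = Φ.
Proof.
apply: ev_ext => c.
transitivity (\sw_(y1, y2 <- x) \sw_(z1, z2 <- x) \sw_(s1, s2 <- R)
  \sw_(x1, x2 <- x) \sw_(r1, r2 <- R) \sw_(u, v <- uptm Φ⟨act s2 z1 * y1⟩)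
   ((α (act r2 x1 * c * y2) : k) *: ((α (x2 * z2) : k) *: ((r1 • s1 • u) ⊠ v)))).
  have hl : lin (fun m => (vsval (iten U V) m)⟨c⟩) by lin.
  do 3!(rewrite [LHS](sw_lin _ _ hl); apply: eq_sw => ? ?).
  rewrite [RHS]sw_pull2 [LHS](sw_lin _ _ hl); apply: eq_sw => u v.
  rewrite iten_pt imulE; do 2![apply: eq_sw => ? ?].
  rewrite !ifunE !linfun_lin; try by lin.
  rewrite modactZ (linZ (F := fun m => m ⊠ _)); last by lin.
  by rewrite (linZ (F := fun m => _ ⊠ m)) //; lin.
pose g h a := \sw_(u, v <- uptm Φ⟨a * c⟩) ((h • u) ⊠ v).
have hg : bil g by rewrite /g; bil.
transitivity (g 1 1); last first.
  rewrite /g mul1r -[RHS](ptm_uptm hD); by apply: eq_sw => u v; rewrite modact1E.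
rewrite -(R_sep_collapse hH hA hx hg).
transitivity (\sw_(x1, x2 <- x) \sw_(r1, r2 <- R) \sw_(y1, y2 <- x) \sw_(z1, z2 <- x)
  \sw_(s1, s2 <- R) \sw_(u, v <- uptm Φ⟨act s2 z1 * y1⟩)
   ((α (act r2 x1 * c * y2) : k) *: ((α (x2 * z2) : k) *: ((r1 • s1 • u) ⊠ v)))).
  by rewrite sw_pull3; apply: eq_sw => x1 x2; rewrite sw_pull3.
apply: eq_sw => x1 x2; apply: eq_sw => r1 r2.
pose K (a b : A) := \sw_(s1, s2 <- R) \sw_(u, v <- uptm Φ⟨act s2 a * b⟩) ((r1 • s1 • u) ⊠ v).
have hK : bil K by rewrite /K; bil.
transitivity (K x2 (act r2 x1 * c)); last first.
  rewrite /K /g; apply: eq_sw => s1 s2; rewrite mulrA.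
  by apply: eq_sw => u v; rewrite modactME.
rewrite -(sep_expand hx hα _ (hK.2 x2)); apply: eq_sw => y1 y2.
rewrite -(sep_expand hx hα _ (hK.1 y1)).
rewrite [RHS](sw_lin _ _ (F := fun m => (α (act r2 x1 * c * y2) : k) *: m)); last by lin.
apply: eq_sw => z1 z2; rewrite scalerA /K.
rewrite [RHS](sw_lin _ _ (F := fun m => (α (act r2 x1 * c * y2) * α (x2 * z2) : k) *: m));
  last by lin.
apply: eq_sw => s1 s2.
rewrite [RHS](sw_lin _ _ (F := fun m => (α (act r2 x1 * c * y2) * α (x2 * z2) : k) *: m));
  last by lin.
by apply: eq_sw => u v; rewrite scalerA.
Qed.

(** The truncated tensor product consists of the tensors fixed by Δ_B(1), which
    acts as the section after the product. *)
Lemma iten_ev U V (m : tobj hWB (F U) (F V)) c d :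
  \sw_(φ, ψ <- uptm m) (φ⟨c⟩ ⊗ ψ⟨d⟩) =
  \sw_(s1, s2 <- R) \sw_(u, v <- uptm (vsval (iten U V) m)⟨act s2 d * c⟩) ((s1 • u) ⊗ v).
Proof.
move: m; apply: ptm_ext => [||φ ψ]; try by lin.
rewrite iten_pt /uptm /ptm ptE vsval_tpr tact_tens sw_sw.
transitivity (\sw_(p, q <- ΔB 1) ((p • φ)⟨c⟩ ⊗ (q • ψ)⟨d⟩)).
  by apply: eq_sw => p q; rewrite sw_tens //; bil.
by rewrite (comulB_act hH act (β := fun u v => u ⊗ v)) ?modact1E //; bil.
Qed.

Lemma iten_inj U V (m m' : tobj hWB (F U) (F V)) :
  vsval (iten U V) m = vsval (iten U V) m' -> m = m'.
Proof.
move=> e; apply: subvs_inj.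
apply: (@tens_separated _ (F U) (F V) U V A A (fun c φ => φ⟨c⟩) (fun c φ => φ⟨c⟩)).
- by lin.
- by lin.
- by move=> φ φ' eφ; apply: ev_ext.
- by move=> φ φ' eφ; apply: ev_ext.
by move=> c d; have := iten_ev m c d; rewrite e -(iten_ev m' c d).
Qed.

Lemma iten_iso U V : exists2 g, rcomp g (iten U V) = rid _ & rcomp (iten U V) g = rid _.
Proof.
apply: (riso (g := @iten_inv U V)).
- by have := @ifun_bil U; have := @ifun_bil V; rewrite /iten_inv => hU hV; lin.
- exact: iten_invK.
by move=> m; apply: iten_inj; rewrite iten_invK.
Qed.

(** The unit object of B-modules is the image of the target counital map; this and
    [tgtB_eq] identify it with the orbit of the unit for [imul]. *)
Lemma tgtB_ounit b : tgtB b • ounit = b • ounit.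
Proof.
apply: ev_ext => c; rewrite (target_evalB hH hA).
have hl : lin (fun a => (ucoef (b • ounit)⟨a * c⟩ : k) *: (uone hW : one)) by lin.
transitivity (\sw_(x1, x2 <- x) ((α (1 * x2) : k) *: ((ucoef (b • ounit)⟨x1 * c⟩ : k) *:
  (uone hW : one)))).
  by apply: eq_sw => x1 x2; rewrite ounitE mul1r scalerA mulrC -scalerA.
by rewrite (sep_expand hx hα 1 hl) mul1r -(ucoefE hD).
Qed.

Lemma tgtB_eq b b' : b • ounit = b' • ounit -> tgtB b = tgtB b'.
Proof.
by move=> e; apply: imod_faithful => φ c; rewrite !(target_evalB hH hA) e.
Qed.

Definition iunit : rhom (uobj hWB) (F one).
Proof.
apply: (@mkhom _ _ (uobj hWB) (F one) (linfun (fun z : uobj hWB => uval z • ounit))).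
have hl : lin (fun z : uobj hWB => uval z • ounit) by lin.
move=> b z; rewrite !(linfun_lin hl).
by rewrite uval_act tgtB_ounit modactME.
Defined.
Lemma iunitE z : vsval iunit z = uval z • ounit.
Proof.
have hl : lin (fun z : uobj hWB => uval z • ounit) by lin.
exact: (linfun_lin hl).
Qed.

(** A map Ψ from A to the unit object is a functional on A; the element of B
    written here sends [ounit] to Ψ. *)
Definition iunit_inv (Ψ : F one) : uobj hWB :=
  uproj hWB (\sw_(x1, x2 <- x) pure x2 1 (lharp (linfun (fun c : A => ucoef Ψ⟨c⟩)) x1)).

Lemma iunit_iso : exists2 g, rcomp g iunit = rid _ & rcomp iunit g = rid _.
Proof.
have hf (Ψ : F one) : lin (fun c : A => ucoef Ψ⟨c⟩) by lin.
have hK (Ψ : F one) : (\sw_(x1, x2 <- x)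
    pure x2 1 (lharp (linfun (fun c : A => ucoef Ψ⟨c⟩)) x1)) • ounit = Ψ.
  apply: ev_ext => c.
  rewrite (sw_lin _ _ (F := fun b : B => (b • ounit)⟨c⟩)); last by lin.
  have hl : lin (fun a => (ucoef Ψ⟨a * c⟩ : k) *: (uone hW : one)) by lin.
  transitivity (\sw_(x1, x2 <- x) ((α (1 * x2) : k) *: ((ucoef Ψ⟨x1 * c⟩ : k) *: (uone hW : one)))).
    apply: eq_sw => x1 x2; rewrite ev_pure modact1E ounitE linfun_lin; last by lin.
    by rewrite (linfun_lin (hf Ψ)) mul1r !scalerA mulrC.
  by rewrite (sep_expand hx hα 1 hl) mul1r -(ucoefE hD).
apply: (riso (g := iunit_inv)).
- have hl : lin (fun Ψ : F one => linfun (fun c : A => ucoef Ψ⟨c⟩)) by apply: lin_linfun; lin.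
  rewrite /iunit_inv; apply: lin_uproj; apply: lin_swr => x1 x2; apply: lin_bpure3.
  apply: lin_linfun => [Ψ|a]; first by lin.
  by apply: lin_lapp.
- by move=> Ψ; rewrite iunitE uval_proj tgtB_ounit hK.
move=> z; rewrite -[RHS]uproj_val /iunit_inv /uproj; congr vsproj.
by apply: tgtB_eq; rewrite hK iunitE.
Qed.

Lemma iten_nat U U' V V' (f : rhom U U') (g : rhom V V') :
  rcomp (iten U' V') (rten hWB (imap f) (imap g)) = rcomp (imap (rten hW f g)) (iten U V).
Proof.
apply: (@rhom2_ext _ _ _ hWB) => φ ψ; rewrite !rcompE rten_pt !iten_pt.
apply: ev_ext => c; rewrite imapE !imulE rsw; apply: eq_sw => x1 x2.
by rewrite rsw; apply: eq_sw => r1 r2; rewrite rten_pt rhomP !imapE.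
Qed.

Lemma iten_assoc U V W :
  rcomp (imap (rassoc hW U V W))
    (rcomp (iten (tobj hW U V) W) (rten hWB (iten U V) (rid (F W)))) =
  rcomp (iten U (tobj hW V W))
    (rcomp (rten hWB (rid (F U)) (iten V W)) (rassoc hWB (F U) (F V) (F W))).
Proof.
apply: (@rhom3_ext _ _ _ hWB) => φ ψ χ; rewrite !rcompE rassoc_pt !rten_pt !ridE !iten_pt.
by apply: ev_ext => c; rewrite imapE (imul_assoc hH hA).
Qed.

Lemma iten_lunit V :
  rcomp (imap (rlunit hW V)) (rcomp (iten one V) (rten hWB iunit (rid (F V)))) =
  rlunit hWB (F V).
Proof.
apply: (@rhom2_ext _ _ _ hWB) => z ψ; rewrite !rcompE rlunit_pt rten_pt ridE iten_pt.
apply: ev_ext => c; rewrite imapE (imul_lunit hA) -[in RHS](uval_fix z) (target_evalB hH hA).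
by apply: eq_sw => x1 x2; rewrite iunitE.
Qed.

Lemma iten_runit V :
  rcomp (imap (rrunit hW V)) (rcomp (iten V one) (rten hWB (rid (F V)) iunit)) =
  rrunit hWB (F V).
Proof.
apply: (@rhom2_ext _ _ _ hWB) => φ z; rewrite !rcompE rrunit_pt rten_pt ridE iten_pt.
apply: ev_ext => c; rewrite imapE iunitE /osource.
have hl : lin (fun b : B => (b • φ)⟨c⟩) by lin.
rewrite [RHS](sw_lin _ _ hl).
transitivity (\sw_(e1, e2 <- ΔB 1) ((ucoef (e2 • uval z • ounit)⟨1⟩ : k) *: (e1 • φ)⟨c⟩));
  last first.
  by apply: eq_sw => e1 e2; rewrite (linZ hl) /= (counitB_eval hH) modactME.
rewrite (comulB_act hH act (β := fun v z => (ucoef z : k) *: v)); last by bil.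
pose f s a := \sw_(v, w <- uptm (imul φ (uval z • ounit))⟨a * c⟩) ((ucoef w : k) *: (s • v)).
rewrite modact1E (R_act1 hH hA (f := f)); last by rewrite /f; bil.
rewrite /f mul1r; under eq_sw do rewrite modact1E.
by rewrite sw_runit.
Qed.

Lemma iten_braid U V :
  rcomp (imap (rbraid hW hR U V)) (iten U V) =
  rcomp (iten V U) (rbraid hWB hB (F U) (F V)).
Proof.
apply: (@rhom2_ext _ _ _ hWB) => φ ψ; rewrite !rcompE rbraid_pt rsw !iten_pt.
by rewrite -(imul_RB hH hA); apply: eq_sw => p q; rewrite iten_pt.
Qed.

Definition induction_functor : functor (Rep hR) (Rep hB).
Proof.
apply: (@Functor _ (Rep hR) (Rep hB) F (fun U V (g : rhom U V) => imap g)).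
- move=> U V c f g; apply: rhom_ext => φ; apply: ev_ext => a.
  have hl : lin (fun φ : F V => φ⟨a⟩) by lin.
  by rewrite imapE !rhomPE hl !imapE.
- by move=> U; apply: rhom_ext => φ; apply: ev_ext => a; rewrite imapE !ridE.
by move=> U V W f g; apply: rhom_ext => φ; apply: ev_ext => a; rewrite imapE !rcompE !imapE.
Defined.

Definition induction_braided : braidedFunctor (Rep hR) (Rep hB) :=
  @Build_braidedFunctor k (Rep hR) (Rep hB) induction_functor iten iunit
    iten_iso iunit_iso iten_nat iten_assoc iten_lunit iten_runit iten_braid.
End MonoidalFunctor.

(** * The inverse functor *)

Section Morita.
Variables (k : fieldType) (H A : falgType k) (x : tensor A A) (α : 'Hom(A, k^o)).
Hypotheses (hx : symmetric_separability_idempotent x) (hα : sep_counit x α).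
Implicit Types (V : fdmod H).
Local Notation B := (endoHopf H hx hα).
Local Notation pure := (bpure (H := H) hx hα).
Local Notation F := (imod hx hα).
Local Notation imap := (imap hx hα).
Variables (a0 : A) (f0 : 'Hom(A, k^o)).
Hypothesis f0a0 : f0 a0 = 1.

(** A copy of H inside B, whose unit e = a0 ⊗ 1 ⊗ f0 is an idempotent of B. *)
Definition corner (h : H) : B := pure a0 h f0.
Lemma corner_mul g h : corner g * corner h = corner (g * h).
Proof. by rewrite /corner bpureM f0a0 scale1r. Qed.
Lemma corner_lin : lin corner.
Proof. by rewrite /corner; lin. Qed.

Section Restriction.
Variable M : fdmod B.
Implicit Types (m : M).
Definition corner_space : {vspace M} := limg (modact M (corner 1)).
Lemma corner_mem a h m : pure a h f0 • m \in corner_space.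
Proof.
have -> : pure a h f0 • m = corner 1 • pure a h f0 • m.
  by rewrite -modactME /corner bpureM f0a0 scale1r mul1r.
exact: memv_img (memvf _).
Qed.
Lemma corner_id (u : subvs_of corner_space) : corner 1 • vsval u = vsval u.
Proof.
by have /memv_imgP[m _ ->] := subvsP u; rewrite -modactME corner_mul mul1r.
Qed.
Definition ract : 'Hom(H, 'End(subvs_of corner_space)) :=
  linfun (fun h => linfun (fun u : subvs_of corner_space =>
    vsproj corner_space (corner h • vsval u))).
Lemma ractE h u : vsval (ract h u) = corner h • vsval u.
Proof.
have hl : lin (fun h : H => linfun (fun u : subvs_of corner_space =>
  vsproj corner_space (corner h • vsval u))).
  by have hc := corner_lin; lin.
rewrite /ract (linfun_lin hl) linfun_lin; last by lin.
by rewrite vsprojK // corner_mem.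
Qed.
(** This is e M, on which H acts through [corner]. *)
Definition rmod : fdmod H.
Proof.
apply: (@Fdmod k H (subvs_of corner_space) ract).
  by apply/lfunP => u; apply: subvs_inj; rewrite ractE id_lfunE corner_id.
by move=> g h; apply/lfunP => u; apply: subvs_inj; rewrite comp_lfunE !ractE -corner_mul modactME.
Defined.
Definition rval (u : rmod) : M := vsval (u : subvs_of corner_space).
Definition rproj (a : A) (m : M) : rmod := vsproj corner_space (pure a 1 f0 • m).
Lemma lin_rval (Z : lmodType k) (g : Z -> rmod) : lin g -> lin (fun z => rval (g z)).
Proof. by rewrite /rval => hg; apply: lin_vsval. Qed.
Lemma rproj_bil : bil rproj.
Proof. by rewrite /rproj; bil. Qed.
Lemma rval_inj : injective rval. Proof. exact: subvs_inj. Qed.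
Lemma rval_proj a m : rval (rproj a m) = pure a 1 f0 • m.
Proof. by rewrite /rval /rproj vsprojK // corner_mem. Qed.
Lemma rval_act h u : rval (h • u) = corner h • rval u.
Proof. exact: ractE. Qed.
Lemma rval_id u : corner 1 • rval u = rval u.
Proof. exact: corner_id. Qed.
End Restriction.

Definition rmap (M N : fdmod B) (g : rhom M N) : rhom (rmod M) (rmod N).
Proof.
apply: (@mkhom _ _ (rmod M) (rmod N) (linfun (fun u : rmod M => rproj a0 (vsval g (rval u))))).
have hr := @rproj_bil N.
have hl : lin (fun u : rmod M => rproj a0 (vsval g (rval u))).
  by apply: (lin_comp (hr.2 a0)); lin; apply: lin_rval; lin.
move=> h u; rewrite !(linfun_lin hl); apply: rval_inj.
rewrite !rval_act !rval_proj rhomP -!modactME.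
by rewrite -[pure a0 1 f0]/(corner 1) !corner_mul mul1r mulr1.
Defined.
Lemma rmapE (M N : fdmod B) (g : rhom M N) u : rval (vsval (rmap g) u) = vsval g (rval u).
Proof.
have hr := @rproj_bil N.
have hl : lin (fun u : rmod M => rproj a0 (vsval g (rval u))).
  by apply: (lin_comp (hr.2 a0)); lin; apply: lin_rval; lin.
by rewrite /= (linfun_lin hl) rval_proj -rhomP rval_id.
Qed.

(** For M = Hom(A, V), e M consists of the maps f0(·) v, and the value at a0
    recovers v. *)
Definition runit_map V : rhom (rmod (F V)) V.
Proof.
apply: (@mkhom _ _ (rmod (F V)) V (linfun (fun u : rmod (F V) => (rval u)⟨a0⟩))).
have hl : lin (fun u : rmod (F V) => (rval u)⟨a0⟩) by lin; apply: lin_rval; lin.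
move=> h u; rewrite !(linfun_lin hl) rval_act ev_pure.
by rewrite f0a0 scale1r.
Defined.
Lemma runit_mapE V u : vsval (runit_map V) u = (rval u)⟨a0⟩.
Proof.
have hl : lin (fun u : rmod (F V) => (rval u)⟨a0⟩) by lin; apply: lin_rval; lin.
exact: (linfun_lin hl).
Qed.
Lemma runit_map_iso V : exists2 g, rcomp g (runit_map V) = rid _ & rcomp (runit_map V) g = rid _.
Proof.
have hi := @ifun_bil _ _ _ _ _ hx hα V.
have hr := @rproj_bil (F V).
apply: (riso (g := fun v => rproj a0 (ifun hx hα f0 v))).
- by apply: (lin_comp (hr.2 a0)); exact: (hi.2 f0).
- by move=> v; rewrite runit_mapE rval_proj ev_pure ifunE modact1E f0a0 !scale1r.
move=> u; apply: rval_inj; rewrite rval_proj; apply: ev_ext => c.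
rewrite runit_mapE ev_pure ifunE modact1E f0a0 scale1r -[in RHS]rval_id ev_pure.
by rewrite modact1E.
Qed.

Section Evaluation.
Variable M : fdmod B.
(** On A^* ⊗ e M this is f ⊗ u |-> (a0 ⊗ 1 ⊗ f) u. *)
Definition reval_fun (φ : F (rmod M)) : M :=
  \sw_(x1, x2 <- x) (pure a0 1 (rharp x2 α) • rval φ⟨x1⟩).
Lemma reval_lin : lin reval_fun.
Proof.
rewrite /reval_fun; apply: lin_swr => x1 x2; apply: lin_lf; apply: lin_rval.
exact: (lin_evl _ (@lin_id _ (F (rmod M)))).
Qed.
Lemma rval_ev_lin (φ : F (rmod M)) : lin (fun c => rval φ⟨c⟩).
Proof. apply: lin_rval; lin. Qed.

Lemma reval_act b φ : reval_fun (b • φ) = b • reval_fun φ.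
Proof.
have hl : lin (fun b : B => reval_fun (b • φ)) by apply: (lin_comp reval_lin); lin.
have hr : lin (fun b : B => b • reval_fun φ) by lin.
move: b; apply: (bpure_ext hl hr) => {hl hr} a h f.
transitivity (pure a0 h f • rval φ⟨a⟩).
  rewrite -[in RHS](rharp_expand hx hα f).
  have hp : lin (fun g => pure a0 h g • rval φ⟨a⟩) by lin.
  rewrite (sw_lin _ _ hp); apply: eq_sw => x1 x2.
  have hu : lin (fun u : rmod M => pure a0 1 (rharp x2 α) • rval u) by lin; apply: lin_rval; lin.
  rewrite ev_pure (linZ hu) rval_act -modactME bpureM f0a0 scale1r mul1r.
  exact: (esym (linZ hp _ _)).
rewrite /reval_fun sw_modact.
have hp : lin (fun c => pure a0 h f • rval φ⟨c⟩) by apply: lin_lf; exact: rval_ev_lin.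
rewrite -(sep_expand hx hα a hp); apply: eq_sw => x1 x2.
rewrite -modactME bpureM mulr1 linfun_lin; last by lin.
by rewrite linearZ scale_lfunE.
Qed.
Definition reval : rhom (F (rmod M)) M.
Proof.
apply: (@mkhom _ _ (F (rmod M)) M (linfun reval_fun)) => b φ.
by rewrite !(linfun_lin reval_lin) reval_act.
Defined.
Lemma revalE φ : vsval reval φ = reval_fun φ.
Proof. exact: (linfun_lin reval_lin). Qed.

Lemma reval_iso : exists2 g, rcomp g reval = rid _ & rcomp reval g = rid _.
Proof.
have hr := @rproj_bil M.
apply: (riso (g := fun m => mkind hx hα (fun a => rproj a m))).
- by apply: lin_mkind; [exact: hr.1 | exact: hr.2].
- move=> m; rewrite revalE /reval_fun -[RHS]modact1E bpure1.
  rewrite (sw_lin _ _ (F := fun b : B => b • m)); last by lin.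
  apply: eq_sw => x1 x2; rewrite (evE _ _ _ (hr.1 m)) rval_proj -modactME bpureM f0a0.
  by rewrite scale1r mul1r.
move=> φ; apply: ev_ext => a; rewrite (evE _ _ _ (hr.1 _)); apply: rval_inj.
rewrite rval_proj revalE /reval_fun sw_modact -[in RHS]rval_id.
have hp : lin (fun c => corner 1 • rval φ⟨c⟩) by apply: lin_lf; exact: rval_ev_lin.
rewrite -(sep_expand hx hα a hp); apply: eq_sw => x1 x2.
rewrite -modactME bpureM mulr1 linfun_lin; last by lin.
by rewrite linearZ scale_lfunE.
Qed.
End Evaluation.
Lemma runit_map_nat U V (f : rhom U V) :
  rcomp (runit_map V) (rmap (imap f)) = rcomp f (runit_map U).
Proof.
by apply: rhom_ext => u; rewrite !rcompE !runit_mapE rmapE imapE.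
Qed.
Lemma reval_nat (M N : fdmod B) (f : rhom M N) :
  rcomp (reval N) (imap (rmap f)) = rcomp f (reval M).
Proof.
apply: rhom_ext => φ; rewrite !rcompE !revalE /reval_fun rsw.
by apply: eq_sw => x1 x2; rewrite rhomP imapE rmapE.
Qed.
End Morita.

Section Equivalence.
Variables (k : fieldType) (H : falgType k) (D : hopfData H) (R : tensor H H).
Hypothesis hH : qt_hopf D R.
Variables (A : falgType k) (act : 'Hom(H, 'End(A))).
Hypothesis hA : module_algebra D act.
Variables (x : tensor A A) (α : 'Hom(A, k^o)).
Hypotheses (hx : symmetric_separability_idempotent x) (hα : sep_counit x α).
Implicit Types U V W : fdmod H.
Local Notation hR := (qt_hopf_weak hH).
Local Notation B := (endoHopf H hx hα).
Variable hB : qt_weak_hopf (hopfB hx hα D R act) (RB hx hα R act).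
Variables (a0 : A) (f0 : 'Hom(A, k^o)).
Hypothesis f0a0 : f0 a0 = 1.

Definition corner_functor : functor (Rep hB) (Rep hR).
Proof.
apply: (@Functor _ (Rep hB) (Rep hR) (fun M : fdmod B => rmod f0a0 M)
  (fun M N (g : rhom M N) => rmap f0a0 g)).
- move=> M N c f g; apply: rhom_ext => u; apply: (@rval_inj _ _ _ _ _ hx hα _ _ f0a0).
  have hl : lin (fun u : rmod f0a0 N => rval u) by exact: (lin_rval (@lin_id _ (rmod f0a0 N))).
  by rewrite rmapE !rhomPE hl !rmapE.
- move=> M; apply: rhom_ext => u; apply: (@rval_inj _ _ _ _ _ hx hα _ _ f0a0).
  by rewrite rmapE !ridE.
move=> L M N f g; apply: rhom_ext => u; apply: (@rval_inj _ _ _ _ _ hx hα _ _ f0a0).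
by rewrite rmapE !rcompE !rmapE.
Defined.

Lemma induction_equivalence : is_equivalence (induction_functor hH hB).
Proof.
exists corner_functor; split.
- exists (fun U : fdmod H => runit_map hx hα f0a0 U).
    by move=> U; exact: runit_map_iso.
  by move=> U V f; exact: runit_map_nat.
exists (fun M : fdmod B => reval f0a0 M).
  by move=> M; exact: reval_iso.
by move=> M N f; exact: reval_nat.
Qed.
End Equivalence.

(** A is nonzero, being unital with 1 different from 0. *)
Lemma dual_pair (k : fieldType) (A : falgType k) :
  exists a0 : A, exists f0 : 'Hom(A, k^o), f0 a0 = 1.
Proof.
have i : 'I_(dim A) := Ordinal (FalgType_proper A).
exists (bvec i), (dbas i); rewrite linfun_lin; last exact: dbas_lin.
by rewrite r2vK mxE !eqxx.
Qed.

Theorem proposition3p7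
    (k : fieldType) (hk : [pchar k] =i pred0)
    (H : falgType k) (D : hopfData H) (R : tensor H H)
    (hH : qt_hopf D R) (hss : semisimple H)
    (A : falgType k) (act : 'Hom(H, 'End(A)))
    (hA : module_algebra D act) (hqc : quantum_commutative R act)
    (x : tensor A A) (hx : symmetric_separability_idempotent x)
    (alpha : 'Hom(A, k^o)) (halpha : sep_counit x alpha) :
  exists hB : qt_weak_hopf (hopfB hx halpha D R act) (RB hx halpha R act),
    braided_equivalent (Rep (qt_hopf_weak hH)) (Rep hB).
Proof.
have hB := RB_qt hH hA hx halpha.
have [a0 [f0 f0a0]] := dual_pair A.
exists hB, (induction_braided hH hA hB); exact: (induction_equivalence hH hB f0a0).
Qed.
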